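(* Let $\mathbb{G}$ be a stratified Lie group and let $\Omega\subset\mathbb{G}$ be a bounded open set. Let $1<p<\infty$, $\beta>0$, $q\ge1$ satisfy $p\le q<\beta+1$, and let $u_0\in S_0^{1,p}(\Omega)\cap L^\infty(\Omega)$ with $u_0\ge0$ and $u_0\not\equiv0$. Then a weak solution $u$ of the initial boundary value problem $$\begin{cases} u_t-\mathcal{L}_p u=-|u|^{\beta-1}u+|u|^{q-2}u, & x\in\Omega,\ t>0,\\ u(t,x)=0, & x\in\partial\Omega,\ t>0,\\ u(0,x)=u_0(x), & x\in\Omega,\end{cases}$$ is globally in $t$-bounded, i.e. $u$ is bounded on $\Omega$ by a constant that is independent of $t>0$.
   Context: A Lie group $\mathbb{G}=(\mathbb{R}^N,\circ)$ is called stratified if: (a) for some decomposition $\mathbb{R}^N=\mathbb{R}^{N_1}\times\dots\times\mathbb{R}^{N_r}$, $N_1+\dots+N_r=N$, for each $\lambda>0$ the dilation $\delta_\lambda(x^{(1)},\dots,x^{(r)})=(\lambda x^{(1)},\dots,\lambda^r x^{(r)})$, $x^{(k)}\in\mathbb{R}^{N_k}$, is an automorphism of $\mathbb{G}$; (b) if $X_1,\dots,X_{N_1}$ are the left-invariant vector fields on $\mathbb{G}$ with $X_j(0)=\frac{\partial}{\partial x_j}|_0$, $j=1,\dots,N_1$, then $\mathrm{rank}(\mathrm{Lie}\{X_1,\dots,X_{N_1}\})=N$ at every $x\in\mathbb{R}^N$, i.e. $X_1,\dots,X_{N_1}$ and their iterated commutators span the whole Lie algebra of $\mathbb{G}$.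 Lebesgue measure $dx$ is the Haar measure of $\mathbb{G}$. The horizontal gradient is $\nabla_H=(X_1,\dots,X_{N_1})$, and the $p$-sub-Laplacian is $\mathcal{L}_p f=\nabla_H\cdot(|\nabla_H f|^{p-2}\nabla_H f)=\sum_{j=1}^{N_1}X_j(|\nabla_H f|^{p-2}X_jf)$, $1<p<\infty$. $S^{1,p}(\Omega)$ is the Sobolev space with norm $J_p(u)=\left(\int_\Omega(|\nabla_H u|^p+|u|^p)\,dx\right)^{1/p}$, and $S_0^{1,p}(\Omega)$ is the completion of $C_0^\infty(\Omega)$ in this norm. For $T>0$ let $Q_T=(0,T)\times\Omega$ and $V=\{v\in L^p(0,T;S_0^{1,p}(\Omega)):\partial_t v\in L^{p'}(0,T;S^{1,p'}(\Omega))\}$, $\frac1p+\frac1{p'}=1$. A weak solution of the problem on $Q_T$ is a function $u\in V\cap C(0,T;L^2(\Omega))$ with $u(0,x)=u_0(x)$ for a.e. $x\in\Omega$ such that $$\iint_{Q_T}\left(\partial_t u\,\varphi+|\nabla_H u|^{p-2}\nabla_H u\cdot\nabla_H\varphi\right)dx\,dt=-\iint_{Q_T}\left(|u|^{\beta-1}u-|u|^{q-2}u\right)\varphi\,dx\,dt$$ for every nonnegative test function $\varphi\in V\cap C(0,T;L^2(\Omega))$. A weak solution for $t>0$ is a function that is a weak solution on $Q_T$ for every $T>0$. *)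

(* Defs.v *)
From HB Require Import structures.
From mathcomp Require Import all_boot all_order all_algebra.
From mathcomp Require Import all_classical all_reals all_analysis.

Set Implicit Arguments.
Unset Strict Implicit.
Unset Printing Implicit Defensive.

Import Order.TTheory GRing.Theory Num.Theory.
Import numFieldNormedType.Exports.

Local Open Scope classical_set_scope.
Local Open Scope ring_scope.

Definition rV_display : measure_display.
Proof. exact: default_measure_display. Qed.

(* The sigma-algebra on row vectors is generated by the coordinates, as the
   library does for tuples; over a realType it is the Borel sigma-algebra. *)
Section measurable_rV.
Context {R : realType} {n : nat}.

Let coors (i : 'I_n) (x : 'rV[R]_n) : R := x ord0 i.

Let rV_set0 : g_sigma_preimage coors set0.
Proof. exact: sigma_algebra0. Qed.

Let rV_setC A : g_sigma_preimage coors A -> g_sigma_preimage coors (~` A).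
Proof. exact: sigma_algebraC. Qed.

Let rV_bigcup (F : _^nat) : (forall i, g_sigma_preimage coors (F i)) ->
  g_sigma_preimage coors (\bigcup_i (F i)).
Proof. exact: sigma_algebra_bigcup. Qed.

HB.instance Definition _ := @isMeasurable.Build rV_display 'rV[R]_n
  (g_sigma_preimage coors) rV_set0 rV_setC rV_bigcup.

Lemma measurable_coor (i : 'I_n) :
  measurable_fun [set: 'rV[R]_n] (fun x : 'rV[R]_n => x ord0 i).
Proof.
move=> _ Y mY; rewrite setTI; apply: sub_sigma_algebra => /=.
rewrite -bigcup_seq/=; exists i => /=; first by rewrite mem_index_enum.
by exists Y => //; rewrite setTI.
Qed.

Lemma measurable_fun_rVP d (T : measurableType d) (f : T -> 'rV[R]_n) :
  measurable_fun [set: T] f <->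
  forall i, measurable_fun [set: T] (fun t => f t ord0 i).
Proof.
split=> [mf i|mf].
  by apply: (@measurableT_comp _ _ _ _ _ _ (fun x : 'rV[R]_n => x ord0 i)) => //;
    exact: measurable_coor.
apply: (@measurability _ _ _ _ _ _
  (\big[setU/set0]_(i < n) preimage_set_system setT (coors i) measurable)) => //.
move=> _ [B + <-]; rewrite -bigcup_seq => -[i _ [A mA <-]].
by rewrite setTI; have := mf i measurableT _ mA; rewrite !setTI.
Qed.
End measurable_rV.

(* The library's canonical instance on [m1 \x m2] is the one for
   subprobabilities, so sigma-finiteness is reproved here. *)
Lemma product_sigma_finite (R : realType) d1 d2 (T1 : measurableType d1)
    (T2 : measurableType d2)
    (m1 : {sigma_finite_measure set T1 -> \bar R})
    (m2 : {sigma_finite_measure set T2 -> \bar R}) :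
  sigma_finite setT (m1 \x m2)%E.
Proof.
have /sigma_finiteP[F [TF ndF Foo]] := sigma_finiteT m1.
have /sigma_finiteP[G [TG ndG Goo]] := sigma_finiteT m2.
exists (fun n => F n `*` G n).
  rewrite -setXTT TF TG predeqE => -[x y]; split.
    move=> [/= [n _ Fnx] [k _ Gky]]; exists (maxn n k) => //; split.
    - by move: x Fnx; exact/subsetPset/ndF/leq_maxl.
    - by move: y Gky; exact/subsetPset/ndG/leq_maxr.
  by move=> [n _ []/= ? ?]; split; exists n.
move=> k; have [? ?] := Foo k; have [? ?] := Goo k.
split; first exact: measurableX.
by rewrite product_measure1E// lte_mul_pinfty// ge0_fin_numE.
Qed.

Lemma sigma_finite_measure_pack (R : realType) d (T : measurableType d)
    (Q : set T -> \bar R) :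
  Q set0 = 0%E -> (forall A, (0 <= Q A)%E) -> semi_sigma_additive Q ->
  sigma_finite setT Q ->
  exists m : {sigma_finite_measure set T -> \bar R}, m = Q :> (set T -> \bar R).
Proof.
move=> Q0 Qge0 Qsig Qfin.
pose mQ := isMeasure.Build _ _ _ Q Q0 Qge0 Qsig.
pose Qm : {measure set T -> \bar R} := HB.pack Q mQ.
pose sQ := Measure_isSigmaFinite.Build _ _ _ Qm Qfin.
pose Qs : {sigma_finite_measure set T -> \bar R} := HB.pack Q mQ sQ.
by exists Qs.
Qed.

Section lebesgue_rV.
Context {R : realType}.

Definition cons_rV n (z : measurableTypeR R * 'rV[R]_n) : 'rV[R]_n.+1 :=
  row_mx (z.1%:M : 'rV[R]_1) z.2.

Fixpoint lebesgue_rV n : set 'rV[R]_n -> \bar R :=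
  match n with
  | 0 => \d_(0 : 'rV[R]_0)
  | n'.+1 =>
    pushforward (@lebesgue_measure R \x @lebesgue_rV n')%E (@cons_rV n')
  end.

Let uncons_rV n (x : 'rV[R]_n.+1) : measurableTypeR R * 'rV[R]_n :=
  (x ord0 ord0, @rsubmx R 1 1 n x).

Let cons_rV0 n (z : measurableTypeR R * 'rV[R]_n) :
  @cons_rV n z ord0 ord0 = z.1.
Proof.
have -> : @ord0 n = @lshift 1 n ord0 by exact/val_inj.
by rewrite /cons_rV (@row_mxEl R 1 1 n) mxE eqxx.
Qed.

Let cons_rVS n (z : measurableTypeR R * 'rV[R]_n) (j : 'I_n) :
  @cons_rV n z ord0 (@rshift 1 n j) = z.2 ord0 j.
Proof. by rewrite /cons_rV (@row_mxEr R 1 1 n). Qed.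

Let cons_rVK n : cancel (@cons_rV n) (@uncons_rV n).
Proof.
move=> [a v]; rewrite /uncons_rV cons_rV0; congr pair.
by apply/rowP => j; rewrite mxE cons_rVS.
Qed.

Let measurable_cons_rV n : measurable_fun [set: _] (@cons_rV n).
Proof.
apply/measurable_fun_rVP => i.
have [->|i0] := eqVneq i ord0.
  by under eq_fun do rewrite cons_rV0; exact: measurable_fst.
have [j ->] : exists j, i = @rshift 1 n j.
  have [j ij|j ij] := @splitP 1 n i; last by exists j; exact/val_inj.
  by exfalso; move/eqP : i0; apply; apply/val_inj; rewrite /= ij ord1.
under eq_fun do rewrite cons_rVS.
by apply: (@measurableT_comp _ _ _ _ _ _ (fun x : 'rV[R]_n => x ord0 j)) => //;
  exact: measurable_coor.
Qed.

Let measurable_uncons_rV n : measurable_fun [set: _] (@uncons_rV n).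
Proof.
apply: measurable_fun_pair; first exact: measurable_coor.
apply/measurable_fun_rVP => i; rewrite /=.
under eq_fun do rewrite mxE.
exact: measurable_coor.
Qed.

Let lebesgue_rV_sfin n :
  exists m : {sigma_finite_measure set 'rV[R]_n -> \bar R},
    m = @lebesgue_rV n :> (set _ -> \bar R).
Proof.
elim: n => [|n [m mE]]; first by exists \d_(0 : 'rV[R]_0).
pose P : {measure set (measurableTypeR R * 'rV[R]_n)%type -> \bar R} :=
  (@lebesgue_measure R \x m)%E.
pose Q := pushforward P (@cons_rV n).
have Q0 : Q set0 = 0%E by exact: (measure0 P).
have Qge0 A : (0 <= Q A)%E by exact: (measure_ge0 P).
have mpre A : measurable A -> measurable (@cons_rV n @^-1` A).
  by move=> mA; rewrite -[X in measurable X]setTI; exact: measurable_cons_rV.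
have Qsig : semi_sigma_additive Q.
  move=> F mF tF mUF; rewrite /Q /pushforward preimage_bigcup.
  apply: (@measure_semi_sigma_additive _ _ _ P); first by move=> k; exact: mpre.
  - apply/trivIsetP => /= i j _ _ ij; rewrite -preimage_setI.
    by move/trivIsetP : tF => /(_ _ _ _ _ ij) ->//; rewrite preimage_set0.
  - by rewrite -preimage_bigcup; exact: mpre.
have Qfin : sigma_finite setT Q.
  have [F FT Ffin] := product_sigma_finite (@lebesgue_measure R) m.
  exists (fun k => @uncons_rV n @^-1` F k).
    by rewrite -preimage_bigcup -FT preimage_setT.
  move=> k; have [mF PF] := Ffin k; split.
    by rewrite -[X in measurable X]setTI; exact: measurable_uncons_rV.
  rewrite /Q /pushforward -comp_preimage (_ : _ \o _ = id)//.
  by apply/funext => z /=; rewrite cons_rVK.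
have [Qs QsE] := sigma_finite_measure_pack Q0 Qge0 Qsig Qfin.
by exists Qs; rewrite QsE /Q /P/= mE; reflexivity.
Qed.

Section instances.
Variable n : nat.

Let lebesgue_rV0 : @lebesgue_rV n set0 = 0%E.
Proof. by have [m <-] := lebesgue_rV_sfin n; exact: measure0. Qed.

Let lebesgue_rV_ge0 A : (0 <= @lebesgue_rV n A)%E.
Proof. by have [m <-] := lebesgue_rV_sfin n; exact: measure_ge0. Qed.

Let lebesgue_rV_sigma_additive : semi_sigma_additive (@lebesgue_rV n).
Proof.
by have [m <-] := lebesgue_rV_sfin n; exact: measure_semi_sigma_additive.
Qed.

HB.instance Definition _ := isMeasure.Build _ _ _ (@lebesgue_rV n)
  lebesgue_rV0 lebesgue_rV_ge0 lebesgue_rV_sigma_additive.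

Let lebesgue_rV_sigma_finite : sigma_finite setT (@lebesgue_rV n).
Proof. by have [m <-] := lebesgue_rV_sfin n; exact: sigma_finiteT. Qed.

HB.instance Definition _ := Measure_isSigmaFinite.Build _ _ _ (@lebesgue_rV n)
  lebesgue_rV_sigma_finite.
End instances.
End lebesgue_rV.

Section smooth.
Context {R : realType}.

Fixpoint Ck {V W : normedModType R} (k : nat) (f : V -> W) : Prop :=
  match k with
  | 0 => continuous f
  | k'.+1 => (forall x, differentiable f x) /\ (forall v, Ck k' ('D_v f))
  end.

Definition smooth {V W : normedModType R} (f : V -> W) := forall k, Ck k f.

Definition support_closure {V : normedModType R} (f : V -> R) : set V :=
  closure [set x | f x != 0].

Definition Cc_infty {V : normedModType R} (U : set V) : set (V -> R) :=
  [set f | [/\ smooth f, compact (support_closure f) &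
               support_closure f `<=` U]].
End smooth.

Section stratified.
Context {R : realType}.

(* [dims] is the sequence N_1, ..., N_r; [reshape_index dims i] is the
   (0-based) block that contains the i-th coordinate. *)
Definition weight (dims : seq nat) (i : 'I_(sumn dims)) : nat :=
  (reshape_index dims i).+1.

Definition dilation (dims : seq nat) (lambda : R) (x : 'rV[R]_(sumn dims)) :
    'rV[R]_(sumn dims) :=
  \row_i (lambda ^+ weight i * x ord0 i).

Lemma head_leq_sumn (dims : seq nat) : (head 0 dims <= sumn dims)%N.
Proof. by case: dims => //= n s; exact: leq_addr. Qed.

Definition horizontal (dims : seq nat) (j : 'I_(head 0%N dims)) :
    'I_(sumn dims) :=
  widen_ord (head_leq_sumn dims) j.

Definition vector_field (n : nat) := 'rV[R]_n -> 'rV[R]_n.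

(* The value at x of the left-invariant vector field which is v at the origin:
   the differential at 0 of the left translation by x, applied to v. *)
Definition left_invariant_field n (op : 'rV[R]_n -> 'rV[R]_n -> 'rV[R]_n)
    (v : 'rV[R]_n) : vector_field n :=
  fun x => 'D_v (op x) 0.

Definition lie_bracket n (X Y : vector_field n) : vector_field n :=
  fun x => 'D_(X x) Y x - 'D_(Y x) X x.

Inductive lie_algebra_generated n (S : set (vector_field n)) :
    vector_field n -> Prop :=
  | Lie_gen X : S X -> lie_algebra_generated S X
  | Lie_zero : lie_algebra_generated S (fun=> 0)
  | Lie_add X Y : lie_algebra_generated S X -> lie_algebra_generated S Y ->
      lie_algebra_generated S (fun x => X x + Y x)
  | Lie_scale (a : R) X : lie_algebra_generated S X ->
      lie_algebra_generated S (fun x => a *: X x)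
  | Lie_bracket X Y : lie_algebra_generated S X ->
      lie_algebra_generated S Y -> lie_algebra_generated S (lie_bracket X Y).

(* The neutral element is fixed by every dilation, hence is the origin. *)
Record stratified_group := StratifiedGroup {
  dims : seq nat;
  dims_neq0 : dims != [::];
  dims_gt0 : all (fun n => (0 < n)%N) dims;
  gop : 'rV[R]_(sumn dims) -> 'rV[R]_(sumn dims) -> 'rV[R]_(sumn dims);
  ginv : 'rV[R]_(sumn dims) -> 'rV[R]_(sumn dims);
  gopA : associative gop;
  gop0x : left_id 0 gop;
  gopx0 : right_id 0 gop;
  gopVx : left_inverse 0 ginv gop;
  gopxV : right_inverse 0 ginv gop;
  gop_smooth : smooth (fun z : 'rV[R]_(sumn dims) * 'rV[R]_(sumn dims) =>
                         gop z.1 z.2);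
  ginv_smooth : smooth ginv;
  dilation_gop : forall lambda : R, 0 < lambda ->
    {morph dilation lambda : x y / gop x y};
  lie_rank : forall x : 'rV[R]_(sumn dims),
    exists Z : 'I_(sumn dims) -> vector_field (sumn dims),
      (forall i, lie_algebra_generated
         [set left_invariant_field gop (delta_mx ord0 (horizontal j)) |
            j in [set: 'I_(head 0%N dims)]] (Z i)) /\
      \rank (\matrix_i Z i x) = sumn dims
}.
End stratified.
Arguments stratified_group : clear implicits.

Section sobolev.
Context {R : realType} (G : stratified_group R).

Definition topdim : nat := sumn (dims G).
Definition hdim : nat := head 0%N (dims G).
Local Notation E := ('rV[R]_topdim).
Local Notation mu := (@lebesgue_rV R topdim).

Definition hfield (j : 'I_hdim) : vector_field topdim :=
  left_invariant_field (@gop R G) (delta_mx ord0 (horizontal j)).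

Definition dotR n (v w : 'rV[R]_n) : R := \sum_j v ord0 j * w ord0 j.

Definition euclid_norm n (v : 'rV[R]_n) : R := Num.sqrt (dotR v v).

Definition Lp (p : \bar R) (Omega : set E) : set (E -> R) :=
  [set f | (f \_ Omega) \in Lfun mu p].

Definition locally_integrable_on (Omega : set E) (f : E -> R) : Prop :=
  forall K, compact K -> K `<=` Omega -> mu.-integrable K (EFin \o f).

(* Lebesgue measure is bi-invariant, so the fields X_j are divergence free and
   the formal adjoint of X_j is - X_j. *)
Definition weak_hgrad (Omega : set E) (u : E -> R) (g : E -> 'rV[R]_hdim) :
    Prop :=
  forall j : 'I_hdim,
    [/\ locally_integrable_on Omega u,
        locally_integrable_on Omega (fun x => g x ord0 j) &
        forall phi, Cc_infty Omega phi ->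
          \int[mu]_(x in Omega) (u x * 'D_(hfield j x) phi x) =
          - \int[mu]_(x in Omega) (g x ord0 j * phi x)].

(* The horizontal gradient, up to a Lebesgue null set. *)
Definition hgrad (Omega : set E) (u : E -> R) : E -> 'rV[R]_hdim :=
  xget (fun=> 0) [set g | weak_hgrad Omega u g].

Definition S1p (p : R) (Omega : set E) : set (E -> R) :=
  [set u | Lp p%:E Omega u /\
     exists g, weak_hgrad Omega u g /\
       forall j, Lp p%:E Omega (fun x => g x ord0 j)].

Definition Jp (p : R) (Omega : set E) (u : E -> R) : \bar R :=
  ((\int[mu]_(x in Omega)
      (euclid_norm (hgrad Omega u x) `^ p + `|u x| `^ p)%:E) `^ p^-1)%E.

(* The completion of C_0^oo(Omega) in the norm J_p, realised as the closure of
   C_0^oo(Omega) in the Banach space S^{1,p}(Omega). *)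
Definition S01p (p : R) (Omega : set E) : set (E -> R) :=
  [set u | S1p p Omega u /\
     exists phi : nat -> E -> R, (forall k, Cc_infty Omega (phi k)) /\
       Jp p Omega (fun x => u x - phi k x) @[k --> \oo] --> 0%E].
End sobolev.

Section bochner.
Context {R : realType} {N : nat}.
Local Notation E := ('rV[R]_N).
Local Notation leb := (@lebesgue_measure R).

Definition cylinder (T : R) (Omega : set E) : set (measurableTypeR R * E) :=
  `]0, T[%classic `*` Omega.

Definition simple_into (B : set (E -> R)) (s : R -> E -> R) : Prop :=
  exists (n : nat) (A : 'I_n -> set (measurableTypeR R)) (b : 'I_n -> E -> R),
    [/\ forall i, measurable (A i), forall i, B (b i) &
        s = fun t x => \sum_(i < n) \1_(A i) t * b i x].

Definition strongly_measurable (B : set (E -> R)) (nrm : (E -> R) -> \bar R)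
    (T : R) (v : R -> E -> R) : Prop :=
  exists s : nat -> R -> E -> R,
    (forall k, simple_into B (s k)) /\
    {ae leb, forall t, 0 < t < T ->
      nrm (fun x => v t x - s k t x) @[k --> \oo] --> 0%E}.

(* L^r(0,T;B) for a space B of functions on Omega with norm [nrm]; its elements
   are represented by functions which are jointly measurable on
   (0,T) x Omega. *)
Definition bochner_L (B : set (E -> R)) (nrm : (E -> R) -> \bar R) (r T : R)
    (Omega : set E) : set (R -> E -> R) :=
  [set v |
    [/\ measurable_fun (cylinder T Omega) (fun z => v z.1 z.2),
        {ae leb, forall t, 0 < t < T -> B (v t)},
        strongly_measurable B nrm T v &
        (\int[leb]_(t in `]0%R, T[) (nrm (v t) `^ r) < +oo)%E]].
End bochner.

Section parabolic.
Context {R : realType} (G : stratified_group R).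
Local Notation E := ('rV[R]_(topdim G)).
Local Notation mu := (@lebesgue_rV R (topdim G)).
Local Notation leb := (@lebesgue_measure R).
Local Notation mu2 := (leb \x mu)%E.

Definition conj_exponent (p : R) : R := p / (p - 1).

Definition time_derivative (T : R) (Omega : set E) (v w : R -> E -> R) : Prop :=
  forall phi : R * E -> R, Cc_infty (cylinder T Omega) phi ->
    \int[mu2]_(z in cylinder T Omega) (v z.1 z.2 * 'D_(1, 0) phi z) =
    - \int[mu2]_(z in cylinder T Omega) (w z.1 z.2 * phi z).

(* Dv is a jointly measurable representative of the horizontal gradient in x. *)
Definition slice_hgrad (T : R) (Omega : set E) (v : R -> E -> R)
    (Dv : R -> E -> 'rV[R]_(hdim G)) : Prop :=
  (forall j, measurable_fun (cylinder T Omega)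
     (fun z => Dv z.1 z.2 ord0 j)) /\
  {ae leb, forall t, 0 < t < T -> weak_hgrad Omega (v t) (Dv t)}.

(* Membership of v in V; the derivatives Dv = grad_H v and v' = d_t v, which
   are determined by v almost everywhere, are carried along explicitly. *)
Definition in_V (p T : R) (Omega : set E) (v : R -> E -> R)
    (Dv : R -> E -> 'rV[R]_(hdim G)) (v' : R -> E -> R) : Prop :=
  let p' := conj_exponent p in
  [/\ bochner_L (S01p p Omega) (Jp p Omega) p T Omega v,
      slice_hgrad T Omega v Dv,
      bochner_L (S1p p' Omega) (Jp p' Omega) p' T Omega v' &
      time_derivative T Omega v v'].

(* Continuity is required on the closed interval, so that v(0) makes sense. *)
Definition C_L2 (T : R) (Omega : set E) (v : R -> E -> R) : Prop :=
  (forall t : R, 0 <= t <= T -> Lp 2%:E Omega (v t)) /\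
  (forall t : R, 0 <= t <= T ->
    ('N[mu]_2%:E [EFin \o ((fun x => v s x - v t x)%R \_ Omega)])%E
      @[s --> within `[0, T]%classic (nbhs t)] --> 0%E).

(* For the integral equation to make sense the right-hand side has to be
   integrable; the left-hand side is, by Hoelder's inequality. *)
Definition weak_solution_on (p beta q T : R) (Omega : set E) (u0 : E -> R)
    (u : R -> E -> R) : Prop :=
  exists (Du : R -> E -> 'rV[R]_(hdim G)) (u' : R -> E -> R),
    [/\ in_V p T Omega u Du u', C_L2 T Omega u,
        {ae mu, forall x, Omega x -> u 0 x = u0 x} &
        forall phi Dphi phi', in_V p T Omega phi Dphi phi' ->
          C_L2 T Omega phi ->
          {ae mu2, forall z, cylinder T Omega z -> 0 <= phi z.1 z.2} ->
          let rhs z := (`|u z.1 z.2| `^ (beta - 1) * u z.1 z.2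
                        - `|u z.1 z.2| `^ (q - 2) * u z.1 z.2) * phi z.1 z.2 in
          mu2.-integrable (cylinder T Omega) (EFin \o rhs) /\
          \int[mu2]_(z in cylinder T Omega)
            (u' z.1 z.2 * phi z.1 z.2
             + euclid_norm (Du z.1 z.2) `^ (p - 2)
               * dotR (Du z.1 z.2) (Dphi z.1 z.2)) =
          - \int[mu2]_(z in cylinder T Omega) rhs z].

Definition weak_solution (p beta q : R) (Omega : set E) (u0 : E -> R)
    (u : R -> E -> R) : Prop :=
  forall T : R, 0 < T -> weak_solution_on p beta q T Omega u0 u.
End parabolic.

(* Main.v *)
(** Let M >= 1 be an essential bound of |u0| and s = 1 or -1.  Where s u > M the
    reaction term has the sign of u, because q < beta + 1; testing the equation
    with cutoff (s u - M), where cutoff is nonnegative, nondecreasing and zero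
    on the negative half-line, therefore gives
      s \int u_t(t) cutoff (s u(t) - M) <= 0   for almost every t.
    This is obtained from the test functions eta(t) psi(x) alone: localizing in
    time yields the equation at almost every t for countably many psi, which
    are built from approximants of u(t) in C_c^oo.

    As u_t is only integrable, the chain rule for \int potential (s u(t) - M),
    potential' = cutoff, is replaced by convexity: its increment on [a, b] is at
    most s \int_a^b \int u_t(t) cutoff (s u(b) - M).  Replacing u(b) by u(t) in
    the cutoff costs little, by continuity of u in L^1 and up to the part of u_t
    above a high level, so that the integral is nonincreasing.  It vanishes at
    t = 0, hence s u <= M at all times. *)

Require Import Defs.
From HB Require Import structures.
From mathcomp Require Import all_boot all_order all_algebra.
From mathcomp Require Import all_classical all_reals all_analysis.
From mathcomp Require Import measurable_realfun.
From mathcomp Require Import ring lra.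

Set Implicit Arguments.
Unset Strict Implicit.
Unset Printing Implicit Defensive.

Import Order.TTheory GRing.Theory Num.Theory.
Import numFieldNormedType.Exports.

Local Open Scope classical_set_scope.
Local Open Scope ring_scope.

(** A product [eta(t) psi(x)] with [psi] in C_c^oo meets every clause of [in_V] by classical
    calculus, and the chain rule is then needed for smooth approximants only. The boundary condition
    enters through this approximation alone: as M >= 0, [cutoff (s phi - M)] vanishes wherever [phi]
    does, so that composition stays inside C_c^oo.

    No growth bound ties the reaction term to the Sobolev norm; its integrability is known only
    against admissible test functions. Hence the limit in the approximants has to be taken in two
    stages, and [cutoff] has to be a product of two smooth factors. The choice [potential x] = x
    exp(-2/x) achieves this: its derivative is such a product, and it is nonnegative, nondecreasing,
    bounded and Lipschitz.

    The singular or degenerate flux passes to the limit by dominated convergence, along approximants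
    whose errors in energy are summable. *)

Section flat.

(** * Smooth functions that are flat at the origin *)

Context {R : realType}.
Implicit Types (P : {poly R}) (x y : R).

(* The functions P(1/x) exp(-1/x), extended by 0 to x <= 0, form a family which
   is closed under differentiation; hence all of them are smooth. *)
Definition flat P x : R := if 0 < x then P.[x^-1] * expR (- x^-1) else 0.

(** With y = 1/x one has dy/dx = - y^2, so that the derivative of P(y) exp(-y) is y^2 (P(y) - P'(y))
    exp(-y). *)
Definition flat_derivative P : {poly R} := 'X^2 * (P - P^`()).

Lemma flat_le0 P x : x <= 0 -> flat P x = 0.
Proof. by rewrite /flat ltNge => ->. Qed.

(** Induction on the polynomial for all rates at once: one half of the rate [a] is spent on the
    polynomial of lower degree, the other half on the new factor y, through y <= (2/a) exp(ay/2). *)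
Lemma horner_le_expR P (a : R) : 0 < a ->
  exists2 C, 0 <= C & forall y, 0 <= y -> `|P.[y]| <= C * expR (a * y).
Proof.
elim/poly_ind: P a => [|P c IH] a a0.
  by exists 0 => // y _; rewrite horner0 normr0 mul0r.
have a20 : 0 < a / 2 by lra.
have [C C0 HC] := IH _ a20.
exists (C * (2 / a) + `|c|).
  by rewrite addr_ge0// mulr_ge0// divr_ge0// ltW.
move=> y y0; rewrite hornerMXaddC (le_trans (ler_normD _ _))//.
rewrite mulrDl lerD//; last first.
  by rewrite ler_peMr// -expR0 ler_expR mulr_ge0// ltW.
rewrite normrM (ger0_norm y0) (_ : expR (a * y) =
  expR (a / 2 * y) * expR (a / 2 * y)); last by rewrite -expRD; congr expR; field.
have h : y <= 2 / a * expR (a / 2 * y).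
  have := expR_ge1Dx (a / 2 * y); set e := expR _ => he.
  rewrite -(@ler_pM2l _ (a / 2))// mulrA (_ : a / 2 * (2 / a) = 1).
    by rewrite mul1r; lra.
  by field; rewrite gt_eqF.
have e0 : 0 <= expR (a / 2 * y) by exact: expR_ge0.
rewrite (_ : C * (2 / a) * _ = C * expR (a / 2 * y) * (2 / a * expR (a / 2 * y)));
  last by ring.
by rewrite ler_pM// HC.
Qed.

Lemma flat_bounded P : exists2 C, 0 <= C & forall x, `|flat P x| <= C.
Proof.
have [C C0 HC] := horner_le_expR P ltr01.
exists C => // x; rewrite /flat; case: ifPn => [x0|_]; last by rewrite normr0.
rewrite normrM (ger0_norm (expR_ge0 _)) expRN ler_pdivrMr ?expR_gt0//.
by rewrite -{2}(mul1r x^-1) HC// invr_ge0 ltW.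
Qed.

(** Boundedness of the member of the family attached to X^2 P is a quadratic bound for [flat P]. The
    added 1 makes the constant positive, so that it can be divided by. *)
Lemma flat_le_sqr P : exists2 C, 0 < C & forall x, `|flat P x| <= C * x ^+ 2.
Proof.
have [C C0 HC] := flat_bounded ('X^2 * P).
exists (C + 1); first by lra.
move=> x; have := HC x; rewrite /flat; case: ifPn => [x0|_]; last first.
  by rewrite normr0 => _; rewrite mulr_ge0 ?sqr_ge0//; lra.
rewrite hornerM hornerXn -mulrA [_ * (P.[_] * _)]mulrC exprVn.
rewrite normrM [X in _ * X]ger0_norm ?invr_ge0 ?sqr_ge0// ler_pdivrMr ?exprn_gt0//.
by move=> /le_trans; apply; rewrite ler_wpM2r ?sqr_ge0//; lra.
Qed.

Global Instance is_derive_flat P x :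
  is_derive x 1 (flat P) (flat (flat_derivative P) x).
Proof.
case: (ltgtP x 0) => [x0|x0|->].
- rewrite (flat_le0 _ (ltW x0)).
  apply: (@near_eq_is_derive _ _ _ (cst 0) _ _ _ 0 _ (is_derive_cst _ _ _)).
  near=> y; rewrite flat_le0//.
  by near: y; exact: lt_le_nbhsl.
- have xN0 : x != 0 by rewrite gt_eqF.
  apply: (@near_eq_is_derive _ _ _ (fun y => P.[y^-1] * expR (- y^-1))).
    near=> y; rewrite /flat ifT//.
    by near: y; exact: lt_nbhsr.
  have dV : is_derive x (1 : R) (fun y : R => y^-1) (- x ^- 2).
    have := @is_deriveV R id x 1 1 xN0 (is_derive_id _ _).
    by rewrite /GRing.scale /= mulr1.
  have d1 := @is_derive1_comp R (horner P) (fun y => y^-1) x _ _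
    (is_derive_poly _ _) dV.
  have d2 := @is_derive1_comp R expR (fun y => - y^-1) x _ _
    (is_derive_expR _) (is_deriveN dV).
  have -> : (fun y => P.[y^-1] * expR (- y^-1)) =
    (horner P \o (fun y => y^-1)) * (expR \o (fun y => - y^-1)) by [].
  apply: is_derive_eq; rewrite /flat x0 /flat_derivative /GRing.scale /=.
  rewrite hornerM hornerXn hornerD hornerN opprK exprVn; ring.
- rewrite flat_le0//.
  (* At the origin the quadratic bound makes the difference quotient at most C |h|; the derivative
     is 0, in agreement with the extension by 0. *)
  have [C C0 HC] := flat_le_sqr P.
  have h : (fun h : R => h^-1 *: (flat P (h + 0) - flat P 0)) @ 0^' --> (0 : R).
    apply/cvgr0Pnorm_le => e e0; near=> h.
    rewrite addr0 (flat_le0 _ (lexx 0)) subr0 /GRing.scale /= normrM.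
    have h0 : h != 0 by near: h; exact: nbhs_dnbhs_neq.
    rewrite normfV ler_pdivrMl ?normr_gt0// (le_trans (HC _))//.
    rewrite -normr_id -real_normK ?num_real// normr_id expr2 mulrCA.
    rewrite ler_wpM2l// -ler_pdivlMl//; near: h.
    apply: dnbhs0_le; rewrite mulr_gt0// invr_gt0//.
  have h' : (fun h : R => h^-1 *: ((flat P \o shift 0) (h *: 1) - flat P 0)) @ 0^'
      --> (0 : R).
    by under eq_fun do rewrite /= [_ *: 1]mulr1.
  split; first by apply/cvg_ex; exists 0.
  exact: (cvg_lim _ h').
Unshelve. all: by end_near. Qed.

Lemma flat_ge0 P x : (forall y, 0 < y -> 0 <= P.[y]) -> 0 <= flat P x.
Proof.
move=> P0; rewrite /flat; case: ifPn => // x0.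
by rewrite mulr_ge0 ?expR_ge0// P0// invr_gt0.
Qed.

Lemma flat1_gt0 x : 0 < x -> 0 < flat 1 x.
Proof. by rewrite /flat => ->; rewrite hornerC mul1r expR_gt0. Qed.

Lemma flat1_ge0 x : 0 <= flat 1 x.
Proof. by apply: flat_ge0 => y _; rewrite hornerC. Qed.

Lemma flat1_le1 x : flat 1 x <= 1.
Proof.
rewrite /flat; case: ifPn => // x0; rewrite hornerC mul1r -expR0 ler_expR.
by rewrite oppr_le0 invr_ge0 ltW.
Qed.

Lemma derivable_flat P x : derivable (flat P) x 1.
Proof. exact: ex_derive. Qed.

Lemma continuous_flat P : continuous (flat P).
Proof. by move=> x; apply: differentiable_continuous; exact/derivable1_diffP/derivable_flat. Qed.

Lemma flat1_nondecreasing : {homo flat 1 : x y / x <= y}.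
Proof.
move=> x y xy; rewrite {1}/flat; case: ifPn => [x0|_]; last exact: flat1_ge0.
have y0 := lt_le_trans x0 xy.
rewrite /flat y0 !hornerC !mul1r ler_expR lerN2 lef_pV2//.
Qed.

Lemma lipschitz_of_derive (f : R -> R) (df : R -> R) (L : R) :
  (forall x, is_derive x 1 f (df x)) -> (forall x, `|df x| <= L) ->
  forall x y, `|f x - f y| <= L * `|x - y|.
Proof.
move=> fdf dfL x y.
wlog xy : x y / x <= y => [H|].
  have [/H//|/ltW/H] := leP x y; rewrite distrC => /le_trans; apply.
  by rewrite distrC.
have cf : {within `[x, y], continuous f}.
  apply/continuous_subspaceT => z.
  apply: differentiable_continuous; apply/derivable1_diffP.
  exact: (@ex_derive _ _ _ _ _ _ _ (fdf z)).
have [z _ E] := @MVT_segment R f df x y xy (fun z _ => fdf z) cf.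
by rewrite distrC E normrM ler_pM// distrC.
Qed.

End flat.

(** * Calculus of smooth functions *)

Section Ck_theory.
Context {R : realType}.
Implicit Types V W : normedModType R.

Lemma Ck_continuous V W k (f : V -> W) : Ck k f -> continuous f.
Proof. by case: k => // k [df _] x; exact: differentiable_continuous. Qed.

Lemma Ck_succ V W k (f : V -> W) :
  Ck k.+1 f -> (forall x, differentiable f x) /\ (forall v, Ck k ('D_v f)).
Proof. by []. Qed.

Lemma CkS V W k (f : V -> W) : Ck k.+1 f -> Ck k f.
Proof.
elim: k f => [|k IH] f Hf; first exact: Ck_continuous Hf.
by case/Ck_succ: Hf => df Hf; split => // v; apply: IH; exact: Hf.
Qed.

Lemma smooth_differentiable V W (f : V -> W) x : smooth f -> differentiable f x.
Proof. by move=> /(_ 1%N)[]. Qed.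

Lemma smooth_derive V W (f : V -> W) v : smooth f -> smooth ('D_v f).
Proof. by move=> sf k; have /Ck_succ[_] := sf k.+1; exact. Qed.

Lemma smooth_continuous V W (f : V -> W) : smooth f -> continuous f.
Proof. by move=> /(_ 0%N). Qed.

Lemma smooth_derivable V W (f : V -> W) x v : smooth f -> derivable f x v.
Proof. by move=> sf; apply: diff_derivable; exact: smooth_differentiable. Qed.

Lemma Ck_cst V W k (a : W) : Ck k (fun _ : V => a).
Proof.
elim: k a => [|k IH] a; first by move=> x; exact: cvg_cst.
split=> [x|v]; first exact: differentiable_cst.
by rewrite (_ : 'D_v _ = fun=> 0) //; apply/funext => x; exact: derive_cst.
Qed.

Lemma CkD V W k (f g : V -> W) : Ck k f -> Ck k g -> Ck k (fun x => f x + g x).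
Proof.
elim: k f g => [|k IH] f g; first by move=> cf cg x; apply: cvgD; [exact: cf|exact: cg].
move=> /Ck_succ[df Hf] /Ck_succ[dg Hg]; split=> [x|v]; first exact: differentiableD.
rewrite (_ : 'D_v _ = fun x => 'D_v f x + 'D_v g x); first by apply: IH; [exact: Hf|exact: Hg].
by apply/funext => x; apply: deriveD; exact: diff_derivable.
Qed.

Lemma CkM V k (f g : V -> R) : Ck k f -> Ck k g -> Ck k (fun x => f x * g x).
Proof.
elim: k f g => [|k IH] f g; first by move=> cf cg x; apply: cvgM; [exact: cf|exact: cg].
move=> Hf Hg; case/Ck_succ: (Hf) => df Hf'; case/Ck_succ: (Hg) => dg Hg'.
split=> [x|v]; first exact: differentiableM.
rewrite (_ : 'D_v _ = fun x => f x * 'D_v g x + g x * 'D_v f x).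
  apply: CkD; apply: IH; [exact: CkS|exact: Hg'|exact: CkS|exact: Hf'].
by apply/funext => x; apply: deriveM; exact: diff_derivable.
Qed.

Lemma Ck_linear V W k (L : {linear V -> W}) : continuous L -> Ck k L.
Proof.
case: k => // k cL; split=> [x|v]; first exact: linear_differentiable.
rewrite (_ : 'D_v L = fun=> L v); first exact: Ck_cst.
by apply/funext => x; rewrite deriveE ?diff_lin//; exact: linear_differentiable.
Qed.

Lemma derive_comp_linear V W V' (L : {linear V' -> V}) (f : V -> W) x v :
  continuous L -> differentiable f (L x) ->
  'D_v (f \o L) x = 'D_(L v) f (L x).
Proof.
move=> cL df; have dL : differentiable L x by exact: linear_differentiable.
rewrite !deriveE//; last exact: differentiable_comp.
by rewrite diff_comp// diff_lin.
Qed.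

Lemma Ck_comp_linear V W V' k (L : {linear V' -> V}) (f : V -> W) :
  continuous L -> Ck k f -> Ck k (f \o L).
Proof.
move=> cL; elim: k f => [|k IH] f.
  by move=> cf x; apply: continuous_comp; [exact: cL|exact: cf].
move=> /Ck_succ[df Hf]; split=> [x|v].
  by apply: differentiable_comp => //; exact: linear_differentiable.
rewrite (_ : 'D_v _ = 'D_(L v) f \o L); first by apply: IH; exact: Hf.
by apply/funext => x; exact: derive_comp_linear.
Qed.

Lemma derive_linear_comp V W W' (L : {linear W -> W'}) (f : V -> W) x v :
  continuous L -> differentiable f x -> 'D_v (L \o f) x = L ('D_v f x).
Proof.
move=> cL df; have dL : differentiable L (f x) by exact: linear_differentiable.
rewrite !deriveE//; last exact: differentiable_comp.
by rewrite diff_comp// diff_lin.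
Qed.

Lemma Ck_linear_comp V W W' k (L : {linear W -> W'}) (f : V -> W) :
  continuous L -> Ck k f -> Ck k (L \o f).
Proof.
move=> cL; elim: k f => [|k IH] f.
  by move=> cf x; apply: continuous_comp; [exact: cf|exact: cL].
move=> /Ck_succ[df Hf]; split=> [x|v].
  by apply: differentiable_comp => //; exact: linear_differentiable.
rewrite (_ : 'D_v _ = L \o 'D_v f); first by apply: IH; exact: Hf.
by apply/funext => x; exact: derive_linear_comp.
Qed.

Lemma derive_real_comp V (g : R -> R) (f : V -> R) x v :
  differentiable g (f x) -> differentiable f x ->
  'D_v (fun x => g (f x)) x = 'D_1 g (f x) * 'D_v f x.
Proof.
move=> dg df; rewrite [LHS]deriveE; last exact: differentiable_comp.
rewrite diff_comp// deriv1E; last exact/derivable1_diffP.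
by rewrite /= -deriveE// derive1E mulrC.
Qed.

(** The outer function is generalized in the induction: the derivative is g'(f) times the derivative
    of f, where g' is smooth again and f only has to be known to the lower order. *)
Lemma Ck_real_comp V k (g : R -> R) (f : V -> R) :
  smooth g -> Ck k f -> Ck k (fun x => g (f x)).
Proof.
elim: k f g => [|k IH] f g.
  move=> sg cf x; apply: (@continuous_comp _ _ _ f g); first exact: cf.
  exact: smooth_continuous sg _.
move=> sg Hf; case/Ck_succ: (Hf) => df Hf'; split=> [x|v].
  by apply: differentiable_comp => //; exact: smooth_differentiable.
rewrite (_ : 'D_v _ = fun x => 'D_1 g (f x) * 'D_v f x).
  apply: CkM; last exact: Hf'.
  by apply: (IH f ('D_1 g)); [exact: smooth_derive|exact: CkS].
apply/funext => x; apply: derive_real_comp => //; exact: smooth_differentiable.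
Qed.

Lemma smooth_cst V W (a : W) : smooth (fun _ : V => a).
Proof. by move=> k; exact: Ck_cst. Qed.

Lemma smoothD V W (f g : V -> W) : smooth f -> smooth g ->
  smooth (fun x => f x + g x).
Proof. by move=> sf sg k; exact: CkD. Qed.

Lemma smoothM V (f g : V -> R) : smooth f -> smooth g ->
  smooth (fun x => f x * g x).
Proof. by move=> sf sg k; exact: CkM. Qed.

Lemma smooth_real_comp V (g : R -> R) (f : V -> R) : smooth g -> smooth f ->
  smooth (fun x => g (f x)).
Proof. by move=> sg sf k; exact: Ck_real_comp. Qed.

Lemma smooth_linear V W (L : {linear V -> W}) : continuous L -> smooth L.
Proof. by move=> cL k; exact: Ck_linear. Qed.

Lemma smooth_id V : smooth (@id V).
Proof. by apply: (@smooth_linear V V idfun) => x; exact: cvg_id. Qed.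

Lemma smooth_comp_linear V W V' (L : {linear V' -> V}) (f : V -> W) :
  continuous L -> smooth f -> smooth (f \o L).
Proof. by move=> cL sf k; exact: Ck_comp_linear. Qed.

Lemma smooth_linear_comp V W W' (L : {linear W -> W'}) (f : V -> W) :
  continuous L -> smooth f -> smooth (L \o f).
Proof. by move=> cL sf k; exact: Ck_linear_comp. Qed.

Lemma smooth_sum V (I : Type) (r : seq I) (f : I -> V -> R) :
  (forall i, smooth (f i)) -> smooth (fun x => \sum_(i <- r) f i x).
Proof.
move=> sf; elim: r => [|i r IH].
  by under eq_fun do rewrite big_nil; exact: smooth_cst.
by under eq_fun do rewrite big_cons; exact: smoothD.
Qed.

Lemma smooth_prod V (I : Type) (r : seq I) (f : I -> V -> R) :
  (forall i, smooth (f i)) -> smooth (fun x => \prod_(i <- r) f i x).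
Proof.
move=> sf; elim: r => [|i r IH].
  by under eq_fun do rewrite big_nil; exact: smooth_cst.
by under eq_fun do rewrite big_cons; exact: smoothM.
Qed.

Lemma derive_real (f : R -> R) (df : R -> R) :
  (forall x : R, is_derive x (1 : R) f (df x)) -> forall v : R, 'D_v f = fun x => v * df x.
Proof.
move=> fdf v; apply/funext => x.
have dfx : derivable f x 1 by exact: (@ex_derive _ _ _ _ _ _ _ (fdf x)).
rewrite deriveE; last exact/derivable1_diffP.
by rewrite deriv1E// derive1E (@derive_val _ _ _ _ _ _ _ (fdf x)).
Qed.

Lemma smooth_flat (P : {poly R}) : smooth (flat P).
Proof.
move=> k; elim: k P => [|k IH] P; first exact: continuous_flat.
split=> [x|v]; first exact/derivable1_diffP/derivable_flat.
rewrite (derive_real (is_derive_flat P)).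
by apply: CkM; [exact: Ck_cst|exact: IH].
Qed.

Lemma smooth_affine (a b : R) : smooth (fun x : R => a * x + b).
Proof.
by apply: smoothD; [apply: smoothM; [exact: smooth_cst|exact: smooth_id]|exact: smooth_cst].
Qed.

Lemma smooth_fst V W W' (f : V -> W') : smooth f ->
  smooth (fun z : V * W => f z.1).
Proof.
by move=> sf; apply: (@smooth_comp_linear _ _ _ (fst : {linear (V * W)%type -> V})) => // x;
  exact: cvg_fst.
Qed.

Lemma smooth_snd V W W' (f : W -> W') : smooth f ->
  smooth (fun z : V * W => f z.2).
Proof.
by move=> sf; apply: (@smooth_comp_linear _ _ _ (snd : {linear (V * W)%type -> W})) => // x;
  exact: cvg_snd.
Qed.

Lemma smooth_coord n (i : 'I_n) : smooth (fun x : 'rV[R]_n => x ord0 i).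
Proof.
have lin : linear (fun x : 'rV[R]_n => x ord0 i : R) by move=> a x y; rewrite !mxE.
pose m := GRing.isLinear.Build _ _ _ _ _ lin.
pose L : {linear 'rV[R]_n -> R} := HB.pack (fun x : 'rV[R]_n => x ord0 i) m.
by apply: (@smooth_linear _ _ L); exact: coord_continuous.
Qed.

Lemma derive_coord V n (f : V -> 'rV[R]_n) (i : 'I_n) x v : differentiable f x ->
  'D_v (fun x => f x ord0 i) x = 'D_v f x ord0 i.
Proof.
have lin : linear (fun x : 'rV[R]_n => x ord0 i : R) by move=> a y z; rewrite !mxE.
pose m := GRing.isLinear.Build _ _ _ _ _ lin.
pose L : {linear 'rV[R]_n -> R} := HB.pack (fun x : 'rV[R]_n => x ord0 i) m.
by move=> df; apply: (derive_linear_comp (L := L)) => //; exact: coord_continuous.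
Qed.

Lemma derive_rV n (f : 'rV[R]_n -> R) x (v : 'rV[R]_n) : differentiable f x ->
  'D_v f x = \sum_i v ord0 i * 'D_(delta_mx ord0 i) f x.
Proof.
move=> df; rewrite deriveE// {1}(row_sum_delta v) linear_sum.
by apply: eq_bigr => i _; rewrite linearZ deriveE.
Qed.

Lemma smooth_derive_field n (f : 'rV[R]_n -> R) (X : 'rV[R]_n -> 'rV[R]_n) :
  smooth f -> (forall i, smooth (fun x => X x ord0 i)) ->
  smooth (fun x => 'D_(X x) f x).
Proof.
move=> sf sX; under eq_fun do rewrite (derive_rV _ (smooth_differentiable _ sf)).
by apply: smooth_sum => i; apply: smoothM => //; exact: smooth_derive.
Qed.

End Ck_theory.

(** * Open sets and the coordinate sigma-algebra *)

Section second_countable.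
Context {R : realType}.

(** Second countability relative to a dense family of centres. A radius below e/2 suffices: a ball
    of that radius which contains x lies in the ball of radius e about x. Balls that are not inside
    U are replaced by the empty set, so that the index type does not depend on U. *)
Lemma open_bigcup_balls (T : pseudoMetricType R) (I : Type) (c : I -> T) :
  (forall x e, 0 < e -> exists i, ball (c i) e x) ->
  forall U : set T, open U ->
  U = \bigcup_(k : I * nat)
        (if `[< ball (c k.1) k.2.+1%:R^-1 `<=` U >]
         then ball (c k.1) k.2.+1%:R^-1 else set0).
Proof.
move=> cI U oU; apply/seteqP; split=> x; last first.
  by move=> [[i n] _] /=; case: asboolP => // h /h.
move=> Ux; have /nbhs_ballP[e /= e0 he] := open_nbhs_nbhs (conj oU Ux).
have [n hn] : exists n : nat, n.+1%:R^-1 < e / 2.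
  near \oo => n; exists n; near: n.
  exact: (near_infty_natSinv_lt (PosNum (divr_gt0 e0 (ltr0n _ 2)))).
have n0 : 0 < n.+1%:R^-1 :> R by rewrite invr_gt0.
have [i hi] := cI x _ n0.
exists (i, n) => //=; rewrite ifT//; apply/asboolP => y hy; apply: he.
apply: (@le_ball _ _ _ (n.+1%:R^-1 + n.+1%:R^-1)); first by move: hn; set r := _^-1; lra.
by apply: ball_triangle hy; exact: ball_sym.
Unshelve. all: by end_near. Qed.

Lemma ball_rV n (x : 'rV[R]_n) (e : R) : 0 < e ->
  ball x e = [set y | forall j, ball (x ord0 j) e (y ord0 j)].
Proof.
move=> e0; apply/seteqP; split=> y; first by move=> [_ h] j; exact: h.
by move=> h; split => // i j; rewrite (ord1 i); exact: h.
Qed.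

Lemma measurable_ballR (x e : R) : measurable (ball x e : set R).
Proof. by rewrite ball_itv; exact: measurable_itv. Qed.

Lemma measurable_ball_rV n (x : 'rV[R]_n) (e : R) :
  0 < e -> measurable (ball x e).
Proof.
move=> e0; rewrite ball_rV//.
rewrite (_ : (fun _ => _) =
  \bigcap_(j in [set: 'I_n]) ((fun y : 'rV[R]_n => y ord0 j) @^-1` ball (x ord0 j) e)).
  apply: fin_bigcap_measurable => // j _; rewrite -[X in measurable X]setTI.
  exact: measurable_coor (measurable_ballR _ _).
by apply/seteqP; split=> y h j; [move=> _|]; apply: h.
Qed.

Lemma exists_rat_ball (x e : R) : 0 < e -> exists q : rat, ball (ratr q : R) e x.
Proof.
move=> e0; have [|q hq] := @rat_in_itvoo R (x - e) (x + e); first by lra.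
exists q; rewrite ball_itv /= in_itv /=; move: hq; rewrite in_itv /=; lra.
Qed.

Lemma exists_rat_ball_rV n (x : 'rV[R]_n) (e : R) : 0 < e ->
  exists q : 'rV[rat]_n, ball (map_mx ratr q : 'rV[R]_n) e x.
Proof.
move=> e0; have /choice[q hq] := fun j => exists_rat_ball (x ord0 j) e0.
by exists (\row_j q j); rewrite ball_rV// => j; rewrite !mxE; exact: hq.
Qed.

(** The sigma-algebra is generated by coordinates. Balls of the maximum norm are finite
    intersections of coordinate conditions, and an open set is a countable union of such balls with
    rational centres. *)
Lemma open_measurable_rV n (U : set 'rV[R]_n) : open U -> measurable U.
Proof.
move=> oU; rewrite (open_bigcup_balls (c := fun q : 'rV[rat]_n => map_mx ratr q : 'rV[R]_n) _ oU).
  apply: countable_bigcupT_measurable; first exact: countableP.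
  move=> [q k] /=; case: ifPn => _; last exact: measurable0.
  by apply: measurable_ball_rV; rewrite invr_gt0.
by move=> x e e0; exact: exists_rat_ball_rV.
Qed.

Lemma open_measurable_prod_rV n (U : set (measurableTypeR R * 'rV[R]_n)) :
  open (U : set (R * 'rV[R]_n)) -> measurable U.
Proof.
move=> oU; rewrite (@open_bigcup_balls (R * 'rV[R]_n)%type (rat * 'rV[rat]_n)%type
  (fun q => (ratr q.1, map_mx ratr q.2)) _ _ oU).
  apply: countable_bigcupT_measurable; first exact: countableP.
  move=> [q k] /=; case: ifPn => _; last exact: measurable0.
  apply: (measurableX (measurable_ballR _ _)).
  by apply: measurable_ball_rV; rewrite invr_gt0.
move=> x e e0; have [q1 h1] := exists_rat_ball x.1 e0.
by have [q2 h2] := exists_rat_ball_rV x.2 e0; exists (q1, q2).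
Qed.

Lemma closed_measurable_rV n (U : set 'rV[R]_n) : closed U -> measurable U.
Proof. by move=> cU; rewrite -[U]setCK; apply: measurableC; apply: open_measurable_rV; exact: closed_openC. Qed.

Lemma continuous_measurable_rV n (f : 'rV[R]_n -> R) :
  continuous f -> measurable_fun [set: 'rV[R]_n] f.
Proof.
move=> /continuousP cf; apply: (measurability _ (RGenOpens.measurableE R)).
move=> _ [_ [a [b ->] <-]]; rewrite setTI; apply: open_measurable_rV.
by apply: cf; exact: interval_open.
Qed.

Lemma continuous_measurable_prod_rV n (f : measurableTypeR R * 'rV[R]_n -> R) :
  continuous (f : R * 'rV[R]_n -> R) -> measurable_fun setT f.
Proof.
move=> /continuousP cf; apply: (measurability _ (RGenOpens.measurableE R)).
move=> _ [_ [a [b ->] <-]]; rewrite setTI; apply: open_measurable_prod_rV.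
by apply: cf; exact: interval_open.
Qed.

End second_countable.

(** * Lebesgue measure of bounded sets *)

Section lebesgue_rV_theory.
Context {R : realType}.
Local Notation leb := (@lebesgue_measure R).

Lemma bounded_image_le (T : Type) (V : normedModType R) (f : T -> V) (A : set T) :
  [bounded f x | x in A] -> exists2 C : R, 0 < C & forall x, A x -> `|f x| <= C.
Proof. by move=> /pinfty_ex_gt0[C C0 h]; exists C. Qed.

Lemma le_bounded_image (T : Type) (V : normedModType R) (f : T -> V) (A : set T) (C : R) :
  (forall x, A x -> `|f x| <= C) -> [bounded f x | x in A].
Proof.
move=> h; exists C; split; first exact: num_real.
by move=> M CM x Ax; apply: le_trans (h x Ax) _; exact: ltW.
Qed.

Lemma le_coord_norm n (x : 'rV[R]_n) i : `|x ord0 i| <= `|x|.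
Proof.
rewrite [leRHS]/Num.norm /= mx_normrE.
by rewrite -[X in X <= _]/((fun k : 'I_1 * 'I_n => `|x k.1 k.2|) (ord0, i)); exact: le_bigmax.
Qed.

Lemma norm_rV_le n (x : 'rV[R]_n) (c : R) : 0 <= c ->
  (forall i, `|x ord0 i| <= c) -> `|x| <= c.
Proof.
move=> c0 h; rewrite /Num.norm /= mx_normrE; apply: bigmax_le => // -[i j] _ /=.
by rewrite (ord1 i).
Qed.

Lemma cons_rV_ord0 n (z : measurableTypeR R * 'rV[R]_n) : cons_rV z ord0 ord0 = z.1.
Proof.
have -> : @ord0 n = @lshift 1 n ord0 by exact/val_inj.
by rewrite /cons_rV (@row_mxEl R 1 1 n) mxE eqxx.
Qed.

Lemma cons_rV_lift n (z : measurableTypeR R * 'rV[R]_n) (j : 'I_n) :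
  cons_rV z ord0 (lift ord0 j) = z.2 ord0 j.
Proof.
have -> : lift ord0 j = @rshift 1 n j by exact/val_inj.
by rewrite /cons_rV (@row_mxEr R 1 1 n).
Qed.

Lemma measurable_cons_rV n : measurable_fun [set: _] (@cons_rV R n).
Proof.
apply/measurable_fun_rVP => i.
have [j ->|->] := unliftP ord0 i.
  under eq_fun do rewrite cons_rV_lift.
  by apply: (@measurableT_comp _ _ _ _ _ _ (fun x : 'rV[R]_n => x ord0 j)) => //;
    exact: measurable_coor.
by under eq_fun do rewrite cons_rV_ord0; exact: measurable_fst.
Qed.

Lemma norm_cons_ge1 n (z : measurableTypeR R * 'rV[R]_n) : `|z.1 : R| <= `|cons_rV z|.
Proof. by rewrite -[in X in X <= _](cons_rV_ord0 z) le_coord_norm. Qed.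

Lemma norm_cons_ge2 n (z : measurableTypeR R * 'rV[R]_n) : `|z.2| <= `|cons_rV z|.
Proof.
by apply: norm_rV_le => // i; rewrite -(cons_rV_lift z) le_coord_norm.
Qed.

Lemma closed_ball_norm (V : normedModType R) (c : R) : closed [set x : V | `|x| <= c].
Proof.
rewrite (_ : [set x | _] = (@Num.norm R V) @^-1` [set y | y <= c])//.
by apply: closed_comp => [x _|]; [exact: norm_continuous|exact: closed_le].
Qed.

Lemma measurable_ball_norm n (c : R) : measurable [set x : 'rV[R]_n | `|x| <= c].
Proof. by apply: closed_measurable_rV; exact: closed_ball_norm. Qed.

Lemma measurable_itv_norm (c : R) : measurable [set t : measurableTypeR R | `|t : R| <= c].
Proof.
rewrite (_ : [set t | _] = [set` `[- c, c]]); first exact: measurable_itv.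
by apply/seteqP; split => t /=; rewrite in_itv /= ler_norml.
Qed.

Lemma lebesgue_rVS n (A : set 'rV[R]_n.+1) :
  lebesgue_rV A = (leb \x @lebesgue_rV R n)%E (@cons_rV R n @^-1` A).
Proof. by []. Qed.

Lemma lebesgue_itv_norm_lty (c : R) : (leb [set t : measurableTypeR R | (`|t : R| <= c)%R] < +oo)%E.
Proof.
rewrite (_ : [set t | _] = [set` `[- c, c]]).
  by rewrite lebesgue_measure_itv /=; case: ifPn => _; rewrite ltry.
by apply/seteqP; split => t /=; rewrite in_itv /= ler_norml.
Qed.

(** In the maximum norm a ball, read through [cons_rV], is contained in an interval times a ball of
    one dimension less. The induction starts from the Dirac mass in dimension 0. *)
Lemma lebesgue_ball_norm_lty n (c : R) :
  (lebesgue_rV [set x : 'rV[R]_n | (`|x| <= c)%R] < +oo)%E.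
Proof.
elim: n => [|n IH].
  by rewrite /= diracE; case: (_ \in _); rewrite ltry.
rewrite lebesgue_rVS.
apply: (@le_lt_trans _ _ ((leb \x @lebesgue_rV R n)%E
   ([set t : measurableTypeR R | (`|t : R| <= c)%R] `*` [set x : 'rV[R]_n | (`|x| <= c)%R]))).
  apply: le_measure; rewrite ?inE.
  - by rewrite -[X in measurable X]setTI; apply: measurable_cons_rV => //; exact: measurable_ball_norm.
  - by apply: measurableX; [exact: measurable_itv_norm|exact: measurable_ball_norm].
  - by move=> z /= h; split => /=; apply: le_trans h; [exact: norm_cons_ge1|exact: norm_cons_ge2].
rewrite product_measure1E; [|exact: measurable_itv_norm|exact: measurable_ball_norm].
by rewrite lte_mul_pinfty// ?ge0_fin_numE//; exact: lebesgue_itv_norm_lty.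
Qed.

Lemma bounded_lebesgue_lty n (A : set 'rV[R]_n) :
  measurable A -> bounded_set A -> (lebesgue_rV A < +oo)%E.
Proof.
move=> mA /bounded_image_le[c _ hc]; apply: le_lt_trans (lebesgue_ball_norm_lty n c).
by apply: le_measure; rewrite ?inE//; exact: measurable_ball_norm.
Qed.

Lemma continuous_support_bounded n (f : 'rV[R]_n -> R) (c : R) : continuous f ->
  (forall x, c < `|x| -> f x = 0) -> exists2 C, 0 <= C & forall x, `|f x| <= C.
Proof.
move=> cf f0.
have cK : compact [set x : 'rV[R]_n | `|x| <= c].
  apply: bounded_closed_compact; last exact: closed_ball_norm.
  exact: (@le_bounded_image _ _ id _ c).
have : compact (f @` [set x : 'rV[R]_n | `|x| <= c]).
  by apply: continuous_compact => //; exact: continuous_subspaceT.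
move=> /compact_bounded/bounded_image_le[C C0 hC]; exists C; first exact: ltW.
move=> x; have [xc|cx] := leP `|x| c.
  by apply: hC; exists x.
by rewrite f0// normr0 ltW.
Qed.

Lemma bounded_measurable_integrable d (T : measurableType d)
    (mu : {measure set T -> \bar R}) (A : set T) (f : T -> R) (C : R) :
  measurable A -> (mu A < +oo)%E -> measurable_fun A f ->
  (forall x, A x -> `|f x| <= C) -> mu.-integrable A (EFin \o f).
Proof.
move=> mA Aoo mf fC; apply: measurable_bounded_integrable => //.
exact: le_bounded_image fC.
Qed.

End lebesgue_rV_theory.

(** * Fubini and Tonelli on a rectangle *)

Section rectangle.
Context d1 d2 (T1 : measurableType d1) (T2 : measurableType d2) (R : realType).
Variables (m1 : {sigma_finite_measure set T1 -> \bar R})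
          (m2 : {sigma_finite_measure set T2 -> \bar R}).
Variables (A : set T1) (B : set T2).
Hypotheses (mA : measurable A) (mB : measurable B).
Local Open Scope ereal_scope.

Let mAB : measurable (A `*` B). Proof. exact: measurableX. Qed.

Lemma patch_rectangle_in (W : pointedType) (f : T1 * T2 -> W) t x : A t ->
  (f \_ (A `*` B)) (t, x) = ((fun y => f (t, y)) \_ B) x.
Proof.
move=> At; rewrite !patchE; congr (if _ then _ else _).
by apply/idP/idP; rewrite !inE; [move=> []|split].
Qed.

Lemma patch_rectangle_out (W : pointedType) (f : T1 * T2 -> W) t x : ~ A t ->
  (f \_ (A `*` B)) (t, x) = point.
Proof. by move=> At; rewrite patchE memNset// => -[]. Qed.

Lemma tonelli_rectangle_measurable (f : T1 * T2 -> \bar R) :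
  measurable_fun (A `*` B) f -> (forall z, (A `*` B) z -> 0 <= f z) ->
  measurable_fun A (fun t => \int[m2]_(x in B) f (t, x)).
Proof.
move=> mf f0; have := mf; rewrite -{1}(setTI (A `*` B)).
move=> /(measurable_restrict f mAB measurableT) mf'.
have f0' z : 0 <= (f \_ (A `*` B)) z.
  by rewrite patchE; case: ifPn => //; rewrite inE => /f0.
have := @measurable_fun_fubini_tonelli_F _ _ _ _ _ m2 _ mf' f0'.
move=> /(measurable_funS measurableT (@subsetT _ A)) => h.
apply: eq_measurable_fun h => t; rewrite inE => At.
rewrite /fubini_F [RHS]integral_mkcond; apply: eq_integral => x _.
exact: patch_rectangle_in.
Qed.

Lemma tonelli_rectangle (f : T1 * T2 -> \bar R) :
  measurable_fun (A `*` B) f -> (forall z, (A `*` B) z -> 0 <= f z) ->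
  \int[m1 \x m2]_(z in A `*` B) f z = \int[m1]_(t in A) \int[m2]_(x in B) f (t, x).
Proof.
move=> mf f0; have := mf; rewrite -{1}(setTI (A `*` B)).
move=> /(measurable_restrict f mAB measurableT) mf'.
have f0' z : 0 <= (f \_ (A `*` B)) z.
  by rewrite patchE; case: ifPn => //; rewrite inE => /f0.
rewrite integral_mkcond fubini_tonelli1//; rewrite [RHS]integral_mkcond.
apply: eq_integral => t _; rewrite /fubini_F patchE; case: ifPn; rewrite ?(inE, notin_setE) => At.
  by rewrite [RHS]integral_mkcond; apply: eq_integral => x _; exact: patch_rectangle_in.
by rewrite integral0_eq// => x _; exact: patch_rectangle_out.
Qed.

Section fubini.
Variable f : T1 * T2 -> R.
Hypothesis intf : (m1 \x m2).-integrable (A `*` B) (EFin \o f).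

Let f' := (EFin \o f) \_ (A `*` B).
Let intf' : (m1 \x m2).-integrable setT f'.
Proof. exact/(integrable_mkcond _ mAB). Qed.

Let FE t : A t -> fubini_F m2 f' t = \int[m2]_(x in B) (f (t, x))%:E.
Proof.
move=> At; rewrite /fubini_F [RHS]integral_mkcond; apply: eq_integral => x _.
by rewrite /f' patch_rectangle_in.
Qed.

Let FE0 t : ~ A t -> fubini_F m2 f' t = 0.
Proof.
by move=> At; rewrite /fubini_F integral0_eq// => x _; rewrite /f' patch_rectangle_out.
Qed.

Let GE x : B x -> fubini_G m1 f' x = \int[m1]_(t in A) (f (t, x))%:E.
Proof.
move=> Bx; rewrite /fubini_G [RHS]integral_mkcond; apply: eq_integral => t _.
rewrite /f' !patchE; congr (if _ then _ else _).
by apply/idP/idP; rewrite !inE; [move=> []|split].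
Qed.

Let GE0 x : ~ B x -> fubini_G m1 f' x = 0.
Proof.
move=> Bx; rewrite /fubini_G integral0_eq// => t _.
by rewrite /f' patchE memNset// => -[].
Qed.

Lemma ae_integrable_slice :
  {ae m1, forall t, A t -> m2.-integrable B (EFin \o (fun x => f (t, x)))}.
Proof.
have := ae_integrable1 intf'; apply: filterS => t ht At.
apply/(integrable_mkcond _ mB); move: ht; congr (integrable _ _ _).
by apply/funext => x; rewrite /f' patch_rectangle_in.
Qed.

Lemma ae_integrable_slice2 :
  {ae m2, forall x, B x -> m1.-integrable A (EFin \o (fun t => f (t, x)))}.
Proof.
have := ae_integrable2 intf'; apply: filterS => x hx Bx.
apply/(integrable_mkcond _ mA); move: hx; congr (integrable _ _ _).
apply/funext => t; rewrite /f' !patchE; congr (if _ then _ else _).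
by apply/idP/idP; rewrite !inE; [move=> []|split].
Qed.

(** Inner integrals in Fubini's theorem are extended reals which are finite almost everywhere, so
    that passing to real values changes neither their integrability nor their integral. *)
Lemma integrable_fine d (T : measurableType d) (m : {measure set T -> \bar R})
    (D : set T) (g : T -> \bar R) : measurable D -> m.-integrable D g ->
  m.-integrable D (EFin \o (fine \o g)) /\
  \int[m]_(x in D) g x = \int[m]_(x in D) (fine (g x))%:E.
Proof.
move=> mD ig; have mg := measurable_int _ ig.
have mfg : measurable_fun D (EFin \o (fine \o g)).
  apply/measurable_EFinP; apply: (measurable_comp (F := setT)) => //.
have ifg : m.-integrable D (EFin \o (fine \o g)).
  apply: (le_integrable mD mfg _ ig) => x _ /=.
  by case: (g x) => [r| |] //=; rewrite normr0 leey.
split => //; apply: ae_eq_integral => //.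
have := integrable_ae mD ig; apply: filterS => x h Dx /=.
by rewrite fineK//; exact: h.
Qed.

Lemma fubini_rectangle_integrable :
  m1.-integrable A (EFin \o (fun t => \int[m2]_(x in B) f (t, x))%R).
Proof.
have [h _] := integrable_fine measurableT (integrable_fubini_F intf').
have := integrableS measurableT mA (@subsetT _ A) h.
by apply: eq_integrable => // t; rewrite inE => At /=; rewrite FE.
Qed.

Lemma fubini_rectangle :
  (\int[m1 \x m2]_(z in A `*` B) f z = \int[m1]_(t in A) (\int[m2]_(x in B) f (t, x)))%R.
Proof.
rewrite /Rintegral integral_mkcond -/f' -(integral12_prod_meas1 intf').
have [_ ->] := integrable_fine measurableT (integrable_fubini_F intf').
congr fine; rewrite [RHS]integral_mkcond; apply: eq_integral => t _.
rewrite patchE; case: ifPn; rewrite ?(inE, notin_setE) => At; first by rewrite FE.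
by rewrite FE0.
Qed.

(** The absolute value of the slice integral is at most the slice integral of the absolute value,
    and the latter has finite integral by Tonelli. *)
Let integrable_fubini_G : m2.-integrable setT (fubini_G m1 f').
Proof.
have mf' := measurable_int _ intf'.
apply/integrableP; split; first exact: measurable_fubini_G intf'.
apply: le_lt_trans (proj1 (integrable21ltyP m1 m2 mf') intf').
apply: ge0_le_integral => //.
- by apply: measurableT_comp => //; exact: measurable_fubini_G intf'.
- apply: (@measurable_fun_fubini_tonelli_G _ _ _ _ _ m1 (abse \o f')); last by move=> z; exact: abse_ge0.
  exact: measurableT_comp.
- move=> x _; apply: le_abse_integral => //.
  exact: measurable_fun_pair1.
Qed.

Lemma fubini_rectangle_integrable2 :
  m2.-integrable B (EFin \o (fun x => \int[m1]_(t in A) f (t, x))%R).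
Proof.
have [h _] := integrable_fine measurableT integrable_fubini_G.
have := integrableS measurableT mB (@subsetT _ B) h.
by apply: eq_integrable => // x; rewrite inE => Bx /=; rewrite GE.
Qed.

Lemma fubini_rectangle2 :
  (\int[m1 \x m2]_(z in A `*` B) f z = \int[m2]_(x in B) (\int[m1]_(t in A) f (t, x)))%R.
Proof.
rewrite /Rintegral integral_mkcond -/f' -(integral21_prod_meas1 intf').
have [_ ->] := integrable_fine measurableT integrable_fubini_G.
congr fine; rewrite [RHS]integral_mkcond; apply: eq_integral => x _.
rewrite patchE; case: ifPn; rewrite ?(inE, notin_setE) => Bx; first by rewrite GE.
by rewrite GE0.
Qed.
End fubini.
End rectangle.

(** * Integrals of derivatives of compactly supported functions *)

Section integral_derive.
Context {R : realType}.
Local Notation leb := (@lebesgue_measure R).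

(** An identity of difference quotients instead of a chain rule: [A] has to be affine only along
    [v], and no differentiability of [f] is involved. It thus serves slices, projections and
    dilations alike. *)
Lemma growth_rate_affine (V V' W : normedModType R) (A : V' -> V) (f : V -> W) x v w :
  (forall h : R, A (h *: v + x) = h *: w + A x) ->
  (fun h : R => h^-1 *: (((f \o A) \o shift x) (h *: v) - (f \o A) x)) =
  (fun h : R => h^-1 *: ((f \o shift (A x)) (h *: w) - f (A x))).
Proof. by move=> H; apply/funext => h /=; rewrite H. Qed.

Lemma derive_affine (V V' W : normedModType R) (A : V' -> V) (f : V -> W) x v w :
  (forall h : R, A (h *: v + x) = h *: w + A x) ->
  'D_v (f \o A) x = 'D_w f (A x).
Proof. by move=> H; rewrite /derive (growth_rate_affine _ H). Qed.

Lemma derivable_affine (V V' W : normedModType R) (A : V' -> V) (f : V -> W) x v w :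
  (forall h : R, A (h *: v + x) = h *: w + A x) ->
  derivable f (A x) w -> derivable (f \o A) x v.
Proof. by move=> H; rewrite /derivable (growth_rate_affine _ H). Qed.

Lemma open_gt_norm (V : normedModType R) (c : R) : open [set x : V | c < `|x|].
Proof.
rewrite (_ : [set x | _] = (@Num.norm R V) @^-1` [set y | c < y])//.
by apply: open_comp => [x _|]; [exact: norm_continuous|exact: open_gt].
Qed.

Lemma derive_support (V : normedModType R) (f : V -> R) (c : R) v :
  (forall x, c < `|x| -> f x = 0) -> forall x, c < `|x| -> 'D_v f x = 0.
Proof.
move=> f0 x cx; rewrite -(@near_eq_derive _ _ _ (fun=> 0)) ?derive_cst//.
have : open_nbhs x [set x : V | c < `|x|] by split => //; exact: open_gt_norm.
by move/open_nbhs_nbhs; apply: filterS => y /= /f0 ->.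
Qed.

Lemma integrable_setT_support d (T : measurableType d)
    (mu : {measure set T -> \bar R}) (A : set T) (f : T -> R) :
  measurable A -> (forall x, ~ A x -> f x = 0) ->
  mu.-integrable A (EFin \o f) -> mu.-integrable setT (EFin \o f).
Proof.
move=> mA f0 /(integrable_mkcond _ mA); congr integrable.
apply/funext => x; rewrite patchE; case: ifPn => //.
by rewrite notin_setE => /f0 /= ->.
Qed.

Lemma Rintegral_support d (T : measurableType d)
    (mu : {measure set T -> \bar R}) (A B : set T) (f : T -> R) :
  A `<=` B -> (forall x, B x -> ~ A x -> f x = 0) ->
  \int[mu]_(x in A) f x = \int[mu]_(x in B) f x.
Proof.
move=> AB f0; rewrite Rintegral_mkcond [RHS]Rintegral_mkcond; apply: eq_Rintegral => x _.
rewrite !patchE; case: ifPn; rewrite ?(inE, notin_setE) => hA.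
  by rewrite mem_set//; exact: AB.
by case: ifPn => //; rewrite inE => hB; rewrite f0.
Qed.

Lemma continuous_support_integrable n (f : 'rV[R]_n -> R) (c : R) : continuous f ->
  (forall x, c < `|x| -> f x = 0) -> (@lebesgue_rV R n).-integrable setT (EFin \o f).
Proof.
move=> cf f0; have [C C0 hC] := continuous_support_bounded cf f0.
apply: (@integrable_setT_support _ _ _ [set x : 'rV[R]_n | `|x| <= c]).
- exact: measurable_ball_norm.
- by move=> x /negP; rewrite -ltNge => /f0.
- apply: (@bounded_measurable_integrable _ _ _ _ _ _ C) => //.
  + exact: measurable_ball_norm.
  + exact: lebesgue_ball_norm_lty.
  + apply: measurable_funS (continuous_measurable_rV cf) => //.
Qed.

Lemma ball_norm_prod n (c : R) : [set z : measurableTypeR R * 'rV[R]_n | `|(z : R * 'rV[R]_n)| <= c] =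
  [set t : measurableTypeR R | `|t : R| <= c] `*` [set x | `|x| <= c].
Proof.
apply/seteqP; split => -[t x]; rewrite /= prod_normE /= ge_max.
  by move=> /andP.
by move=> [-> ->].
Qed.

Lemma continuous_support_integrable_prod n (f : measurableTypeR R * 'rV[R]_n -> R) (c : R) :
  continuous (f : R * 'rV[R]_n -> R) ->
  (forall z : R * 'rV[R]_n, c < `|z| -> f z = 0) ->
  (leb \x @lebesgue_rV R n)%E.-integrable setT (EFin \o f).
Proof.
move=> cf f0.
pose B := [set z : measurableTypeR R * 'rV[R]_n | `|(z : R * 'rV[R]_n)| <= c].
have BE : B = [set t : measurableTypeR R | `|t : R| <= c] `*` [set x | `|x| <= c].
  exact: ball_norm_prod.
have mB : measurable B.
  by rewrite BE; apply: measurableX; [exact: measurable_itv_norm|exact: measurable_ball_norm].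
have [C hC] : exists C : R, forall z, B z -> `|f z| <= C.
  have cK : compact (B : set (R * 'rV[R]_n)).
    rewrite BE; apply: compact_setX.
      rewrite (_ : [set t | _] = [set` `[- c, c]]); first exact: segment_compact.
      by apply/seteqP; split => t /=; rewrite in_itv /= ler_norml.
    apply: bounded_closed_compact; last exact: closed_ball_norm.
    exact: (@le_bounded_image _ _ _ id _ c).
  have : compact (f @` (B : set (R * 'rV[R]_n))).
    by apply: continuous_compact => //; exact: continuous_subspaceT.
  move=> /compact_bounded/bounded_image_le[C C0 hC]; exists C => z Bz.
  by apply: hC; exists z.
apply: (@integrable_setT_support _ _ _ B) => //.
- by move=> x /negP; rewrite -ltNge => /f0.
- apply: (@bounded_measurable_integrable _ _ _ _ _ _ C) => //.
  + rewrite BE [X in (X < _)%E](_ : _ = leb [set t : measurableTypeR R | (`|t : R| <= c)%R] *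
      lebesgue_rV [set x : 'rV[R]_n | (`|x| <= c)%R])%E; last first.
      by apply: product_measure1E; [exact: measurable_itv_norm|exact: measurable_ball_norm].
    rewrite lte_mul_pinfty// ?ge0_fin_numE//; first exact: lebesgue_itv_norm_lty.
    exact: lebesgue_ball_norm_lty.
  + by apply: measurable_funS (continuous_measurable_prod_rV cf).
Qed.

Lemma integral_derive1_eq0 (F : R -> R) (c : R) :
  (forall t : R, derivable F t 1) -> continuous ('D_1 F) ->
  (forall t : R, c < `|t| -> F t = 0) -> (\int[leb]_t ('D_1 F t)%:E = 0)%E.
Proof.
move=> dF cF F0; have dF0 := derive_support (1 : R) F0.
(* This bound is positive whatever the sign of [c], and it exceeds [c], so that F vanishes at both
   ends of [-b, b]. *)
pose b : R := `|c| + 1.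
have b0 : 0 < b by rewrite ltr_wpDl.
have cb : c < b by rewrite (le_lt_trans (ler_norm _))// ltrDl.
transitivity (\int[leb]_(t in `[(- b)%R, b%R]) ('D_1 F t)%:E)%E.
  rewrite [RHS]integral_mkcond; apply: eq_integral => t _.
  rewrite patchE; case: ifPn => //; rewrite notin_setE /= in_itv /= -ler_norml.
  by move=> /negP; rewrite -ltNge => h; rewrite dF0// (lt_trans cb).
have contF : continuous F.
  by move=> t; apply: differentiable_continuous; exact/derivable1_diffP.
rewrite (@continuous_FTC2 _ _ F); last 4 first.
- by rewrite gtrN.
- exact: continuous_subspaceT.
- split; first by move=> t _; exact: dF.
  + by apply: cvg_at_right_filter; exact: contF.
  + by apply: cvg_at_left_filter; exact: contF.
- by move=> t _; rewrite derive1E.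
have nb : c < `|b| by rewrite gtr0_norm.
by rewrite !F0 ?normrN// sube0.
Qed.

Lemma integral_cons_rV n (f : 'rV[R]_n.+1 -> \bar R) :
  measurable_fun setT f ->
  (leb \x @lebesgue_rV R n)%E.-integrable setT (f \o @cons_rV R n) ->
  (\int[@lebesgue_rV R n.+1]_x f x = \int[leb \x @lebesgue_rV R n]_z f (cons_rV z))%E.
Proof.
move=> mf intf.
have := @integral_pushforward _ _ _ _ _ _ (@measurable_cons_rV R n)
  (leb \x @lebesgue_rV R n)%E setT f mf.
by rewrite preimage_setT => /(_ intf measurableT) <-.
Qed.

Lemma coord_affine n (a : R) (u v : 'rV[R]_n) k :
  (a *: u + v) ord0 k = a * u ord0 k + v ord0 k.
Proof. by rewrite !mxE. Qed.

Lemma cons_rV_shift0 n (t : R) (x : 'rV[R]_n) (h : R) :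
  cons_rV (h *: (1 : R) + t, x) = h *: delta_mx ord0 ord0 + cons_rV (t, x).
Proof.
apply/rowP => k; rewrite coord_affine [delta_mx _ _ _ _]mxE eqxx /=.
have [j ->|->] := unliftP ord0 k.
  by rewrite !cons_rV_lift /= mulr0 add0r.
by rewrite !cons_rV_ord0.
Qed.

Lemma cons_rV_shift n (t : R) (x : 'rV[R]_n) (j : 'I_n) (h : R) :
  cons_rV (t, h *: delta_mx ord0 j + x) = h *: delta_mx ord0 (lift ord0 j) + cons_rV (t, x).
Proof.
apply/rowP => k; rewrite coord_affine [delta_mx _ _ _ _]mxE eqxx /=.
have [i ->|->] := unliftP ord0 k.
  by rewrite !cons_rV_lift /= !mxE eqxx /= (inj_eq lift_inj).
by rewrite !cons_rV_ord0 /= mulr0 add0r.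
Qed.

Lemma continuous_cons_rV n : continuous (@cons_rV R n : R * 'rV[R]_n -> 'rV[R]_n.+1).
Proof.
move=> z; apply/cvgrPdist_le => e e0; near=> y.
apply: norm_rV_le; first exact: ltW.
move=> k; rewrite mxE [X in _ + X]mxE.
have zy : `|z - y| <= e.
  by near: y; move: (@cvg_id _ (nbhs z)) => /cvgrPdist_le; exact.
have [j ->|->] := unliftP ord0 k.
  rewrite !cons_rV_lift; apply: le_trans zy; rewrite prod_normE /=.
  rewrite le_max; apply/orP; right.
  by have := le_coord_norm (z.2 - y.2) j; rewrite mxE [X in _ + X]mxE.
rewrite !cons_rV_ord0; apply: le_trans zy; rewrite prod_normE /=.
by rewrite le_max lexx.
Unshelve. all: by end_near. Qed.

Lemma norm_cons_ge n (z : R * 'rV[R]_n) : `|z| <= `|cons_rV z|.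
Proof. by rewrite prod_normE ge_max norm_cons_ge1 norm_cons_ge2. Qed.

Lemma continuous_pair_cst (V W : normedModType R) (t : W) :
  continuous (fun x : V => (t, x) : W * V).
Proof. by move=> x; exact: (cvg_pair (cvg_cst t) cvg_id). Qed.

Lemma continuous_cst_pair (V W : normedModType R) (x : V) :
  continuous (fun t : W => (t, x) : W * V).
Proof. by move=> t; exact: (cvg_pair cvg_id (cvg_cst x)). Qed.

(** Induction on the dimension, with the order of integration adapted to the direction. If it is a
    later coordinate, the first one is frozen and the induction hypothesis applies; if it is the
    first one, the others are frozen and the fundamental theorem of calculus applies. *)
Lemma integral_partial_eq0 n (i : 'I_n) (F : 'rV[R]_n -> R) (c : R) :
  (forall x, derivable F x (delta_mx ord0 i)) ->
  continuous ('D_(delta_mx ord0 i) F) ->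
  (forall x, c < `|x| -> F x = 0) ->
  (\int[@lebesgue_rV R n]_x ('D_(delta_mx ord0 i) F x)%:E = 0)%E.
Proof.
elim: n i F => [|n IH] i F dF cF F0; first by case: i dF cF.
have dF0 := derive_support (delta_mx ord0 i) F0.
set g := 'D_(delta_mx ord0 i) F.
have cg : continuous ((g \o @cons_rV R n) : R * 'rV[R]_n -> R).
  by move=> z; apply: continuous_comp; [exact: continuous_cons_rV|exact: cF].
have ig : (leb \x @lebesgue_rV R n)%E.-integrable setT (EFin \o (g \o @cons_rV R n)).
  apply: (@continuous_support_integrable_prod _ _ c) => // z cz.
  by apply: dF0; rewrite (lt_le_trans cz)// norm_cons_ge.
rewrite (@integral_cons_rV _ (EFin \o g)) //; last first.
  by apply/measurable_EFinP; exact: continuous_measurable_rV.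
have ct := @continuous_pair_cst 'rV[R]_n R.
have cx := @continuous_cst_pair 'rV[R]_n R.
have [j ij|i0] := unliftP ord0 i.
- rewrite -(integral12_prod_meas1 ig) integral0_eq// => t _ /=; rewrite /fubini_F /=.
  pose A (x : 'rV[R]_n) := cons_rV ((t : measurableTypeR R), x).
  have AE (x : 'rV[R]_n) (h : R) :
    A (h *: delta_mx ord0 j + x) = h *: delta_mx ord0 i + A x.
    by rewrite ij; exact: cons_rV_shift.
  have gE x : 'D_(delta_mx ord0 j) (F \o A) x = g (A x).
    by apply: derive_affine; exact: AE.
  apply: etrans (IH j (F \o A) _ _ _); first by apply: eq_integral => y _; rewrite gE.
  + by move=> x; apply: derivable_affine; [exact: AE|exact: dF].
  + rewrite (_ : 'D_(delta_mx ord0 j) _ = fun x => g (A x)); last by apply/funext.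
    by move=> x; apply: (@continuous_comp _ _ _ _ (g \o @cons_rV R n)); [exact: ct|exact: cg].
  + by move=> x xc; apply: F0; rewrite (lt_le_trans xc)//; exact: (norm_cons_ge2 (_, _)).
- rewrite -(integral21_prod_meas1 ig) integral0_eq// => x _ /=; rewrite /fubini_G /=.
  pose A (t : R) := cons_rV ((t : measurableTypeR R), x).
  have AE (t h : R) : A (h *: (1 : R) + t) = h *: delta_mx ord0 i + A t.
    by rewrite i0; exact: cons_rV_shift0.
  have gE (t : R) : 'D_1 (F \o A) t = g (A t).
    by apply: derive_affine; exact: AE.
  apply: etrans (@integral_derive1_eq0 (F \o A) c _ _ _).
    by apply: eq_integral => y _; rewrite gE.
  + by move=> t; apply: derivable_affine; [exact: AE|exact: dF].
  + rewrite (_ : 'D_(1 : R) (F \o A) = fun t => g (A t)); last by apply/funext.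
    by move=> t; apply: (@continuous_comp _ _ _ _ (g \o @cons_rV R n)); [exact: cx|exact: cg].
  + by move=> t tc; apply: F0; rewrite (lt_le_trans tc)//; exact: (norm_cons_ge1 (_, _)).
Qed.

Lemma integral_time_derive_eq0 n (F : R * 'rV[R]_n -> R) (c : R) :
  (forall z, derivable F z (1, 0)) -> continuous ('D_(1, 0) F) ->
  (forall z, c < `|z| -> F z = 0) ->
  (\int[leb \x @lebesgue_rV R n]_z ('D_(1, 0) F z)%:E = 0)%E.
Proof.
move=> dF cF F0; have dF0 := derive_support ((1, 0) : R * 'rV[R]_n) F0.
have ig := continuous_support_integrable_prod cF dF0.
have cx := @continuous_cst_pair 'rV[R]_n R.
rewrite -(integral21_prod_meas1 ig) integral0_eq// => x _ /=; rewrite /fubini_G /=.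
pose A (t : R) : R * 'rV[R]_n := (t, x : 'rV[R]_n).
have AE (t h : R) : A (h *: (1 : R) + t) = h *: (1, 0) + A t.
  by congr pair; rewrite /= scaler0 add0r.
have gE (t : R) : 'D_1 (F \o A) t = 'D_(1, 0) F (A t).
  by apply: derive_affine; exact: AE.
apply: etrans (@integral_derive1_eq0 (F \o A) c _ _ _).
    by apply: eq_integral => y _; rewrite gE.
- by move=> t; apply: derivable_affine; [exact: AE|exact: dF].
- rewrite (_ : 'D_(1 : R) (F \o A) = fun t => 'D_(1, 0) F (A t)); last by apply/funext.
  by move=> t; apply: (@continuous_comp R (R * 'rV[R]_n)%type R A ('D_(1, 0) F)); [exact: cx|exact: cF].
- move=> t tc; apply: F0; rewrite (lt_le_trans tc)// prod_normE /= le_max lexx//.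
Qed.

End integral_derive.

(** * Stability properties of C_c^oo *)

Section compactly_supported.
Context {R : realType}.

(** The support itself need not be computed: any compact closed set off which f vanishes contains
    it, and a closed subset of a compact set is compact. *)
Lemma Cc_infty_of_compact (V : normedModType R) (U K : set V) (f : V -> R) :
  smooth f -> compact K -> closed K -> K `<=` U -> (forall x, ~ K x -> f x = 0) ->
  Cc_infty U f.
Proof.
move=> sf cK clK KU f0.
have sub : support_closure f `<=` K.
  rewrite (closure_id K).1//; apply: closureS => x /= /eqP fx.
  by apply: contrapT => /f0.
split => //; last exact: subset_trans KU.
by apply: (subclosed_compact _ cK) => //; exact: closed_closure.
Qed.

Lemma Cc_infty_eq0 (V : normedModType R) (f : V -> R) x :
  ~ support_closure f x -> f x = 0.
Proof.
move=> h; apply: contrapT => /eqP fx; apply: h.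
exact: (@subset_closure _ [set x | f x != 0]).
Qed.

Lemma Cc_infty_out (V : normedModType R) (U : set V) (f : V -> R) x :
  Cc_infty U f -> ~ U x -> f x = 0.
Proof. by move=> [_ _ sU] nU; apply: Cc_infty_eq0 => /sU. Qed.

Lemma Cc_infty_bounded_support (V : normedModType R) (U : set V) (f : V -> R) :
  Cc_infty U f -> exists2 c : R, 0 < c & forall x, c < `|x| -> f x = 0.
Proof.
move=> [_ /compact_bounded/bounded_image_le[c c0 hc] _]; exists c => // x cx.
by apply: Cc_infty_eq0 => /hc /(lt_le_trans cx); rewrite ltxx.
Qed.

Lemma Cc_infty_smooth (V : normedModType R) (U : set V) (f : V -> R) :
  Cc_infty U f -> smooth f.
Proof. by case. Qed.

Lemma closed_support_closure (V : normedModType R) (f : V -> R) : closed (support_closure f).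
Proof. exact: closed_closure. Qed.

Lemma Cc_inftyMr (V : normedModType R) (U : set V) (f g : V -> R) :
  Cc_infty U f -> smooth g -> Cc_infty U (fun x => f x * g x).
Proof.
move=> [sf cf fU] sg; apply: (Cc_infty_of_compact (K := support_closure f)) => //.
- exact: smoothM.
- exact: closed_support_closure.
- by move=> x /Cc_infty_eq0 ->; rewrite mul0r.
Qed.

Lemma Cc_inftyD (V : normedModType R) (U : set V) (f g : V -> R) :
  Cc_infty U f -> Cc_infty U g -> Cc_infty U (fun x => f x + g x).
Proof.
move=> [sf cf fU] [sg cg gU].
apply: (Cc_infty_of_compact (K := support_closure f `|` support_closure g)) => //.
- exact: smoothD.
- exact: compactU.
- by apply: closedU; exact: closed_support_closure.
- by move=> x [/fU|/gU].
- move=> x /not_orP[hf hg].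
  by rewrite (Cc_infty_eq0 hf) (Cc_infty_eq0 hg) addr0.
Qed.

Lemma Cc_infty0 (V : normedModType R) (U : set V) : Cc_infty U (fun _ : V => 0 : R).
Proof.
apply: (Cc_infty_of_compact (K := set0)) => //; first exact: smooth_cst.
  exact: compact0.
exact: closed0.
Qed.

Lemma Cc_infty_sum (V : normedModType R) (U : set V) (I : Type) (r : seq I)
    (P : pred I) (f : I -> V -> R) :
  (forall i, Cc_infty U (f i)) -> Cc_infty U (fun x => \sum_(i <- r | P i) f i x).
Proof.
move=> cf; elim: r => [|i r IH].
  by under eq_fun do rewrite big_nil; exact: Cc_infty0.
under eq_fun do rewrite big_cons.
by case: (P i) => //; exact: Cc_inftyD.
Qed.

Lemma Cc_infty_comp (V : normedModType R) (U : set V) (g : R -> R) (f : V -> R) :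
  smooth g -> g 0 = 0 -> Cc_infty U f -> Cc_infty U (fun x => g (f x)).
Proof.
move=> sg g0 [sf cf fU]; apply: (Cc_infty_of_compact (K := support_closure f)) => //.
- exact: smooth_real_comp.
- exact: closed_support_closure.
- by move=> x /Cc_infty_eq0 ->.
Qed.

End compactly_supported.

(** * The fundamental lemma of the calculus of variations *)

Section fundamental_lemma.
Context {R : realType}.

Lemma ae_imp d (T : measurableType d) (mu : {measure set T -> \bar R})
    (P Q : T -> Prop) :
  (forall x, P x -> Q x) -> {ae mu, forall x, P x} -> {ae mu, forall x, Q x}.
Proof. by move=> PQ; apply: filterS. Qed.

Lemma ae_forall_countable d (T : measurableType d) (mu : {measure set T -> \bar R})
    (I : countType) (P : I -> T -> Prop) :
  (forall i, {ae mu, forall x, P i x}) -> {ae mu, forall x, forall i, P i x}.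
Proof.
move=> h.
have H : {ae mu, forall x, forall k, if unpickle k is Some i then P i x else True}.
  apply: ae_foralln => k; case: (unpickle k) => [i|]; first exact: h.
  exact: aeW.
by apply: filterS H => x hx i; have := hx (pickle i); rewrite pickleK.
Qed.

Lemma Rintegral_dominated d (T : measurableType d) (mu : {measure set T -> \bar R})
    (D : set T) (f_ : nat -> T -> R) (f g : T -> R) :
  measurable D -> (forall n, measurable_fun D (f_ n)) ->
  (forall x, D x -> f_ n x @[n --> \oo] --> f x) ->
  mu.-integrable D (EFin \o g) ->
  (forall n x, D x -> `|f_ n x| <= g x) ->
  \int[mu]_(x in D) f_ n x @[n --> \oo] --> \int[mu]_(x in D) f x.
Proof.
move=> mD mf_ cf ig fg.
have mf : measurable_fun D f by apply: (measurable_fun_cvg mf_).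
have H : (\int[mu]_(x in D) (f_ n x)%:E)%E @[n --> \oo] --> (\int[mu]_(x in D) (f x)%:E)%E.
  apply: (@dominated_cvg _ _ _ mu D mD (fun n => EFin \o f_ n) _ (EFin \o g)) => //.
  - by move=> n; exact/measurable_EFinP.
  - by move=> x Dx; apply: cvg_EFin; [exact: nearW|exact: cf].
have intf : mu.-integrable D (EFin \o f).
  apply: (le_integrable mD _ _ ig); first exact/measurable_EFinP.
  move=> x Dx /=; rewrite lee_fin (le_trans _ (ler_norm (g x)))//.
  have := cf x Dx => /cvg_norm h.
  by apply: (cvgr_to_le h); apply: nearW => k; exact: fg.
rewrite /Rintegral; apply: (fine_cvg (f := fun n => (\int[mu]_(x in D) (f_ n x)%:E)%E)).
by rewrite fineK//; exact: integrable_fin_num intf.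
Qed.

(* A pi-lambda argument. *)
Lemma ae_eq0_of_generator d (T : measurableType d) (mu : {measure set T -> \bar R})
    (G : set (set T)) (D : set T) (f : T -> R) :
  @measurable _ T = <<s G>> -> setI_closed G -> measurable D ->
  mu.-integrable D (EFin \o f) -> \int[mu]_(x in D) f x = 0 ->
  (forall B, G B -> \int[mu]_(x in B `&` D) f x = 0) ->
  {ae mu, forall x, D x -> f x = 0}.
Proof.
move=> mG GI mD iD D0 G0.
pose P (S : set T) := (\int[mu]_(x in S `&` D) (f x)%:E = 0)%E.
have intS S : measurable S -> mu.-integrable (S `&` D) (EFin \o f).
  by move=> mS; apply: integrableS iD => //; exact: measurableI.
have fin0 S : measurable S -> \int[mu]_(x in S `&` D) f x = 0 -> P S.
  move=> mS h; rewrite /P -[LHS]fineK; first by congr EFin; exact: h.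
  by apply: integrable_fin_num (intS _ mS); exact: measurableI.
have PT : P setT by apply: fin0 => //; rewrite setTI.
have PP : forall S, measurable S -> P S.
  move=> S0; rewrite {1}mG => hS.
  apply: (@dynkin_induction _ _ G P) hS => //.
  - move=> B GB; apply: fin0; last exact: G0.
    by rewrite mG; exact: sub_sigma_algebra.
  - move=> S mS PS; rewrite /P; have := PT; rewrite /P setTI.
    rewrite -{1}(setUIDK D S) integral_setU_EFin//.
    + by rewrite setIC PS add0e setDE setIC.
    + exact: measurableI.
    + exact: measurableD.
    + apply/measurable_EFinP; apply: measurable_int.
      by apply: integrableS iD => //; [rewrite setUIDK|rewrite setUIDK].
    + by apply/disj_setPS => x [[_ ?] [_ ?]].
  - move=> F mF tF PF; rewrite /P setI_bigcupl integral_bigcup//.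
    + by rewrite eseries0// => i _ _; exact: PF.
    + by apply: trivIset_setIr.
    + by move=> k; exact: measurableI.
    + by rewrite -setI_bigcupl; apply: intS; exact: bigcup_measurable.
have h : forall S, S `<=` D -> measurable S ->
    (\int[mu]_(x in S) (EFin \o f) x = \int[mu]_(x in S) cst 0 x)%E.
  by move=> S Sb mS; rewrite integral_cst// mul0e -(PP S mS) (setIidl Sb).
have := @integral_ae_eq _ _ _ mu D mD (cst 0%E) (EFin \o f) iD (measurable_cst _) h.
by apply: filterS => x hx /hx /= [].
Qed.

Variable n : nat.
Local Notation E := 'rV[R]_n.
Local Notation mu := (@lebesgue_rV R n).

Definition box (a b : E) : set E := [set x | forall i, a ord0 i < x ord0 i < b ord0 i].
Definition cbox (a b : E) : set E := [set x | forall i, a ord0 i <= x ord0 i <= b ord0 i].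

Lemma boxI (a b c d : E) : box a b `&` box c d =
  box (\row_i Num.max (a ord0 i) (c ord0 i)) (\row_i Num.min (b ord0 i) (d ord0 i)).
Proof.
apply/seteqP; split => x; rewrite /box /=.
  move=> [h1 h2] i; have /andP[h11 h12] := h1 i; have /andP[h21 h22] := h2 i.
  by rewrite !mxE gt_max lt_min h11 h12 h21 h22.
move=> h; split => i; have := h i; rewrite !mxE gt_max lt_min.
  by move=> /andP[/andP[-> _] /andP[-> _]].
by move=> /andP[/andP[_ ->] /andP[_ ->]].
Qed.

Lemma ball_box (c : E) (r : R) : 0 < r ->
  ball c r = box (\row_i (c ord0 i - r)) (\row_i (c ord0 i + r)).
Proof.
move=> r0; rewrite ball_rV//; apply/seteqP; split => x h i; have := h i;
  by rewrite !mxE ball_itv /= in_itv.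
Qed.

Lemma box_cbox (a b : E) : box a b `<=` cbox a b.
Proof. by move=> x h i; have /andP[/ltW -> /ltW ->] := h i. Qed.

Lemma open_box (a b : E) : open (box a b).
Proof.
rewrite (_ : box a b = ~` \bigcup_(i in [set: 'I_n])
   ((fun x : E => x ord0 i) @^-1` ([set` `]-oo, a ord0 i]] `|` [set` `[b ord0 i, +oo[]))).
  apply: closed_openC; apply: closed_bigcup => [|i _]; first exact: finite_finset.
  apply: closed_comp.
    by move=> x _; exact: coord_continuous.
  by apply: closedU; exact: interval_closed.
apply/seteqP; split => x h.
  move=> [i _ /=]; have := h i; rewrite !in_itv /= andbT => /andP[h1 h2] [].
    by rewrite leNgt h1.
  by rewrite leNgt h2.
move=> i; apply: contrapT => /negP; rewrite negb_and -!leNgt => /orP h'.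
by apply: h; exists i => //=; rewrite !in_itv /= andbT.
Qed.

Lemma closed_cbox (a b : E) : closed (cbox a b).
Proof.
rewrite (_ : cbox a b = \bigcap_(i in [set: 'I_n])
   ((fun x : E => x ord0 i) @^-1` [set` `[a ord0 i, b ord0 i]])); last first.
  apply/seteqP; split => x h i; first by move=> _; rewrite /= in_itv; exact: h.
  by have := h i I; rewrite /= in_itv.
apply: closed_bigI => i _; apply: closed_comp; first by move=> x _; exact: coord_continuous.
exact: itv_closed.
Qed.

Lemma compact_cbox (a b : E) : compact (cbox a b).
Proof.
apply: bounded_closed_compact; last exact: closed_cbox.
apply: (@le_bounded_image _ _ _ id _ (`|a| + `|b|)) => x h.
apply: norm_rV_le; first by rewrite addr_ge0.
move=> i; have := h i; have := le_coord_norm a i; have := le_coord_norm b i.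
rewrite !ler_norml; lra.
Qed.

(** These functions take values in [0, 1], vanish off the open box, and tend pointwise to its
    indicator as [k] grows. *)
Definition bump (a b : E) (k : nat) (x : E) : R :=
  \prod_i (flat 1 (k%:R * (x ord0 i - a ord0 i)) * flat 1 (k%:R * (b ord0 i - x ord0 i))).

Lemma smooth_bump a b k : smooth (bump a b k).
Proof.
apply: smooth_prod => i; apply: smoothM; apply: smooth_real_comp.
- exact: smooth_flat.
- under eq_fun do rewrite mulrBr.
  by apply: smoothD; [apply: smoothM; [exact: smooth_cst|exact: smooth_coord]|exact: smooth_cst].
- exact: smooth_flat.
- apply: smoothM; first exact: smooth_cst.
  under eq_fun do rewrite -mulN1r.
  by apply: smoothD; [exact: smooth_cst|apply: smoothM; [exact: smooth_cst|exact: smooth_coord]].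
Qed.

Lemma bump_ge0 a b k x : 0 <= bump a b k x.
Proof. by apply: prodr_ge0 => i _; rewrite mulr_ge0 ?flat1_ge0. Qed.

Lemma bump_le1 a b k x : bump a b k x <= 1.
Proof.
apply: prodr_ile1 => i _; rewrite mulr_ge0 ?flat1_ge0//=.
by rewrite mulr_ile1 ?flat1_ge0 ?flat1_le1.
Qed.

Lemma bump_out a b k x : ~ box a b x -> bump a b k x = 0.
Proof.
move=> /existsNP[i /negP]; rewrite negb_and -!leNgt => h.
rewrite /bump (bigD1 i)//=; case/orP: h => h.
  by rewrite (@flat_le0 _ _ (k%:R * (x ord0 i - _))) ?mul0r// mulr_ge0_le0// subr_le0.
by rewrite (@flat_le0 _ _ (k%:R * (b ord0 i - _))) ?mulr0 ?mul0r// mulr_ge0_le0// subr_le0.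
Qed.

Lemma Cc_bump (U : set E) a b k : cbox a b `<=` U -> Cc_infty U (bump a b k).
Proof.
move=> sub; apply: (Cc_infty_of_compact (K := cbox a b)) => //.
- exact: smooth_bump.
- exact: compact_cbox.
- exact: closed_cbox.
- by move=> x h; apply: bump_out => /box_cbox.
Qed.

Lemma cvg_flat1_scaled (c : R) : 0 < c -> flat 1 (k%:R * c) @[k --> \oo] --> (1 : R).
Proof.
move=> c0; rewrite -[X in _ --> X](expR0) -oppr0.
apply: (@cvg_trans _ (expR (- (k%:R * c)^-1) @[k --> \oo])).
  apply: near_eq_cvg; near=> k; rewrite /flat hornerC mul1r ifT// mulr_gt0// ltr0n.
  by near: k; exists 1%N.
apply: continuous_cvg; first exact: continuous_expR.
apply: cvgN; apply/gtr0_cvgV0.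
  near=> k; rewrite mulr_gt0// ltr0n; by near: k; exists 1%N.
apply/cvgryPge => A; near=> k; rewrite -ler_pdivrMr//.
by near: k; exact: nbhs_infty_ger.
Unshelve. all: by end_near. Qed.

Lemma cvg_bump a b x : box a b x -> bump a b k x @[k --> \oo] --> (1 : R).
Proof.
move=> h; rewrite /bump.
suff : forall r : seq 'I_n,
   \prod_(i <- r) (flat 1 (k%:R * (x ord0 i - a ord0 i)) * flat 1 (k%:R * (b ord0 i - x ord0 i)))
   @[k --> \oo] --> (1 : R) by apply.
elim=> [|i r IH]; first by under eq_fun do rewrite big_nil; exact: cvg_cst.
under eq_fun do rewrite big_cons.
have /andP[h1 h2] := h i.
have h1' : 0 < x ord0 i - a ord0 i by rewrite subr_gt0.
have h2' : 0 < b ord0 i - x ord0 i by rewrite subr_gt0.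
have e1 : (1 : R) = 1 * 1 * 1 by rewrite !mulr1.
by rewrite [X in nbhs X]e1; apply: cvgM => //; apply: cvgM; exact: cvg_flat1_scaled.
Qed.

(** Boxes are used as generators because they are stable under intersection, as the pi-lambda
    argument demands, and because the balls of the maximum norm are boxes. *)
Lemma measurable_boxes :
  @measurable _ E = <<s [set B | exists a b, B = box a b] >>.
Proof.
apply/seteqP; split; last first.
  apply: smallest_sub; first exact: sigma_algebra_measurable.
  by move=> _ [a [b ->]]; apply: open_measurable_rV; exact: open_box.
pose G : set (set E) := [set B | exists a b, B = box a b].
have mo (U : set E) : open U -> <<s G >> U.
  move=> oU; rewrite (open_bigcup_balls (c := fun q : 'rV[rat]_n => map_mx ratr q : E) _ oU).
    apply: (@countable_bigcupT_measurable _ (g_sigma_algebraType G)) => //.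
    move=> [q k] /=; case: ifPn => _; last exact: (@measurable0 _ (g_sigma_algebraType G)).
    apply: sub_sigma_algebra; rewrite ball_box ?invr_gt0//.
    by eexists; eexists.
  by move=> x e e0; exact: exists_rat_ball_rV.
apply: smallest_sub; first exact: (@sigma_algebra_measurable _ (g_sigma_algebraType G)).
rewrite -bigcup_seq => _ [i _ [Y mY <-]].
have : measurable_fun [set: g_sigma_algebraType G] (fun x : E => x ord0 i).
  apply: (measurability _ (RGenOpens.measurableE R)).
  move=> _ [_ [a [b ->] <-]]; rewrite setTI; apply: mo.
  apply: open_comp; first by move=> x _; exact: coord_continuous.
  exact: interval_open.
by move=> /(_ measurableT _ mY).
Qed.

Variable Omega : set E.
Hypothesis Omega_open : open Omega.

Section vanishing.
Variable f : E -> R.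
Hypothesis f_loc : forall K, compact K -> K `<=` Omega -> mu.-integrable K (EFin \o f).
Hypothesis f_test : forall psi, Cc_infty Omega psi -> (forall x, 0 <= psi x) ->
  \int[mu]_(x in Omega) (f x * psi x) = 0.

(** Once the closed box lies in [Omega], its bumps are nonnegative test functions. They tend to the
    indicator of the open box under the majorant |f|, integrable on the compact closed box. *)
Let integral_box (a b : E) : cbox a b `<=` Omega -> \int[mu]_(x in box a b) f x = 0.
Proof.
move=> sub; pose K := cbox a b.
have mK : measurable K by apply: closed_measurable_rV; exact: closed_cbox.
have mB : measurable (box a b) by apply: open_measurable_rV; exact: open_box.
have iK : mu.-integrable K (EFin \o f) by apply: f_loc => //; exact: compact_cbox.
have mf : measurable_fun K f by apply/measurable_EFinP; exact: measurable_int iK.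
have h0 k : \int[mu]_(x in K) (f x * bump a b k x) = 0.
  rewrite -[RHS](f_test (Cc_bump k sub) (bump_ge0 a b k)).
  apply: Rintegral_support => // x _ hK.
  by rewrite bump_out ?mulr0// => /box_cbox.
have : \int[mu]_(x in K) (f x * bump a b k x) @[k --> \oo] -->
       \int[mu]_(x in K) (f \_ (box a b)) x.
  apply: (@Rintegral_dominated _ _ mu K _ _ (fun x => `|f x|)) => //.
  - move=> k; apply: measurable_funM => //.
    apply: measurable_funS (continuous_measurable_rV _) => //.
    exact/smooth_continuous/smooth_bump.
  - move=> x Kx; rewrite patchE; case: ifPn; rewrite ?(inE, notin_setE) => hx.
      by rewrite -[X in _ --> X]mulr1; apply: cvgM; [exact: cvg_cst|exact: cvg_bump].
    by under eq_fun do rewrite bump_out// mulr0; exact: cvg_cst.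
  - by have := integrable_abse iK; congr integrable.
  - move=> k x _; rewrite normrM ler_piMr//.
    by rewrite ger0_norm ?bump_ge0 ?bump_le1.
under eq_fun do rewrite h0.
move=> H; have := cvg_lim (@Rhausdorff R) H; rewrite lim_cst// => {H}H.
rewrite [RHS]H.
rewrite -Rintegral_mkcondr; congr Rintegral.
by apply/seteqP; split => x; [move=> hx; split => //; exact: box_cbox|move=> []].
Qed.

Let ae_box (a b : E) : cbox a b `<=` Omega ->
  {ae mu, forall x, box a b x -> f x = 0}.
Proof.
move=> sub.
have mK : measurable (cbox a b) by apply: closed_measurable_rV; exact: closed_cbox.
have mB : measurable (box a b) by apply: open_measurable_rV; exact: open_box.
have iK : mu.-integrable (cbox a b) (EFin \o f) by apply: f_loc => //; exact: compact_cbox.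
have iB := integrableS mK mB (@box_cbox a b) iK.
apply: (ae_eq0_of_generator measurable_boxes) => //.
- by move=> _ _ [a1 [b1 ->]] [a2 [b2 ->]]; rewrite boxI; eexists; eexists.
- exact: integral_box.
- move=> _ [a1 [b1 ->]]; rewrite boxI integral_box// => x h; apply: sub => i.
  have := h i; rewrite !mxE ge_max le_min.
  by move=> /andP[/andP[_ ->] /andP[_ ->]].
Qed.

(** Integrability is available only on compact sets, so that the conclusion is first reached on each
    box whose closure lies in [Omega]. Countably many rational boxes of this kind cover [Omega]. *)
Lemma ae_eq0_of_test : {ae mu, forall x, Omega x -> f x = 0}.
Proof.
pose P (q : 'rV[rat]_n * nat) (x : E) :=
  cbox (\row_i (ratr (q.1 ord0 i) - q.2.+1%:R^-1)) (\row_i (ratr (q.1 ord0 i) + q.2.+1%:R^-1))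
    `<=` Omega ->
  box (\row_i (ratr (q.1 ord0 i) - q.2.+1%:R^-1)) (\row_i (ratr (q.1 ord0 i) + q.2.+1%:R^-1)) x ->
  f x = 0.
have : {ae mu, forall x, forall q, P q x}.
  apply: ae_forall_countable => q; rewrite /P.
  have [h|h] := pselect (cbox (\row_i (ratr (q.1 ord0 i) - q.2.+1%:R^-1))
    (\row_i (ratr (q.1 ord0 i) + q.2.+1%:R^-1)) `<=` Omega); last exact: aeW.
  by apply: filterS (ae_box h) => x hx _; exact: hx.
apply: filterS => x hx Ox.
have /nbhs_ballP[e /= e0 he] := open_nbhs_nbhs (conj Omega_open Ox).
have [k hk] : exists k : nat, k.+1%:R^-1 < e / 2.
  near \oo => k; exists k; near: k.
  exact: (near_infty_natSinv_lt (PosNum (divr_gt0 e0 (ltr0n _ 2)))).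
have k0 : 0 < k.+1%:R^-1 :> R by rewrite invr_gt0.
have [q hq] := exists_rat_ball_rV x k0.
have rowE (s : R) : (\row_i ((map_mx ratr q : E) ord0 i + s)) = \row_i (ratr (q ord0 i) + s).
  by apply/rowP => i; rewrite !mxE.
move: hq; rewrite ball_box// !rowE => hq.
apply: (hx (q, k)) => //= y hy; apply: he; rewrite ball_rV// => i.
have := hq i; have := hy i; rewrite !mxE ball_itv /= in_itv /=.
by move: hk; set r := _^-1; lra.
Unshelve. all: by end_near. Qed.

End vanishing.
End fundamental_lemma.

(** * Left-invariant fields and weak horizontal gradients *)

Lemma differentiable_cst_pair (R : realType) (V W : normedModType R) (t : W) (x : V) :
  differentiable (fun y : V => (t, y) : W * V) x.
Proof.
apply: differentiable_pair; first exact: differentiable_cst.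
exact: (@smooth_differentiable _ V V id x (@smooth_id _ V)).
Qed.

Section horizontal_fields.
Context {R : realType} (G : stratified_group R).
Local Notation E := 'rV[R]_(topdim G).
Local Notation mu := (@lebesgue_rV R (topdim G)).

Let opc (i : 'I_(topdim G)) (z : E * E) : R := gop z.1 z.2 ord0 i.

Let smooth_opc i : smooth (opc i).
Proof.
have lin : linear (fun x : E => x ord0 i : R) by move=> a x y; rewrite !mxE.
pose m := GRing.isLinear.Build _ _ _ _ _ lin.
pose L : {linear E -> R} := HB.pack (fun x : E => x ord0 i) m.
apply: (@smooth_linear_comp _ _ _ _ L (fun z : E * E => gop z.1 z.2)).
  exact: coord_continuous.
exact: gop_smooth.
Qed.

Let hfield_opc j x i : hfield j x ord0 i =
  'D_(0, delta_mx ord0 (horizontal j)) (opc i) (x, 0).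
Proof.
pose A (y : E) : E * E := (x, y).
have AE (y v : E) (h : R) : A (h *: v + y) = h *: (0, v) + A y.
  by congr pair; rewrite /= ?scaler0 ?add0r.
have dA : differentiable (gop x) (0 : E).
  have -> : gop x = (fun z : E * E => gop z.1 z.2) \o A by [].
  apply: differentiable_comp.
    exact: differentiable_cst_pair.
  exact/smooth_differentiable/gop_smooth.
rewrite /hfield /left_invariant_field -derive_coord//.
have -> : (fun y => gop x y ord0 i) = opc i \o A by [].
exact: derive_affine.
Qed.

(** A coefficient of the field at x is a directional derivative of the group law at (x, 0), and it
    inherits smoothness in x from there. *)
Lemma smooth_hfield j i : smooth (fun x : E => hfield j x ord0 i).
Proof.
under eq_fun do rewrite hfield_opc.
have lin : linear (fun x : E => (x, 0) : E * E).
  by move=> a x y; congr pair; rewrite /= ?scaler0 ?addr0.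
pose m := GRing.isLinear.Build _ _ _ _ _ lin.
pose L : {linear E -> (E * E)%type} := HB.pack (fun x : E => (x, 0) : E * E) m.
apply: (@smooth_comp_linear _ _ _ _ L ('D_(0, delta_mx ord0 (horizontal j)) (opc i))); last exact/smooth_derive/smooth_opc.
exact: (@continuous_cst_pair _ E E 0).
Qed.

Lemma weight_horizontal (j : 'I_(hdim G)) : weight (horizontal j) = 1%N.
Proof.
rewrite /weight /horizontal /reshape_index /=; case: j => j /=.
rewrite /hdim; case: (dims G) => //= n s jn.
by move: jn; rewrite -subn_eq0 => ->.
Qed.

Lemma dilation_affine (l : R) (x v : E) (h : R) :
  dilation l (h *: v + x) = h *: dilation l v + dilation l x.
Proof. by apply/rowP => i; rewrite !mxE; ring. Qed.

Lemma dilation0 (l : R) : dilation l (0 : E) = 0.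
Proof. by apply/rowP => i; rewrite !mxE mulr0. Qed.

Lemma dilation_delta (l : R) i :
  dilation l (delta_mx ord0 i : E) = l ^+ weight i *: delta_mx ord0 i.
Proof.
apply/rowP => k; rewrite !mxE eqxx /=.
by have [->|] := eqVneq k i; rewrite ?mulr1 ?mulr0.
Qed.

Lemma mulf_cancel_scaled (l a u v : R) : l != 0 -> a != 0 ->
  l^-1 * a * u = a * v -> u = l * v.
Proof. by move=> l0 a0 H; apply: (mulfI a0); rewrite mulrCA -H; field. Qed.

Lemma deriveZv (V W : normedModType R) (f : V -> W) x (a : R) v :
  differentiable f x -> 'D_(a *: v) f x = a *: 'D_v f x.
Proof. by move=> df; rewrite !deriveE// linearZ. Qed.

(** Obtained by differentiating, at the origin in a direction of weight 1, the automorphism property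
    of the dilation. The i-th coefficient of a horizontal field is thus homogeneous of degree
    [weight i] - 1. *)
Lemma hfield_dilation (l : R) (j : 'I_(hdim G)) (x : E) i : 0 < l ->
  l * hfield j (dilation l x) ord0 i = l ^+ weight i * hfield j x ord0 i.
Proof.
move=> l0; pose e : E := delta_mx ord0 (horizontal j).
have dop y : differentiable (fun z : E => gop y z ord0 i) (0 : E).
  have -> : (fun z => gop y z ord0 i) = opc i \o (fun z : E => (y, z) : E * E) by [].
  apply: differentiable_comp; last exact/smooth_differentiable/smooth_opc.
  exact: differentiable_cst_pair.
have dgop y : differentiable (gop y) (0 : E).
  have -> : gop y = (fun z : E * E => gop z.1 z.2) \o (fun z : E => (y, z) : E * E) by [].
  apply: differentiable_comp; last exact/smooth_differentiable/gop_smooth.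
  exact: differentiable_cst_pair.
have hE y : hfield j y ord0 i = 'D_e (fun z => gop y z ord0 i) (0 : E).
  by rewrite /hfield /left_invariant_field -derive_coord.
have H1 : 'D_e ((fun z => gop (dilation l x) z ord0 i) \o dilation l) 0 =
          l * hfield j (dilation l x) ord0 i.
  rewrite (@derive_affine _ _ _ _ (dilation l) _ 0 e (dilation l e)); last first.
    by move=> h; exact: dilation_affine.
  by rewrite dilation0 dilation_delta weight_horizontal expr1 deriveZv// hE.
rewrite -H1 hE.
have -> : (fun z => gop (dilation l x) z ord0 i) \o dilation l =
          l ^+ weight i \*: (fun z => gop x z ord0 i).
  by apply/funext => z /=; rewrite -dilation_gop// mxE.
by rewrite deriveZ//; exact: diff_derivable.
Qed.

(* By homogeneity, d = d_i X^i satisfies d(x) = l d(delta_l x) for all l > 0;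
   letting l tend to 0 shows that X is divergence free, term by term. *)
Lemma derive_hfield_eq0 j i x :
  'D_(delta_mx ord0 i) (fun y : E => hfield j y ord0 i) x = 0.
Proof.
pose c (y : E) : R := hfield j y ord0 i; pose d := 'D_(delta_mx ord0 i) c.
have sc : smooth c by exact: smooth_hfield.
have dd (l : R) : 0 < l -> d x = l * d (dilation l x).
  move=> l0.
  have H1 : 'D_(delta_mx ord0 i) (c \o dilation l) x = l ^+ weight i * d (dilation l x).
    rewrite (@derive_affine _ _ _ _ (dilation l) _ x _ (dilation l (delta_mx ord0 i))).
      by rewrite dilation_delta deriveZv//; exact: smooth_differentiable.
    by move=> h; exact: dilation_affine.
  have cE : c \o dilation l = (l^-1 * l ^+ weight i) \*: c.
    apply/funext => y /=; rewrite /GRing.scale /= -mulrA -/(c y) /c -hfield_dilation//.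
    by rewrite mulrA mulVf ?mul1r// gt_eqF.
  move: H1; rewrite cE deriveZ; last exact: smooth_derivable.
  rewrite -/d /GRing.scale /= => H1.
  have lw : l ^+ weight i != 0 by apply: lt0r_neq0; exact: exprn_gt0.
  have ln : l != 0 by exact: lt0r_neq0.
  exact: (mulf_cancel_scaled ln lw H1).
have cd : continuous d by exact/smooth_continuous/smooth_derive.
pose l k : R := k.+1%:R^-1.
have l0 k : 0 < l k by rewrite invr_gt0.
have lcvg : l k @[k --> \oo] --> (0 : R) by exact: cvg_harmonic.
have hl : l k * `|x| @[k --> \oo] --> (0 : R).
  by rewrite -(mul0r `|x|); apply: cvgM => //; exact: cvg_cst.
have dil : dilation (l k) x @[k --> \oo] --> (0 : E).
  apply/cvgr0Pnorm_le => e e0; near=> k.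
  have [l1 lxe] : l k <= 1 /\ l k * `|x| <= e.
    split; first by rewrite invf_le1// ler1n.
    by apply: le_trans (ler_norm _) _; near: k; move/cvgr0Pnorm_le : hl; exact.
  apply: norm_rV_le; first exact: ltW.
  move=> a; rewrite mxE normrM ger0_norm ?exprn_ge0 ?(ltW (l0 k))//.
  apply: le_trans lxe; rewrite ler_pM ?exprn_ge0 ?(ltW (l0 k))//; last exact: le_coord_norm.
  by rewrite /weight exprS ler_piMr ?(ltW (l0 k))// exprn_ile1// (ltW (l0 k)).
have H : l k * d (dilation (l k) x) @[k --> \oo] --> 0 * d 0.
  by apply: cvgM => //; have := cvg_comp _ _ dil (cd 0); exact.
have : (fun k => l k * d (dilation (l k) x)) = fun=> d x by apply/funext => k; rewrite -dd.
move=> HE; move: H; rewrite HE mul0r => H.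
have := cvg_lim (@Rhausdorff R) H; rewrite lim_cst//.
by move=> /(_ _) H1; exact: H1.
Unshelve. all: by end_near. Qed.

Definition cgrad (phi : E -> R) (x : E) : 'rV[R]_(hdim G) :=
  \row_j 'D_(hfield j x) phi x.

Lemma derive_hfieldE (phi : E -> R) j x : smooth phi ->
  'D_(hfield j x) phi x = \sum_i hfield j x ord0 i * 'D_(delta_mx ord0 i) phi x.
Proof. by move=> sphi; rewrite derive_rV//; exact: smooth_differentiable. Qed.

Lemma smooth_cgrad (phi : E -> R) j : smooth phi ->
  smooth (fun x => 'D_(hfield j x) phi x).
Proof. by move=> sphi; apply: smooth_derive_field => // i; exact: smooth_hfield. Qed.

Lemma Cc_derive_hfield (U : set E) (phi : E -> R) j : Cc_infty U phi ->
  Cc_infty U (fun x => 'D_(hfield j x) phi x).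
Proof.
move=> [sphi cphi phiU].
apply: (Cc_infty_of_compact (K := support_closure phi)) => //.
- exact: smooth_cgrad.
- exact: closed_support_closure.
- move=> x nx; rewrite -(@near_eq_derive _ _ _ (fun=> 0)) ?derive_cst//.
  have : open_nbhs x (~` support_closure phi).
    by split => //; apply: closed_openC; exact: closed_support_closure.
  by move/open_nbhs_nbhs; apply: filterS => y /Cc_infty_eq0 ->.
Qed.

Lemma Cc_bounded (U : set E) (phi : E -> R) : Cc_infty U phi ->
  exists2 C, 0 <= C & forall x, `|phi x| <= C.
Proof.
move=> Cphi; have [c c0 hc] := Cc_infty_bounded_support Cphi.
apply: continuous_support_bounded hc.
exact/smooth_continuous/(Cc_infty_smooth Cphi).
Qed.

(** As d_i X^i = 0 for each i, the derivative X w equals the sum of the d_i (w X^i), and each of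
    these is a partial derivative of a compactly supported function. *)
Lemma integral_hfield_eq0 (U : set E) (w : E -> R) j : Cc_infty U w ->
  \int[mu]_x 'D_(hfield j x) w x = 0.
Proof.
move=> Cw; have sw := Cc_infty_smooth Cw.
have H i : mu.-integrable setT (EFin \o (fun x => hfield j x ord0 i * 'D_(delta_mx ord0 i) w x)) /\
    (\int[mu]_x (hfield j x ord0 i * 'D_(delta_mx ord0 i) w x)%:E = 0)%E.
  have Cc : Cc_infty U (fun x => w x * hfield j x ord0 i).
    by apply: Cc_inftyMr => //; exact: smooth_hfield.
  have [c c0 hc] := Cc_infty_bounded_support Cc.
  have sc := Cc_infty_smooth Cc.
  have dEx x : 'D_(delta_mx ord0 i) (fun x => w x * hfield j x ord0 i) x =
      hfield j x ord0 i * 'D_(delta_mx ord0 i) w x.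
    rewrite deriveM; [|exact: smooth_derivable|exact/smooth_derivable/smooth_hfield].
    by rewrite derive_hfield_eq0 scaler0 add0r.
  have dE : 'D_(delta_mx ord0 i) (fun x => w x * hfield j x ord0 i) =
      fun x => hfield j x ord0 i * 'D_(delta_mx ord0 i) w x by exact/funext.
  have cd : continuous ('D_(delta_mx ord0 i) (fun x => w x * hfield j x ord0 i)).
    exact/smooth_continuous/smooth_derive.
  split.
    have := continuous_support_integrable cd (derive_support (delta_mx ord0 i) hc).
    by rewrite dE.
  have := integral_partial_eq0 (fun x => smooth_derivable sc) cd hc.
  by under eq_integral do rewrite dEx.
rewrite /Rintegral.
have -> : (\int[mu]_x ('D_(hfield j x) w x)%:E)%E =
  (\int[mu]_x \sum_(i < topdim G) (hfield j x ord0 i * 'D_(delta_mx ord0 i) w x)%:E)%E.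
  apply: eq_integral => x _; by rewrite derive_hfieldE// -sumEFin.
rewrite integral_sum//; last by move=> i; have [] := H i.
by rewrite big1// => i _; have [_] := H i.
Qed.

Variable Omega : set E.
Hypothesis Omega_open : open Omega.

Let mOmega : measurable Omega. Proof. exact: open_measurable_rV. Qed.

Lemma continuous_locally_integrable (f : E -> R) : continuous f ->
  locally_integrable_on Omega f.
Proof.
move=> cf K cK KO.
have mK : measurable K.
  apply: closed_measurable_rV; apply: compact_closed cK.
  exact: norm_hausdorff.
have [C hC] : exists C : R, forall x, K x -> `|f x| <= C.
  have : compact (f @` K) by apply: continuous_compact => //; exact: continuous_subspaceT.
  move=> /compact_bounded/bounded_image_le[C C0 hC]; exists C => x Kx.
  by apply: hC; exists x.
apply: (@bounded_measurable_integrable _ _ _ _ _ _ C) => //.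
- by apply: bounded_lebesgue_lty => //; exact: compact_bounded.
- by apply: measurable_funS (continuous_measurable_rV cf).
Qed.

Lemma locally_integrableM (f psi : E -> R) : locally_integrable_on Omega f ->
  Cc_infty Omega psi -> mu.-integrable Omega (EFin \o (fun x => f x * psi x)).
Proof.
move=> floc Cpsi; have [C C0 hC] := Cc_bounded Cpsi.
have [spsi cK KO] := Cpsi; pose K := support_closure psi.
have mK : measurable K by apply: closed_measurable_rV; exact: closed_support_closure.
have iK : mu.-integrable K (EFin \o f) by exact: floc.
have : mu.-integrable K (EFin \o (fun x => f x * psi x)).
  have := @integrableMl _ _ _ mu K mK (EFin \o f) psi iK.
  move=> /(_ _ _); apply.
    by apply: measurable_funS (continuous_measurable_rV (smooth_continuous spsi)).
  exact: le_bounded_image.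
move=> /(integrable_setT_support mK) h.
apply: (integrableS measurableT) => //; apply: h => x nx.
by rewrite (Cc_infty_eq0 nx) mulr0.
Qed.

(** Integration by parts: X (phi psi) has integral zero. *)
Lemma cgrad_weak_hgrad (phi : E -> R) : Cc_infty Omega phi ->
  weak_hgrad Omega phi (cgrad phi).
Proof.
move=> Cphi j; have sphi := Cc_infty_smooth Cphi.
have lphi : locally_integrable_on Omega phi.
  exact/continuous_locally_integrable/smooth_continuous.
have lg : locally_integrable_on Omega (fun x => cgrad phi x ord0 j).
  apply: continuous_locally_integrable.
  under eq_fun do rewrite mxE.
  exact/smooth_continuous/smooth_cgrad.
split => // psi Cpsi; have spsi := Cc_infty_smooth Cpsi.
have Cd := Cc_derive_hfield j Cpsi.
apply/eqP; rewrite -subr_eq0 opprK -RintegralD//; [|exact: locally_integrableM..].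
have C1 := Cc_inftyMr Cphi spsi.
rewrite -(integral_hfield_eq0 j C1).
have dE x : phi x * 'D_(hfield j x) psi x + cgrad phi x ord0 j * psi x =
    'D_(hfield j x) (fun x => phi x * psi x) x.
  rewrite deriveM; [|exact: smooth_derivable..]; rewrite mxE.
  by congr (_ + _); rewrite mulrC.
under eq_Rintegral do rewrite dE.
apply/eqP; apply: Rintegral_support => // x _ nx.
exact: (Cc_infty_out (Cc_derive_hfield j C1)).
Qed.

Lemma locally_integrableD (f g : E -> R) : locally_integrable_on Omega f ->
  locally_integrable_on Omega g -> locally_integrable_on Omega (fun x => f x + g x).
Proof.
move=> hf hg K cK KO; have mK : measurable K.
  by apply: closed_measurable_rV; apply: compact_closed cK; exact: norm_hausdorff.
have := integrableD mK (hf K cK KO) (hg K cK KO); congr integrable.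
Qed.

Lemma locally_integrableZ (a : R) (f : E -> R) : locally_integrable_on Omega f ->
  locally_integrable_on Omega (fun x => a * f x).
Proof.
move=> hf K cK KO; have mK : measurable K.
  by apply: closed_measurable_rV; apply: compact_closed cK; exact: norm_hausdorff.
have := integrableZl mK a (hf K cK KO); congr integrable.
Qed.

Lemma weak_hgradD (u v : E -> R) (g h : E -> 'rV[R]_(hdim G)) :
  weak_hgrad Omega u g -> weak_hgrad Omega v h ->
  weak_hgrad Omega (fun x => u x + v x) (fun x => g x + h x).
Proof.
move=> Hu Hv j; have [lu lg eu] := Hu j; have [lv lh ev] := Hv j.
have lgh : locally_integrable_on Omega (fun x => (g x + h x) ord0 j).
  by under eq_fun do rewrite mxE; exact: locally_integrableD.
split => //; first exact: locally_integrableD.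
move=> phi Cphi; have Cd := Cc_derive_hfield j Cphi.
under eq_Rintegral do rewrite mulrDl.
rewrite RintegralD//; [|exact: locally_integrableM..].
rewrite eu// ev// -opprD; congr (- _).
rewrite -RintegralD//; [|exact: locally_integrableM..].
by apply: eq_Rintegral => x _; rewrite mxE mulrDl.
Qed.

Lemma weak_hgradZ (a : R) (u : E -> R) (g : E -> 'rV[R]_(hdim G)) :
  weak_hgrad Omega u g -> weak_hgrad Omega (fun x => a * u x) (fun x => a *: g x).
Proof.
move=> Hu j; have [lu lg eu] := Hu j.
split; [exact: locally_integrableZ| |].
  by under eq_fun do rewrite mxE; exact: locally_integrableZ.
move=> phi Cphi; have Cd := Cc_derive_hfield j Cphi.
under eq_Rintegral do rewrite -mulrA.
rewrite RintegralZl//; last exact: locally_integrableM.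
rewrite eu// mulrN; congr (- _); rewrite -RintegralZl//; last exact: locally_integrableM.
by apply: eq_Rintegral => x _; rewrite mxE mulrA.
Qed.

Lemma weak_hgradB (u v : E -> R) (g h : E -> 'rV[R]_(hdim G)) :
  weak_hgrad Omega u g -> weak_hgrad Omega v h ->
  weak_hgrad Omega (fun x => u x - v x) (fun x => g x - h x).
Proof.
move=> Hu /(weak_hgradZ (-1)) Hv; have := weak_hgradD Hu Hv; congr weak_hgrad.
  by apply/funext => x; rewrite mulN1r.
by apply/funext => x; rewrite scaleN1r.
Qed.

(** Each component of the difference of the two gradients is orthogonal to all test functions. *)
Lemma weak_hgrad_unique (u : E -> R) (g h : E -> 'rV[R]_(hdim G)) :
  weak_hgrad Omega u g -> weak_hgrad Omega u h ->
  {ae mu, forall x, Omega x -> g x = h x}.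
Proof.
move=> Hg Hh.
have Hj j : {ae mu, forall x, Omega x -> (fun x => g x ord0 j + - 1 * h x ord0 j) x = 0}.
  have [_ lg eg] := Hg j; have [_ lh eh] := Hh j.
  have lh' := locally_integrableZ (-1) lh.
  apply: ae_eq0_of_test => //; first exact: locally_integrableD.
  move=> psi Cpsi _; under eq_Rintegral do rewrite mulrDl -mulrA.
  rewrite RintegralD//; [|exact: locally_integrableM|]; last first.
    by have := locally_integrableM lh' Cpsi; under eq_fun do rewrite -mulrA.
  rewrite RintegralZl//; last exact: locally_integrableM.
  have := eg psi Cpsi; rewrite eh// => /oppr_inj ->.
  by rewrite mulN1r subrr.
have := ae_forall_countable Hj; apply: filterS => x hx Ox.
apply/rowP => j; have := hx j Ox; rewrite mulN1r => /eqP.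
by rewrite subr_eq0 => /eqP.
Qed.

End horizontal_fields.

(** * Crude inequalities for the Euclidean norm *)

Section euclid.
Context {R : realType}.

Lemma dotR_ge0 n (v : 'rV[R]_n) : 0 <= dotR v v.
Proof. by apply: sumr_ge0 => i _; rewrite -expr2 sqr_ge0. Qed.

Lemma euclid_norm_ge0 n (v : 'rV[R]_n) : 0 <= euclid_norm v.
Proof. exact: sqrtr_ge0. Qed.

Lemma euclid_norm_sqr n (v : 'rV[R]_n) : euclid_norm v ^+ 2 = dotR v v.
Proof. by rewrite /euclid_norm sqr_sqrtr// dotR_ge0. Qed.

Lemma le_coord_euclid n (v : 'rV[R]_n) i : `|v ord0 i| <= euclid_norm v.
Proof.
rewrite -sqrtr_sqr ler_wsqrtr// /dotR (bigD1 i)//= -expr2 lerDl.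
by apply: sumr_ge0 => k _; rewrite -expr2 sqr_ge0.
Qed.

Lemma euclid_normZ n (a : R) (v : 'rV[R]_n) : euclid_norm (a *: v) = `|a| * euclid_norm v.
Proof.
rewrite /euclid_norm (_ : dotR (a *: v) (a *: v) = a ^+ 2 * dotR v v).
  by rewrite sqrtrM ?sqr_ge0// sqrtr_sqr.
by rewrite /dotR mulr_sumr; apply: eq_bigr => i _; rewrite !mxE; ring.
Qed.

(** The constant 2 comes from |v + w|^2 <= 2 |v|^2 + 2 |w|^2, coordinate by coordinate. Sharp
    constants are irrelevant, as the inequality only serves convergence and domination. *)
Lemma euclid_normD_max n (v w : 'rV[R]_n) :
  euclid_norm (v + w) <= 2 * Num.max (euclid_norm v) (euclid_norm w).
Proof.
set m := Num.max _ _.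
have m0 : 0 <= m by rewrite le_max euclid_norm_ge0.
have H (a : R) : 0 <= a -> a <= m -> a ^+ 2 <= m ^+ 2 by move=> a0 am; rewrite lerXn2r// ?nnegrE.
have hv : dotR v v <= m ^+ 2.
  by rewrite -euclid_norm_sqr H// ?euclid_norm_ge0// le_max lexx.
have hw : dotR w w <= m ^+ 2.
  by rewrite -euclid_norm_sqr H// ?euclid_norm_ge0// le_max lexx orbT.
rewrite -[leRHS]ger0_norm ?mulr_ge0// -sqrtr_sqr ler_wsqrtr//.
apply: (@le_trans _ _ (2 * dotR v v + 2 * dotR w w)); last by lra.
rewrite /dotR !mulr_sumr -big_split /=; apply: ler_sum => i _.
rewrite !mxE; have := sqr_ge0 (v ord0 i - w ord0 i); lra.
Qed.

(** Each of the n terms is bounded by the product of the norms; the factor n stands in for the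
    Cauchy-Schwarz inequality and is harmless in a majorant. *)
Lemma dotR_le n (v w : 'rV[R]_n) : `|dotR v w| <= n%:R * (euclid_norm v * euclid_norm w).
Proof.
rewrite /dotR (le_trans (ler_norm_sum _ _ _))//.
rewrite -[X in X%:R * _](card_ord n) mulr_natl -sumr_const.
by apply: ler_sum => i _; rewrite normrM ler_pM// le_coord_euclid.
Qed.

Lemma dotRDr n (v w1 w2 : 'rV[R]_n) : dotR v (w1 + w2) = dotR v w1 + dotR v w2.
Proof. by rewrite /dotR -big_split; apply: eq_bigr => i _; rewrite mxE mulrDr. Qed.

Lemma dotRZr n (a : R) (v w : 'rV[R]_n) : dotR v (a *: w) = a * dotR v w.
Proof. by rewrite /dotR mulr_sumr; apply: eq_bigr => i _; rewrite mxE; ring. Qed.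

Lemma measurable_dotR d (T : measurableType d) (A : set T) n (f g : T -> 'rV[R]_n) :
  (forall j, measurable_fun A (fun x => f x ord0 j)) ->
  (forall j, measurable_fun A (fun x => g x ord0 j)) ->
  measurable_fun A (fun x => dotR (f x) (g x)).
Proof. by move=> mf mg; apply: measurable_sum => i; exact: measurable_funM. Qed.

Lemma measurable_sqrt : measurable_fun [set: R] (@Num.sqrt R).
Proof. by apply: continuous_measurable_fun; exact: sqrt_continuous. Qed.

Lemma measurable_euclid_norm d (T : measurableType d) (A : set T) n (f : T -> 'rV[R]_n) :
  (forall j, measurable_fun A (fun x => f x ord0 j)) ->
  measurable_fun A (fun x => euclid_norm (f x)).
Proof.
by move=> mf; apply: (measurableT_comp measurable_sqrt); exact: measurable_dotR.
Qed.

Lemma measurable_powR_comp d (T : measurableType d) (A : set T) (f : T -> R) (p : R) :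
  measurable_fun A f -> measurable_fun A (fun x => f x `^ p).
Proof. by move=> mf; exact: (measurableT_comp (measurable_powR p)). Qed.

(** Bounding by the maximum before taking the power gives one constant for all exponents, with no
    appeal to convexity. *)
Lemma powR_max_le (a b c p : R) : 0 <= p -> 0 <= a -> 0 <= b -> 0 <= c -> c <= 2 * Num.max a b ->
  c `^ p <= 2 `^ p * (a `^ p + b `^ p).
Proof.
move=> p0 a0 b0 c0 hc.
have h : c `^ p <= 2 `^ p * Num.max a b `^ p.
  rewrite -powRM ?le_max ?a0//; apply: ge0_ler_powR; rewrite ?nnegrE ?mulr_ge0 ?le_max ?a0//.
apply: le_trans h _; rewrite ler_wpM2l ?powR_ge0//.
by case: (leP a b) => _; rewrite ?lerDl ?lerDr powR_ge0.
Qed.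

Lemma normD_max (a b : R) : `|a + b| <= 2 * Num.max `|a| `|b|.
Proof.
rewrite (le_trans (ler_normD _ _))// mulr_natl mulr2n lerD// le_max lexx ?orbT//.
Qed.

End euclid.

(** * L^p membership and measurability on an open set *)

Section Lp_theory.
Context {R : realType} (G : stratified_group R).
Local Notation E := 'rV[R]_(topdim G).
Local Notation mu := (@lebesgue_rV R (topdim G)).
Variable Omega : set E.
Hypothesis Omega_open : open Omega.

Let mO : measurable Omega. Proof. exact: open_measurable_rV. Qed.

Lemma integral_powR_Lnorm (p : R) (f : E -> R) : 0 < p ->
  (\int[mu]_(x in Omega) (`|f x| `^ p)%:E = 'N[mu]_p%:E [EFin \o (f \_ Omega)] `^ p)%E.
Proof.
move=> p0; rewrite powR_Lnorm; last by rewrite gt_eqF.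
etransitivity; first exact: integral_mkcond.
apply: eq_integral => x _; rewrite patchE /= patchE /=; case: ifPn => _ //=.
by rewrite normr0 powR0// gt_eqF.
Qed.

Lemma LpP (p : R) (f : E -> R) : 0 < p ->
  Lp p%:E Omega f <->
  measurable_fun Omega f /\ (\int[mu]_(x in Omega) (`|f x| `^ p)%:E < +oo)%E.
Proof.
move=> p0.
have mE : measurable_fun Omega f <-> measurable_fun setT (f \_ Omega).
  by rewrite -(measurable_restrict _ mO measurableT) setTI.
rewrite (integral_powR_Lnorm f p0); split.
  rewrite /Lp /= inE => /andP[]; rewrite !inE /= => mf fin; split; first exact/mE.
  exact: poweR_lty.
move=> [mf fin]; rewrite /Lp /= inE; apply/andP; split; rewrite inE /=; first exact/mE.
by apply: lty_poweRy fin; rewrite gt_eqF.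
Qed.

Definition box_index := ('rV[rat]_(topdim G) * nat)%type.
Definition box_lo (q : box_index) : E := \row_i (ratr (q.1 ord0 i) - q.2.+1%:R^-1).
Definition box_hi (q : box_index) : E := \row_i (ratr (q.1 ord0 i) + q.2.+1%:R^-1).

Lemma exists_box (x : E) : Omega x -> exists q : box_index,
  cbox (box_lo q) (box_hi q) `<=` Omega /\ box (box_lo q) (box_hi q) x.
Proof.
move=> Ox; have /nbhs_ballP[e /= e0 he] := open_nbhs_nbhs (conj Omega_open Ox).
have [k hk] : exists k : nat, k.+1%:R^-1 < e / 2.
  near \oo => k; exists k; near: k.
  exact: (near_infty_natSinv_lt (PosNum (divr_gt0 e0 (ltr0n _ 2)))).
have k0 : 0 < k.+1%:R^-1 :> R by rewrite invr_gt0.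
have [q hq] := exists_rat_ball_rV x k0.
have rowE (s : R) : (\row_i ((map_mx ratr q : E) ord0 i + s)) = \row_i (ratr (q ord0 i) + s).
  by apply/rowP => i; rewrite !mxE.
move: hq; rewrite ball_box// !rowE => hq.
exists (q, k); split => // y hy; apply: he; rewrite ball_rV// => i.
have := hq i; have := hy i; rewrite !mxE ball_itv /= in_itv /=.
by move: hk; set r := _^-1; lra.
Unshelve. all: by end_near. Qed.

(** Local integrability yields measurability on compact sets only; the pieces are glued along
    countably many boxes with closure in [Omega]. *)
Lemma locally_integrable_measurable (f : E -> R) :
  locally_integrable_on Omega f -> measurable_fun Omega f.
Proof.
move=> lf _ Y mY.
rewrite (_ : _ `&` _ = \bigcup_(q : box_index)
  (if `[< cbox (box_lo q) (box_hi q) `<=` Omega >]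
   then box (box_lo q) (box_hi q) `&` f @^-1` Y else set0)); last first.
  apply/seteqP; split => x.
    move=> [Ox Yx]; have [q [h1 h2]] := exists_box Ox; exists q => //.
    by rewrite ifT//; exact/asboolP.
  move=> [q _]; case: asboolP => // h [h1 h2]; split => //; apply: h; exact: box_cbox.
apply: countable_bigcupT_measurable; first exact: countableP.
move=> q; case: asboolP => h; last exact: measurable0.
have mK : measurable (cbox (box_lo q) (box_hi q)) by apply: closed_measurable_rV; exact: closed_cbox.
have mB : measurable (box (box_lo q) (box_hi q)) by apply: open_measurable_rV; exact: open_box.
have /measurable_int/measurable_EFinP mf := lf _ (@compact_cbox _ _ (box_lo q) (box_hi q)) h.
have := measurable_funS mK (@box_cbox _ _ _ _) mf.
by move=> /(_ mB _ mY).
Qed.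

End Lp_theory.

(** * Energies and approximation by C_c^oo functions *)

Section energy.
Context {R : realType} (G : stratified_group R).
Local Notation E := 'rV[R]_(topdim G).
Local Notation mu := (@lebesgue_rV R (topdim G)).
Variables (Omega : set E) (p : R).
Hypotheses (Omega_open : open Omega) (p_gt0 : 0 < p).

Let mO : measurable Omega. Proof. exact: open_measurable_rV. Qed.

(* The p-th power of the norm of S^{1,p}, with the gradient as an argument. *)
Definition energy (u : E -> R) (g : E -> 'rV[R]_(hdim G)) : \bar R :=
  (\int[mu]_(x in Omega) (euclid_norm (g x) `^ p + `|u x| `^ p)%:E)%E.

Lemma weak_hgrad_measurable u (g : E -> 'rV[R]_(hdim G)) j : weak_hgrad Omega u g ->
  measurable_fun Omega (fun x => g x ord0 j).
Proof. by move=> /(_ j)[_ lg _]; exact: locally_integrable_measurable. Qed.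

(** [weak_hgrad] records the local integrability of [u] once for each horizontal direction, so that
    one direction must exist for it to be extracted. *)
Lemma hdim_gt0 : (0 < hdim G)%N.
Proof.
rewrite /hdim; have := dims_neq0 G; have := dims_gt0 G.
by case: (dims G) => //= n s /andP[].
Qed.

Lemma weak_hgrad_measurable_fun u (g : E -> 'rV[R]_(hdim G)) : weak_hgrad Omega u g ->
  measurable_fun Omega u.
Proof.
by move=> /(_ (Ordinal hdim_gt0))[lu _ _]; exact: locally_integrable_measurable.
Qed.

Lemma measurable_energy u (g : E -> 'rV[R]_(hdim G)) : weak_hgrad Omega u g ->
  measurable_fun Omega (fun x => euclid_norm (g x) `^ p + `|u x| `^ p).
Proof.
move=> H; apply: measurable_funD; apply: measurable_powR_comp.
  by apply: measurable_euclid_norm => j; exact: weak_hgrad_measurable H.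
by apply: measurableT_comp => //; exact: weak_hgrad_measurable_fun H.
Qed.

Lemma energy_ge0 u g : (0 <= energy u g)%E.
Proof. by apply: integral_ge0 => x _; rewrite lee_fin addr_ge0 ?powR_ge0. Qed.

(** [Jp] is written with the gradient picked by [xget]. By uniqueness almost everywhere, any known
    weak gradient gives the same value. *)
Lemma JpE u g : weak_hgrad Omega u g -> Jp p Omega u = (energy u g `^ p^-1)%E.
Proof.
move=> H; apply: (congr1 (fun z => (z `^ p^-1)%E)).
have Hh : weak_hgrad Omega u (hgrad Omega u).
  by rewrite /hgrad; apply: (@xgetPex _ _ [set g | weak_hgrad Omega u g]); exists g.
apply: ae_eq_integral => //.
- by apply/measurable_EFinP; exact: measurable_energy.
- by apply/measurable_EFinP; exact: measurable_energy.
- have := weak_hgrad_unique Omega_open Hh H; apply: filterS => x hx Ox.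
  by rewrite hx.
Qed.

Lemma energy_poweR u g : weak_hgrad Omega u g -> (Jp p Omega u `^ p)%E = energy u g.
Proof.
move=> H; rewrite (JpE H) -poweRrM mulVf ?gt_eqF// poweRe1//.
exact: energy_ge0.
Qed.

Lemma Jp_lt_energy u g (d : R) : 0 < d -> weak_hgrad Omega u g ->
  (Jp p Omega u < (d `^ p^-1)%:E)%E -> (energy u g < d%:E)%E.
Proof.
move=> d0 H; rewrite (JpE H) ltNge => hlt; rewrite ltNge; apply/negP => h; move/negP : hlt; apply.
rewrite -poweR_EFin; apply: gt0_ler_poweR => //.
- by rewrite invr_ge0 ltW.
- by rewrite in_itv /= leey andbT lee_fin ltW.
- by rewrite in_itv /= leey andbT energy_ge0.
Qed.

Lemma energyD u v g h : weak_hgrad Omega u g -> weak_hgrad Omega v h ->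
  (energy (fun x => u x + v x)%R (fun x => g x + h x)%R <=
   (2 `^ p)%:E * (energy u g + energy v h))%E.
Proof.
move=> Hu Hv.
rewrite -ge0_integralD//; last 4 first.
- by move=> x _; rewrite lee_fin addr_ge0 ?powR_ge0.
- by apply/measurable_EFinP; exact: measurable_energy.
- by move=> x _; rewrite lee_fin addr_ge0 ?powR_ge0.
- by apply/measurable_EFinP; exact: measurable_energy.
have msum : measurable_fun Omega (fun x => ((euclid_norm (g x) `^ p + `|u x| `^ p)%:E
   + (euclid_norm (h x) `^ p + `|v x| `^ p)%:E)%E).
  by apply: emeasurable_funD; apply/measurable_EFinP; exact: measurable_energy.
rewrite -ge0_integralZl//; last first.
  by move=> x _; rewrite -EFinD lee_fin !addr_ge0 ?powR_ge0.
apply: ge0_le_integral => //.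
- by move=> x _; rewrite lee_fin addr_ge0 ?powR_ge0.
- by apply/measurable_EFinP; apply: measurable_energy; exact: weak_hgradD.
- exact: measurable_funeM.
- move=> x _; rewrite -EFinD -EFinM lee_fin.
  have h1 := powR_max_le (ltW p_gt0) (euclid_norm_ge0 (g x)) (euclid_norm_ge0 (h x))
    (euclid_norm_ge0 _) (euclid_normD_max (g x) (h x)).
  have h2 := powR_max_le (ltW p_gt0) (normr_ge0 (u x)) (normr_ge0 (v x))
    (normr_ge0 _) (normD_max (u x) (v x)).
  by apply: le_trans (lerD h1 h2) _; rewrite -mulrDr addrACA.
Qed.

Lemma energy0 : energy (fun=> 0) (fun=> 0) = 0%E.
Proof.
apply: integral0_eq => x _; rewrite normr0 powR0 ?gt_eqF// addr0.
rewrite (_ : euclid_norm 0 = 0) ?powR0 ?gt_eqF//.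
by rewrite -(scale0r (0 : 'rV[R]_(hdim G))) euclid_normZ normr0 mul0r.
Qed.

(** The approximating class is a parameter, so that one countable class can serve almost all times
    at once; an explicit gradient avoids the choice made in [hgrad]. *)
Definition approximable (D : set (E -> R)) (u : E -> R) (g : E -> 'rV[R]_(hdim G)) :=
  forall e : R, 0 < e -> exists2 phi, D phi &
    (energy (fun x => u x - phi x)%R (fun x => g x - cgrad phi x)%R < e%:E)%E.

Lemma cgradD (f h : E -> R) x : smooth f -> smooth h ->
  cgrad (fun x => f x + h x) x = cgrad f x + cgrad h x :> 'rV[R]_(hdim G).
Proof.
move=> sf sh; apply/rowP => j; rewrite !mxE.
by rewrite deriveD//; exact: smooth_derivable.
Qed.

Lemma lte_scaled_add (c d : R) (a b : \bar R) : 0 < c -> (0 <= a)%E -> (0 <= b)%E ->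
  (a < d%:E)%E -> (b < d%:E)%E -> (c%:E * (a + b) < (c * (d + d))%:E)%E.
Proof.
move=> c0; case: a => [a| |]//; case: b => [b| |]// _ _.
rewrite !lte_fin => ad bd.
by rewrite ltr_pM2l// ltrD.
Qed.

Lemma approximableD (D : set (E -> R)) u v g h :
  D `<=` Cc_infty Omega -> (forall f1 f2, D f1 -> D f2 -> D (fun x => f1 x + f2 x)) ->
  weak_hgrad Omega u g -> weak_hgrad Omega v h ->
  approximable D u g -> approximable D v h ->
  approximable D (fun x => u x + v x) (fun x => g x + h x).
Proof.
move=> DC DD Hu Hv Au Av e e0.
have c0 : 0 < 2 `^ p :> R by rewrite powR_gt0.
(* The energy satisfies the triangle inequality only up to the factor 2^p; two errors of this size
   add up to [e] after multiplication by it. *)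
pose e' := e / (2 `^ p) / 2.
have e'0 : 0 < e' by rewrite !divr_gt0.
have [f1 D1 h1] := Au _ e'0; have [f2 D2 h2] := Av _ e'0.
exists (fun x => f1 x + f2 x); first exact: DD.
have W1 := weak_hgradB Omega_open Hu (cgrad_weak_hgrad Omega_open (DC _ D1)).
have W2 := weak_hgradB Omega_open Hv (cgrad_weak_hgrad Omega_open (DC _ D2)).
have := energyD W1 W2.
rewrite (_ : (fun x => u x - f1 x + (v x - f2 x)) = fun x => u x + v x - (f1 x + f2 x)); last first.
  by apply/funext => x; ring.
rewrite (_ : (fun x => _ - _ + _) = fun x => g x + h x - cgrad (fun x => f1 x + f2 x) x); last first.
  apply/funext => x; rewrite cgradD; [|exact: Cc_infty_smooth (DC _ _)..].
  by rewrite opprD addrACA.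
move=> /le_lt_trans; apply.
rewrite (_ : e = 2 `^ p * (e' + e')); last by rewrite /e'; field; rewrite gt_eqF.
by apply: lte_scaled_add => //; exact: energy_ge0.
Qed.

Lemma approximable_close (D : set (E -> R)) u g : D `<=` Cc_infty Omega ->
  weak_hgrad Omega u g ->
  (forall e : R, 0 < e -> exists v h, [/\ weak_hgrad Omega v h, approximable D v h &
    (energy (fun x => u x - v x)%R (fun x => g x - h x)%R < e%:E)%E]) ->
  approximable D u g.
Proof.
move=> DC Hu H e e0.
have c0 : 0 < 2 `^ p :> R by rewrite powR_gt0.
pose e' := e / (2 `^ p) / 2.
have e'0 : 0 < e' by rewrite !divr_gt0.
have [v [h [Hv Av h1]]] := H _ e'0; have [f Df h2] := Av _ e'0.
exists f => //.
have W1 := weak_hgradB Omega_open Hu Hv.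
have W2 := weak_hgradB Omega_open Hv (cgrad_weak_hgrad Omega_open (DC _ Df)).
have := energyD W1 W2.
rewrite (_ : (fun x => u x - v x + (v x - f x)) = fun x => u x - f x); last first.
  by apply/funext => x; ring.
rewrite (_ : (fun x => _ - _ + _) = fun x => g x - cgrad f x); last first.
  by apply/funext => x; rewrite addrA subrK.
move=> /le_lt_trans; apply.
rewrite (_ : e = 2 `^ p * (e' + e')); last by rewrite /e'; field; rewrite gt_eqF.
by apply: lte_scaled_add => //; exact: energy_ge0.
Qed.

Lemma Jp_cvg_energy (w : nat -> E -> R) (gw : nat -> E -> 'rV[R]_(hdim G)) :
  (forall k, weak_hgrad Omega (w k) (gw k)) ->
  Jp p Omega (w k) @[k --> \oo] --> 0%E ->
  forall e : R, 0 < e -> exists k, (energy (w k) (gw k) < e%:E)%E.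
Proof.
move=> Hw cw e e0.
have d0 : (0 < (e `^ p^-1)%:E)%E by rewrite lte_fin powR_gt0.
have [k hk] : exists k, (Jp p Omega (w k) < (e `^ p^-1)%:E)%E.
  near \oo => k; exists k; near: k.
  have : nbhs 0%E [set y : \bar R | (y < (e `^ p^-1)%:E)%E].
    by apply: open_nbhs_nbhs; split => //; exact: open_ereal_lt_ereal.
  by move/cw.
by exists k; apply: Jp_lt_energy hk.
Unshelve. all: by end_near. Qed.

Lemma cgrad_cst0 : cgrad (fun _ : E => 0 : R) = (fun=> 0) :> (E -> 'rV[R]_(hdim G)).
Proof. by apply/funext => x; apply/rowP => j; rewrite !mxE derive_cst. Qed.

Lemma weak_hgrad0 : weak_hgrad Omega (fun=> 0 : R) (fun=> 0 : 'rV[R]_(hdim G)).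
Proof. by have := cgrad_weak_hgrad Omega_open (Cc_infty0 Omega); rewrite cgrad_cst0. Qed.

Lemma approximable0 (D : set (E -> R)) : D (fun=> 0) ->
  approximable D (fun=> 0) (fun=> 0).
Proof.
move=> D0 e e0; exists (fun=> 0) => //.
rewrite cgrad_cst0 (_ : (fun x : E => 0 - 0 : R) = fun=> 0); last first.
  by apply/funext => x; rewrite subrr.
rewrite (_ : (fun x : E => 0 - 0 : 'rV[R]_(hdim G)) = fun=> 0) ?energy0 ?lte_fin//.
by apply/funext => x; rewrite subrr.
Qed.

Definition additive_class (D : set (E -> R)) :=
  [/\ D `<=` Cc_infty Omega, D (fun=> 0) &
      forall f1 f2, D f1 -> D f2 -> D (fun x => f1 x + f2 x)].

Lemma S01p_approximants u : S01p p Omega u -> exists2 phi : nat -> E -> R,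
  (forall m, Cc_infty Omega (phi m)) &
  exists2 g, weak_hgrad Omega u g & approximable (range phi) u g.
Proof.
move=> [[_ [g [wg _]]] [phi [Cphi cphi]]]; exists phi => //; exists g => // e e0.
have [m hm] := @Jp_cvg_energy (fun m x => u x - phi m x) (fun m x => g x - cgrad (phi m) x)
  (fun m => weak_hgradB Omega_open wg (cgrad_weak_hgrad Omega_open (Cphi m))) cphi e e0.
by exists (phi m).
Qed.

(** At each time a simple function is the sum of some of finitely many elements of S_0^{1,p}.
    Approximants of these, fixed before [D] and [t] are, therefore suffice for every class that
    contains them and is stable under addition. *)
Lemma simple_into_approximants (s : R -> E -> R) : simple_into (S01p p Omega) s ->
  exists2 phi : nat -> nat -> E -> R, (forall i m, Cc_infty Omega (phi i m)) &
  forall D t, additive_class D -> (forall i m, D (phi i m)) ->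
  exists2 g, weak_hgrad Omega (s t) g & approximable D (s t) g.
Proof.
move=> [n [A [b [mA Sb ->]]]].
have /choice[phi hphi] : forall i, exists phi : nat -> E -> R,
    (forall m, Cc_infty Omega (phi m)) /\
    exists2 g, weak_hgrad Omega (b i) g & approximable (range phi) (b i) g.
  by move=> i; have [phi h1 h2] := S01p_approximants (Sb i); exists phi.
(* The finite family is padded with the zero function, so that the index type no longer depends on
   the simple function. *)
pose phi' i m := if insub i is Some j then phi j m else fun=> 0.
exists phi'.
  move=> i m; rewrite /phi'; case: insub => [j|]; last exact: Cc_infty0.
  by have [h _] := hphi j; exact: h.
move=> D t [DC D0 DD] Dphi.
elim: (index_enum _) => [|i r [g IH1 IH2]].
  exists (fun=> 0); first by under eq_fun do rewrite big_nil; exact: weak_hgrad0.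
  by under eq_fun do rewrite big_nil; exact: approximable0.
have [_ [gi w1 w2]] := hphi i.
exists (fun x => \1_(A i) t *: gi x + g x).
  under eq_fun do rewrite big_cons.
  by apply: weak_hgradD => //; exact: weak_hgradZ.
under eq_fun do rewrite big_cons.
apply: (@approximableD D (fun x => \1_(A i) t * b i x) _ (fun x => \1_(A i) t *: gi x) g DC DD _ IH1 _ IH2).
  exact: weak_hgradZ.
(* The weight is 0 or 1. This is why closure under sums is enough and the class can remain
   countable: no real multiples enter. *)
rewrite indicE; case: (_ \in _) => /=.
  have -> : (fun x => 1 * b i x) = b i by apply/funext => x; rewrite mul1r.
  have -> : (fun x => 1 *: gi x) = gi by apply/funext => x; rewrite scale1r.
  move=> e e0; have [_ [m _ <-] hm] := w2 e e0; exists (phi i m) => //.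
  by have := Dphi i m; rewrite /phi' valK.
have -> : (fun x => 0 * b i x) = fun=> 0 by apply/funext => x; rewrite mul0r.
have -> : (fun x => 0 *: gi x) = fun=> 0 by apply/funext => x; rewrite scale0r.
exact: approximable0.
Qed.

(** Strong measurability provides the separability: almost every [v t] is a limit of values of
    countably many simple functions, and these values are approximated by finite sums from one
    countable set of C_c^oo functions. The null set of times does not depend on the gradient. *)
Lemma exists_countable_approximants (T : R) (v : R -> E -> R) :
  strongly_measurable (S01p p Omega) (Jp p Omega) T v ->
  exists2 D : nat -> E -> R, (forall k, Cc_infty Omega (D k)) &
    {ae @lebesgue_measure R, forall t, 0 < t < T ->
      forall g, weak_hgrad Omega (v t) g -> approximable (range D) (v t) g}.
Proof.
move=> [s [hs cs]].
have /choice[phi hphi] : forall k, exists phi : nat -> nat -> E -> R,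
    (forall i m, Cc_infty Omega (phi i m)) /\
    forall D t, additive_class D -> (forall i m, D (phi i m)) ->
    exists2 g, weak_hgrad Omega (s k t) g & approximable D (s k t) g.
  by move=> k; have [phi h1 h2] := simple_into_approximants (hs k); exists phi.
pose S (l : seq (nat * nat * nat)) (x : E) := \sum_(q <- l) phi q.1.1 q.1.2 q.2 x.
have CS l : Cc_infty Omega (S l).
  by apply: Cc_infty_sum => q; have [h _] := hphi q.1.1; exact: h.
(* An enumeration of all finite sums; numbers that encode no list are sent to the zero function,
   which is the empty sum. *)
pose D k := if unpickle k is Some l then S l else fun=> 0.
have DS l : range D (S l) by exists (pickle l) => //; rewrite /D pickleK.
have DE f : range D f -> exists l, f = S l.
  move=> [k _ <-]; rewrite /D; case: unpickle => [l|]; first by exists l.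
  by exists [::]; apply/funext => x; rewrite /S big_nil.
have aD : additive_class (range D).
  split.
  - by move=> f /DE[l ->].
  - by have := DS [::]; congr (range D _); apply/funext => x; rewrite /S big_nil.
  - move=> f1 f2 /DE[l1 ->] /DE[l2 ->]; have := DS (l1 ++ l2).
    by congr (range D _); apply/funext => x; rewrite /S big_cat.
exists D; first by move=> k; have [h _ _] := aD; apply: h; exists k.
apply: ae_imp cs => t ht tT g Hg.
have [DC _ _] := aD.
apply: approximable_close => // e e0.
have /choice[gs hgs] : forall k, exists g, weak_hgrad Omega (s k t) g /\
    approximable (range D) (s k t) g.
  move=> k; have [_ h] := hphi k; have [|g' h1 h2] := h (range D) t aD; last by exists g'.
  move=> i m; have := DS [:: (k, i, m)]; congr (range D _).
  by apply/funext => x; rewrite /S big_seq1.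
have [k hk] := @Jp_cvg_energy (fun k x => v t x - s k t x) (fun k x => g x - gs k x)
   (fun k => weak_hgradB Omega_open Hg (hgs k).1) (ht tT) e e0.
by exists (s k t), (gs k); split; [exact: (hgs k).1|exact: (hgs k).2|].
Qed.

End energy.

(** * Homogeneity of the norms and integrability of C_c^oo functions *)

Section scaling.
Context {R : realType} (G : stratified_group R).
Local Notation E := 'rV[R]_(topdim G).
Local Notation mu := (@lebesgue_rV R (topdim G)).
Variables (Omega : set E).
Hypotheses (Omega_open : open Omega) (Omega_bounded : bounded_set Omega).

Let mO : measurable Omega. Proof. exact: open_measurable_rV. Qed.

Lemma lebesgue_domain_lty : (mu Omega < +oo)%E.
Proof. exact: bounded_lebesgue_lty. Qed.

Lemma energyZ (p a : R) (u : E -> R) (g : E -> 'rV[R]_(hdim G)) : 0 < p ->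
  weak_hgrad Omega u g ->
  energy Omega p (fun x => a * u x) (fun x => a *: g x) = ((`|a| `^ p)%:E * energy Omega p u g)%E.
Proof.
move=> p0 H; rewrite -ge0_integralZl//.
- apply: eq_integral => x _; rewrite -EFinM; congr EFin.
  by rewrite euclid_normZ normrM !powRM ?euclid_norm_ge0// mulrDr.
- by apply/measurable_EFinP; exact: measurable_energy H.
- by move=> x _; rewrite lee_fin addr_ge0 ?powR_ge0.
Qed.

Lemma JpZ (p a : R) (u : E -> R) (g : E -> 'rV[R]_(hdim G)) : 0 < p ->
  weak_hgrad Omega u g ->
  Jp p Omega (fun x => a * u x) = (`|a|%:E * Jp p Omega u)%E.
Proof.
move=> p0 H; rewrite (JpE p Omega_open H) (JpE p Omega_open (weak_hgradZ Omega_open a H)).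
rewrite energyZ// poweRM ?lee_fin ?powR_ge0 ?energy_ge0//.
by rewrite poweR_EFin -powRrM mulfV ?gt_eqF// powRr1.
Qed.

Lemma bounded_Lp (p : R) (f : E -> R) (C : R) : 0 < p -> measurable_fun Omega f ->
  (forall x, Omega x -> `|f x| <= C) -> Lp p%:E Omega f.
Proof.
move=> p0 mf fC; apply/LpP => //; split => //.
have mfp : measurable_fun Omega (fun x => `|f x| `^ p).
  by apply: measurable_powR_comp; exact: measurableT_comp.
have : mu.-integrable Omega (EFin \o (fun x => `|f x| `^ p)).
  apply: (@bounded_measurable_integrable _ _ _ _ _ _ (C `^ p)) => //.
    exact: lebesgue_domain_lty.
  move=> x Ox; rewrite ger0_norm ?powR_ge0//.
  apply: ge0_ler_powR; rewrite ?nnegrE ?(ltW p0) ?normr_ge0 ?fC//.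
  exact: le_trans (normr_ge0 _) (fC x Ox).
move=> /integrableP[_]; congr (_ < _)%E; apply: eq_integral => x _ /=.
by rewrite ger0_norm ?powR_ge0.
Qed.

Lemma Cc_Lp (p : R) (phi : E -> R) : 0 < p -> Cc_infty Omega phi -> Lp p%:E Omega phi.
Proof.
move=> p0 Cphi; have [C _ hC] := Cc_bounded Cphi.
apply: (bounded_Lp p0 (C := C)) => //.
by apply: measurable_funS (continuous_measurable_rV (smooth_continuous (Cc_infty_smooth Cphi))).
Qed.

Lemma Cc_S1p (p : R) (phi : E -> R) : 0 < p -> Cc_infty Omega phi -> S1p p Omega phi.
Proof.
move=> p0 Cphi; split; first exact: Cc_Lp.
exists (cgrad phi); split; first exact: cgrad_weak_hgrad.
move=> j; under eq_fun do rewrite mxE.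
by apply: Cc_Lp => //; exact: Cc_derive_hfield.
Qed.

Lemma Cc_S01p (p : R) (phi : E -> R) : 0 < p -> Cc_infty Omega phi -> S01p p Omega phi.
Proof.
move=> p0 Cphi; split; first exact: Cc_S1p.
exists (fun=> phi); split => //.
have -> : (fun x => phi x - phi x) = fun=> 0 by apply/funext => x; rewrite subrr.
rewrite (JpE p Omega_open (weak_hgrad0 Omega_open)) energy0// poweR0r; first exact: cvg_cst.
by rewrite invr_eq0 gt_eqF.
Qed.

Lemma Cc_cgrad_bounded (phi : E -> R) : Cc_infty Omega phi ->
  exists2 M : R, 0 <= M & forall x, euclid_norm (cgrad phi x) <= M.
Proof.
move=> Cphi.
have /choice[D hD] : forall j, exists D : R, 0 <= D /\ forall x, `|'D_(hfield j x) phi x| <= D.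
  by move=> j; have [D D0 h] := Cc_bounded (Cc_derive_hfield j Cphi); exists D.
pose M := Num.sqrt (\sum_j D j ^+ 2).
exists M => [|x]; first exact: sqrtr_ge0.
rewrite /euclid_norm ler_wsqrtr// /dotR; apply: ler_sum => j _.
rewrite !mxE -expr2 -real_normK ?num_real// lerXn2r// ?nnegrE ?normr_ge0//.
  by have [] := hD j.
by have [_ ->] := hD j.
Qed.

Lemma Cc_Jp_lty (p : R) (phi : E -> R) : 0 < p -> Cc_infty Omega phi ->
  (Jp p Omega phi < +oo)%E.
Proof.
move=> p0 Cphi; have Hw := cgrad_weak_hgrad Omega_open Cphi.
rewrite (JpE p Omega_open Hw); apply: poweR_lty.
have [C C0 hC] := Cc_bounded Cphi.
have [M M0 gM] := Cc_cgrad_bounded Cphi.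
have : mu.-integrable Omega (EFin \o (fun x => euclid_norm (cgrad phi x) `^ p + `|phi x| `^ p)).
  apply: (@bounded_measurable_integrable _ _ _ _ _ _ (M `^ p + C `^ p)) => //.
  - exact: lebesgue_domain_lty.
  - exact: measurable_energy Hw.
  - move=> x Ox; rewrite ger0_norm ?addr_ge0 ?powR_ge0//.
    by apply: lerD; apply: ge0_ler_powR;
      rewrite ?nnegrE ?(ltW p0) ?normr_ge0 ?euclid_norm_ge0 ?M0 ?gM ?hC.
move=> /integrableP[_]; congr (_ < _)%E; apply: eq_integral => x _ /=.
by rewrite ger0_norm// addr_ge0 ?powR_ge0.
Qed.

Lemma LnormE (p : R) (f : E -> R) : 0 < p ->
  ('N[mu]_p%:E [EFin \o (f \_ Omega)] = (\int[mu]_(x in Omega) (`|f x| `^ p)%:E) `^ p^-1)%E.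
Proof.
move=> p0; rewrite (integral_powR_Lnorm Omega f p0).
by rewrite -poweRrM mulfV ?gt_eqF// poweRe1// Lnorm_ge0.
Qed.

Lemma LnormZ_domain (p a : R) (f : E -> R) : 0 < p -> measurable_fun Omega f ->
  ('N[mu]_p%:E [EFin \o ((fun x => a * f x)%R \_ Omega)] =
   `|a|%:E * 'N[mu]_p%:E [EFin \o (f \_ Omega)])%E.
Proof.
move=> p0 mf; rewrite !LnormE//.
have mfp : measurable_fun Omega (fun x => `|f x| `^ p).
  by apply: measurable_powR_comp; exact: measurableT_comp.
have -> : (\int[mu]_(x in Omega) (`|a * f x| `^ p)%:E)%E =
    ((`|a| `^ p)%:E * \int[mu]_(x in Omega) (`|f x| `^ p)%:E)%E.
  rewrite -ge0_integralZl//.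
    by apply: eq_integral => x _; rewrite -EFinM normrM powRM.
  exact/measurable_EFinP.
rewrite poweRM ?lee_fin ?powR_ge0//.
  by rewrite poweR_EFin -powRrM mulfV ?gt_eqF// powRr1.
by apply: integral_ge0 => x _; rewrite lee_fin powR_ge0.
Qed.

End scaling.

(** * Products of a time weight and a C_c^oo function as test functions *)

Section tensor.
Context {R : realType} (G : stratified_group R).
Local Notation E := 'rV[R]_(topdim G).
Local Notation mu := (@lebesgue_rV R (topdim G)).
Local Notation leb := (@lebesgue_measure R).
Local Notation mu2 := (leb \x mu)%E.
Variables (Omega : set E) (T : R).
Hypotheses (Omega_open : open Omega) (Omega_bounded : bounded_set Omega).

Let mO : measurable Omega. Proof. exact: open_measurable_rV. Qed.

Lemma measurable_cylinder : measurable (cylinder T Omega).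
Proof. exact: (measurableX (measurable_itv _) mO). Qed.

Lemma measurable_cylinder_fst (theta : R -> R) :
  measurable_fun setT theta -> measurable_fun (cylinder T Omega) (fun z => theta z.1).
Proof.
move=> mt; apply: (measurable_funS measurableT) => //.
by apply: (measurableT_comp mt); exact: measurable_fst.
Qed.

Lemma measurable_cylinder_snd (f : E -> R) :
  measurable_fun Omega f -> measurable_fun (cylinder T Omega) (fun z => f z.2).
Proof.
move=> mf; apply: (measurable_comp mO) => //; first by move=> x [z hz <-]; case: hz.
by apply: (measurable_funS measurableT) => //; exact: measurable_snd.
Qed.

Lemma measurable_tensor (theta : R -> R) (f : E -> R) :
  measurable_fun setT theta -> measurable_fun Omega f ->
  measurable_fun (cylinder T Omega) (fun z => theta z.1 * f z.2).
Proof.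
move=> mt mf; apply: measurable_funM; first exact: measurable_cylinder_fst.
exact: measurable_cylinder_snd.
Qed.

Lemma lebesgue_interval_lty : (leb [set` `]0%R, T[] < +oo)%E.
Proof. by rewrite lebesgue_measure_itv /=; case: ifPn => _; rewrite ltry. Qed.

(* Step functions in time, obtained by rounding theta down to multiples of 1/(k+1). *)
Lemma simple_approximation (theta : R -> R) (C : R) : measurable_fun setT theta ->
  (forall t, `|theta t| <= C) -> forall k : nat,
  exists n (A : 'I_n -> set (measurableTypeR R)) (c : 'I_n -> R),
    (forall i, measurable (A i)) /\
    forall t, `|theta t - \sum_(i < n) \1_(A i) t * c i| <= k.+1%:R^-1.
Proof.
move=> mt hC k.
pose N := (Num.truncn C).+1.
have CN : C < N%:R by exact: truncnS_gt.
pose y t := (theta t + N%:R) * k.+1%:R.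
have y0 t : 0 <= y t.
  by rewrite mulr_ge0//; have := hC t; rewrite ler_norml; lra.
pose n := (N * 2 * k.+1).+1.
have yn t : y t < n%:R.
  apply: (@le_lt_trans _ _ (N * 2 * k.+1)%:R); last by rewrite ltr_nat.
  by rewrite !natrM ler_wpM2r//; have := hC t; rewrite ler_norml; lra.
pose A (i : 'I_n) : set (measurableTypeR R) := [set t | i%:R <= y t < i.+1%:R].
exists n, A, (fun i : 'I_n => i%:R / k.+1%:R - N%:R); split.
  move=> i; have my : measurable_fun setT y.
    by apply: measurable_funM => //; exact: measurable_funD.
  have := my measurableT [set` `[(i%:R : R), i.+1%:R[] (measurable_itv _).
  by rewrite setTI; congr measurable; apply/seteqP; split => t /=; rewrite in_itv.
move=> t; pose m := Num.truncn (y t).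
have [hm1 hm2] : m%:R <= y t /\ y t < m.+1%:R.
  by split; [rewrite truncn_le|exact: truncnS_gt].
have mn : (m < n)%N by rewrite -(ltr_nat R) (le_lt_trans hm1).
rewrite (bigD1 (Ordinal mn))//= big1 ?addr0; last first.
  move=> i im; rewrite indicE memNset ?mul0r//= => /andP[h1 h2].
  move/negP : im; apply; apply/eqP/val_inj => /=; apply/eqP.
  have := le_lt_trans h1 hm2; have := le_lt_trans hm1 h2; rewrite !ltr_nat !ltnS => a b.
  by rewrite eqn_leq a b.
have At : A (Ordinal mn) t by rewrite /A /= hm1 hm2.
rewrite indicE (mem_set At) /=.
rewrite mul1r.
have kp : 0 < k.+1%:R :> R by [].
have -> : theta t - (m%:R / k.+1%:R - N%:R) = (y t - m%:R) / k.+1%:R.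
  by rewrite /y; field; rewrite gt_eqF.
rewrite normrM ger0_norm ?subr_ge0// ger0_norm ?invr_ge0// ler_piMl ?invr_ge0//.
by move: hm2; rewrite -natr1; lra.
Qed.

(** The norm of a multiple of [psi] is proportional to the factor, so that uniform approximation of
    [theta] by step functions is approximation in the Bochner sense. The space and its norm stay
    abstract because both S_0^{1,p} and S^{1,p'} are needed, the latter for the time derivative. *)
Lemma tensor_bochner (B : set (E -> R)) (nrm : (E -> R) -> \bar R) (r C : R)
    (theta : R -> R) (psi : E -> R) :
  0 < r -> measurable_fun setT theta -> (forall t, `|theta t| <= C) ->
  measurable_fun Omega psi -> (forall a, B (fun x => a * psi x)) ->
  (0 <= nrm psi < +oo)%E ->
  (forall a, nrm (fun x => a * psi x)%R = (`|a|%:E * nrm psi)%E) ->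
  bochner_L B nrm r T Omega (fun t x => theta t * psi x).
Proof.
move=> r0 mt hC mpsi Bpsi /andP[n0 noo] nZ.
have nfin : nrm psi \is a fin_num by rewrite ge0_fin_numE.
pose m := fine (nrm psi).
have mE : nrm psi = m%:E by rewrite fineK.
have m0 : 0 <= m by exact: fine_ge0.
split.
- exact: measurable_tensor.
- exact: aeW.
- have /choice[n /choice]: forall k, exists n, exists Ac : nat -> set (measurableTypeR R) * R,
    (forall i, measurable (Ac i).1) /\
    forall t, `|theta t - \sum_(i < n) \1_((Ac i).1) t * (Ac i).2| <= k.+1%:R^-1.
    move=> k; have [n [A [c [h1 h2]]]] := simple_approximation mt hC k.
    exists n, (fun i => if insub i is Some j then (A j, c j) else (set0, 0)); split.
      by move=> i; case: insub => [j|] /=; [exact: h1|exact: measurable0].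
    move=> t; have := h2 t; congr (`|_ - _| <= _).
    by apply: eq_bigr => i _; rewrite valK.
  move=> [Ac hAc].
  exists (fun k t x => (\sum_(i < n k) \1_((Ac k i).1) t * (Ac k i).2) * psi x); split.
    move=> k; exists (n k), (fun i : 'I_(n k) => (Ac k i).1), (fun i x => (Ac k i).2 * psi x); split.
    + by move=> i; have [h _] := hAc k; exact: h.
    + by move=> i; exact: Bpsi.
    + by apply/funext => t; apply/funext => x; rewrite mulr_suml; apply: eq_bigr => i _; rewrite mulrA.
  apply: aeW => t _.
  under eq_fun do under eq_fun do rewrite -mulrBl.
  under eq_fun do rewrite nZ mE.
  apply/fine_cvgP; split; first by apply: nearW => k.
  apply: (@squeeze_cvgr _ _ _ _ (fun=> 0) (fun k => k.+1%:R^-1 * m)).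
  + apply: nearW => k /=; rewrite mulr_ge0//= ler_wpM2r//.
    by have [_ h] := hAc k; exact: h.
  + exact: cvg_cst.
  + by rewrite -(mul0r m); apply: cvgM; [exact: cvg_harmonic|exact: cvg_cst].
- under eq_integral do rewrite nZ mE -EFinM poweR_EFin.
  have : leb.-integrable `]0, T[ (EFin \o (fun t => (`|theta t| * m) `^ r)).
    apply: (@bounded_measurable_integrable _ _ _ _ _ _ ((C * m) `^ r)) => //.
    + exact: lebesgue_interval_lty.
    + apply: measurable_powR_comp; apply: measurable_funM => //.
      by apply: (measurable_funS measurableT) => //; exact: measurableT_comp.
    + move=> t _; rewrite ger0_norm ?powR_ge0//.
      have C0 : 0 <= C := le_trans (normr_ge0 _) (hC 0).
      by apply: ge0_ler_powR; rewrite ?nnegrE ?(ltW r0) ?mulr_ge0// ler_wpM2r.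
  move=> /integrableP[_]; congr (_ < _)%E; apply: eq_integral => t _ /=.
  by rewrite ger0_norm ?powR_ge0.
Qed.

Variables (p : R) (eta : R -> R) (C : R) (psi : E -> R).
Hypotheses (p_gt1 : 1 < p) (smooth_eta : smooth eta)
  (eta_bounded : forall t, `|eta t| <= C) (deta_bounded : forall t, `|'D_1 eta t| <= C)
  (Cpsi : Cc_infty Omega psi).

Lemma conj_exponent_gt0 : 0 < conj_exponent p.
Proof. by rewrite /conj_exponent divr_gt0 ?subr_gt0// (lt_trans ltr01). Qed.

Let measurable_smooth (f : R -> R) : smooth f -> measurable_fun setT f.
Proof. by move=> sf; apply: continuous_measurable_fun; exact: smooth_continuous. Qed.

Let mpsi : measurable_fun Omega psi.
Proof.
by apply: measurable_funS (continuous_measurable_rV (smooth_continuous (Cc_infty_smooth Cpsi))).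
Qed.

Lemma CcZ (a : R) : Cc_infty Omega (fun x => a * psi x).
Proof.
under eq_fun do rewrite mulrC.
by apply: Cc_inftyMr => //; exact: smooth_cst.
Qed.

(** The time derivative of the product of [phi] with [eta psi] integrates to zero; since [psi] does
    not depend on time, the product rule leaves exactly two terms. *)
Lemma tensor_time_derivative :
  time_derivative T Omega (fun t x => eta t * psi x) (fun t x => 'D_1 eta t * psi x).
Proof.
move=> phi Cphi; have sphi := Cc_infty_smooth Cphi.
pose e (z : R * E) := eta z.1; pose s (z : R * E) := psi z.2.
have se : smooth e by exact: smooth_fst.
have ss : smooth s by apply: smooth_snd; exact: Cc_infty_smooth Cpsi.
have de z : 'D_(1, 0) e z = 'D_1 eta z.1.
  by rewrite (@derive_affine _ _ _ _ (fst : R * E -> R) eta z (1, 0) 1).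
have ds z : 'D_(1, 0) s z = 0.
  by rewrite (@derive_affine _ _ _ _ (snd : R * E -> E) psi z (1, 0) 0) ?derive0.
pose F (z : R * E) := phi z * (e z * s z).
have CF : Cc_infty (cylinder T Omega : set (R * E)) F.
  by apply: Cc_inftyMr => //; exact: smoothM.
have [c c0 hc] := Cc_infty_bounded_support CF.
have sF := Cc_infty_smooth CF.
have dF z : 'D_(1, 0) F z = e z * s z * 'D_(1, 0) phi z + 'D_1 eta z.1 * s z * phi z.
  rewrite deriveM; [|exact: smooth_derivable|exact/smooth_derivable/smoothM].
  rewrite deriveM; [|exact: smooth_derivable..].
  by rewrite de ds /GRing.scale /=; ring.
have [c1 c10 hc1] := Cc_infty_bounded_support Cphi.
have int_out (f : R * E -> R) : continuous f -> (forall z, c1 < `|z| -> f z = 0) ->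
    mu2.-integrable (cylinder T Omega) (EFin \o f).
  move=> cf f0; apply: (integrableS measurableT); first exact: measurable_cylinder.
    by [].
  exact: continuous_support_integrable_prod cf f0.
have i1 : mu2.-integrable (cylinder T Omega) (EFin \o (fun z => eta z.1 * psi z.2 * 'D_(1, 0) phi z)).
  apply: int_out.
    apply: smooth_continuous; apply: smoothM; last exact: smooth_derive.
    exact: (smoothM se ss).
  by move=> z /(derive_support ((1, 0) : R * E) hc1) ->; rewrite mulr0.
have i2 : mu2.-integrable (cylinder T Omega) (EFin \o (fun z => 'D_1 eta z.1 * psi z.2 * phi z)).
  apply: int_out.
    apply: smooth_continuous; apply: smoothM => //.
    apply: (@smoothM _ _ (fun z : R * E => 'D_1 eta z.1)) => //.
    by apply: (@smooth_fst _ _ _ _ ('D_1 eta)); exact: smooth_derive.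
  by move=> z /hc1 ->; rewrite mulr0.
apply/eqP; rewrite -subr_eq0 opprK -RintegralD//; last exact: measurable_cylinder.
apply/eqP.
have H0 := integral_time_derive_eq0 (fun z => smooth_derivable sF)
  (smooth_continuous (smooth_derive ((1, 0) : R * E) sF)) hc.
transitivity (\int[mu2]_z ('D_(1, 0) F z)); last by rewrite /Rintegral H0.
transitivity (\int[mu2]_(z in cylinder T Omega) ('D_(1, 0) F z)).
  by apply: eq_Rintegral => z _; rewrite dF.
apply: Rintegral_support => // z _ nz; rewrite dF.
have phi0 : phi z = 0 by exact: Cc_infty_out Cphi nz.
rewrite phi0 mulr0 addr0 -(@near_eq_derive _ _ _ (fun=> 0)) ?derive_cst ?mulr0//.
have nzs : ~ support_closure phi z by have [_ _ sub] := Cphi; move=> /sub.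
have : open_nbhs z (~` support_closure phi).
  by split => //; apply: closed_openC; exact: closed_support_closure.
by move/open_nbhs_nbhs; apply: filterS => y /Cc_infty_eq0 ->.
Qed.

Lemma tensor_in_V :
  in_V p T Omega (fun t x => eta t * psi x) (fun t x => eta t *: cgrad psi x)
    (fun t x => 'D_1 eta t * psi x).
Proof.
have p0 : 0 < p by exact: lt_trans ltr01 p_gt1.
have Hw := cgrad_weak_hgrad Omega_open Cpsi.
have Jp0 (r : R) : 0 < r -> (0 <= Jp r Omega psi < +oo)%E.
  by move=> r0; rewrite Cc_Jp_lty// andbT /Jp poweR_ge0.
split.
- apply: (@tensor_bochner _ _ _ C) => //.
  + exact: measurable_smooth.
  + by move=> a; apply: Cc_S01p => //; exact: CcZ.
  + exact: Jp0.
  + by move=> a; apply: JpZ Hw.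
- split.
    move=> j; under eq_fun do rewrite mxE.
    apply: (measurable_tensor (f := fun x => cgrad psi x ord0 j)); first exact: measurable_smooth.
    exact: weak_hgrad_measurable Hw.
  by apply: aeW => t _; exact: weak_hgradZ.
- have p'0 := conj_exponent_gt0.
  apply: (@tensor_bochner _ _ _ C) => //.
  + by apply: measurable_smooth; exact: smooth_derive.
  + by move=> a; apply: Cc_S1p => //; exact: CcZ.
  + exact: Jp0.
  + by move=> a; apply: JpZ Hw.
- exact: tensor_time_derivative.
Qed.

Lemma tensor_C_L2 : C_L2 T Omega (fun t x => eta t * psi x).
Proof.
split=> [t _|t _]; first by apply: Cc_Lp => //; exact: CcZ.
have N0 : (0 <= 'N[mu]_2%:E [EFin \o (psi \_ Omega)])%E by exact: Lnorm_ge0.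
have Noo : ('N[mu]_2%:E [EFin \o (psi \_ Omega)] < +oo)%E.
  have : Lp 2%:E Omega psi by apply: Cc_Lp.
  by rewrite /Lp /= inE => /andP[_]; rewrite inE.
have nfin : 'N[mu]_2%:E [EFin \o (psi \_ Omega)]%E \is a fin_num by rewrite ge0_fin_numE.
rewrite (_ : (fun s => _) = fun s => (`|eta s - eta t| *
    fine ('N[mu]_2%:E [EFin \o (psi \_ Omega)])%E)%:E); last first.
  apply/funext => s; rewrite EFinM fineK// -LnormZ_domain//.
  by congr Lnorm; apply/funext => x; rewrite /= !patchE; case: ifP => // _; rewrite mulrBl.
apply/fine_cvgP; split; first by apply: nearW.
apply: cvg_within_filter.
set m := fine _.
have H : (`|eta s - eta t| * m) @[s --> t] --> `|eta t - eta t| * m.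
  apply: cvgM; last exact: cvg_cst.
  apply: cvg_norm; apply: cvgB; last exact: cvg_cst.
  exact: smooth_continuous smooth_eta t.
by rewrite subrr normr0 mul0r in H; exact: H.
Qed.

End tensor.

(** * Comparison of integrals and integrability criteria *)

Section integration_tools.
Context d (T : measurableType d) {R : realType} (mu : {measure set T -> \bar R}).

Lemma ae_and (P Q : T -> Prop) :
  {ae mu, forall x, P x} -> {ae mu, forall x, Q x} -> {ae mu, forall x, P x /\ Q x}.
Proof. by move=> hP hQ; exact: filterI. Qed.

(** The integral of a nonnegative function is a supremum over the simple functions below it, and
    this supremum is monotone whether or not the function is measurable. *)
Lemma le_integral_nonmeasurable (f g : T -> \bar R) :
  (forall x, (0 <= f x)%E) -> (forall x, (f x <= g x)%E) ->
  (\int[mu]_x f x <= \int[mu]_x g x)%E.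
Proof.
move=> f0 fg; rewrite !ge0_integralTE//; last by move=> x; exact: le_trans (f0 x) (fg x).
by apply: le_ereal_sup => _ [h hf <-]; exists h => // x; exact: le_trans (hf x) (fg x).
Qed.

(* The dominating function is the Bochner norm of a slice, which is not known
   to be measurable in time. *)
Lemma ae_le_integral_nonmeasurable (D : set T) (f g : T -> \bar R) :
  measurable D -> measurable_fun D f -> (forall x, D x -> (0 <= f x)%E) ->
  (forall x, D x -> (0 <= g x)%E) -> {ae mu, forall x, D x -> (f x <= g x)%E} ->
  (\int[mu]_(x in D) f x <= \int[mu]_(x in D) g x)%E.
Proof.
move=> mD mf f0 g0 [N [mN N0 Nsub]].
rewrite (ge0_negligible_integral mN mD mf f0 N0).
rewrite integral_mkcond [leRHS]integral_mkcond.
apply: le_integral_nonmeasurable => x; rewrite !patchE.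
  by case: ifPn => //; rewrite inE => -[Dx _]; exact: f0.
case: ifPn => [|_]; last by case: ifPn => //; rewrite inE => /g0.
rewrite inE => -[Dx nN]; rewrite mem_set//.
have : ~ ~ (D x -> (f x <= g x)%E) by move=> h; apply: nN; exact: Nsub.
by move=> /contrapT; apply.
Qed.

Lemma le_integrable_real (D : set T) (f g : T -> R) : measurable D ->
  measurable_fun D f -> (forall x, D x -> `|f x| <= g x) ->
  mu.-integrable D (EFin \o g) -> mu.-integrable D (EFin \o f).
Proof.
move=> mD mf fg ig; apply: (le_integrable mD _ _ ig); first exact/measurable_EFinP.
by move=> x Dx /=; rewrite lee_fin (le_trans (fg x Dx))// ler_norm.
Qed.

Lemma integrable_boundedM (D : set T) (h f : T -> R) (C : R) : measurable D ->
  measurable_fun D h -> (forall x, D x -> `|h x| <= C) ->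
  mu.-integrable D (EFin \o f) -> mu.-integrable D (EFin \o (fun x => h x * f x)).
Proof.
move=> mD mh hC intf.
have := @integrableMr _ _ _ mu D mD h (EFin \o f) mh (le_bounded_image hC) intf.
by congr integrable.
Qed.

Lemma integrable_add (D : set T) (f g : T -> R) : measurable D ->
  mu.-integrable D (EFin \o f) -> mu.-integrable D (EFin \o g) ->
  mu.-integrable D (EFin \o (fun x => f x + g x)).
Proof. by move=> mD hf hg; have := integrableD mD hf hg; congr integrable. Qed.

Lemma integrable_scale (D : set T) (a : R) (f : T -> R) : measurable D ->
  mu.-integrable D (EFin \o f) -> mu.-integrable D (EFin \o (fun x => a * f x)).
Proof. by move=> mD hf; have := integrableZl mD a hf; congr integrable. Qed.

Lemma integrable_cst_real (D : set T) (a : R) : measurable D -> (mu D < +oo)%E ->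
  mu.-integrable D (EFin \o (fun=> a)).
Proof. by move=> mD Doo; apply: (bounded_measurable_integrable (C := `|a|)). Qed.

Lemma integrable_lty (D : set T) (f : T -> R) : measurable_fun D f ->
  (forall x, D x -> 0 <= f x) -> (\int[mu]_(x in D) (f x)%:E < +oo)%E ->
  mu.-integrable D (EFin \o f).
Proof.
move=> mf f0 foo; apply/integrableP; split; first exact/measurable_EFinP.
rewrite (eq_integral (EFin \o f))// => x; rewrite inE => Dx /=.
by rewrite ger0_norm ?f0.
Qed.

Lemma integrable_measurable (D : set T) (f : T -> R) :
  mu.-integrable D (EFin \o f) -> measurable_fun D f.
Proof. by move=> /measurable_int/measurable_EFinP. Qed.

End integration_tools.

(** * Power inequalities, the flux and the reaction term *)

Section powers.
Context {R : realType}.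

Lemma le_1DpowR (a r : R) : 0 <= a -> 1 <= r -> a <= 1 + a `^ r.
Proof.
move=> a0 r1; have [a1|/ltW a1] := leP a 1; first by rewrite (le_trans a1)// lerDl powR_ge0.
by rewrite (le_trans (le1r_powR a1 r1))// lerDr.
Qed.

Lemma powRB1_le (a p : R) : 1 < p -> 0 <= a -> a `^ (p - 1) <= 1 + a `^ p.
Proof.
move=> p1 a0; have [a1|/ltW a1] := leP a 1.
  rewrite (le_trans (y := 1))// ?lerDl ?powR_ge0//.
  have {2}-> : (1 : R) = 1 `^ (p - 1) by rewrite powR1.
  by apply: ge0_ler_powR; rewrite ?nnegrE// subr_ge0 ltW.
rewrite (le_trans (y := a `^ p))// ?lerDr//.
by apply: ler_powR => //; rewrite gerBl.
Qed.

(** One factor |v| from the scalar product is merged with |v|^(p-2), so that the power which is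
    singular for p < 2 does not have to be bounded separately. *)
Lemma flux_le n (p : R) (v w : 'rV[R]_n) : 1 < p ->
  `|euclid_norm v `^ (p - 2) * dotR v w| <=
  n%:R * (euclid_norm v `^ (p - 1) * euclid_norm w).
Proof.
move=> p1; rewrite normrM (ger0_norm (powR_ge0 _ _)).
apply: le_trans (ler_wpM2l (powR_ge0 _ _) (dotR_le v w)) _.
rewrite mulrCA ler_wpM2l// mulrA ler_wpM2r ?euclid_norm_ge0//.
rewrite (_ : p - 2 = p - 1 - 1); last by ring.
by rewrite mulrC mulr_powRB1 ?euclid_norm_ge0// subr_gt0.
Qed.

Definition reaction (beta q v : R) := `|v| `^ (beta - 1) * v - `|v| `^ (q - 2) * v.

Lemma reaction_ge0 (beta q v : R) : q < beta + 1 -> 1 <= v -> 0 <= reaction beta q v.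
Proof.
move=> qb v1; rewrite /reaction -mulrBl mulr_ge0//; last exact: le_trans v1.
rewrite subr_ge0; apply: ler_powR; last by lra.
by rewrite ger0_norm// (le_trans _ v1).
Qed.

Lemma reactionN (beta q v : R) : reaction beta q (- v) = - reaction beta q v.
Proof. by rewrite /reaction normrN !mulrN opprB opprK addrC. Qed.

Lemma smooth_flat_scaled (a : R) (k : R) : smooth (fun t : R => flat 1 (k * (t - a))).
Proof.
apply: smooth_real_comp; first exact: smooth_flat.
by under eq_fun do rewrite mulrBr -mulrN; exact: smooth_affine.
Qed.

Lemma derive_flat_scaled (a k t : R) :
  'D_1 (fun t : R => flat 1 (k * (t - a))) t = k * flat (flat_derivative 1) (k * (t - a)).
Proof.
have H : is_derive t 1 (fun t : R => k * (t - a)) k.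
  have -> : (fun t : R => k * (t - a)) = k \*: (id - cst a) by [].
  by apply: is_derive_eq; rewrite subr0 /GRing.scale /= mulr1.
have H2 := @is_derive1_comp _ (flat 1) (fun t : R => k * (t - a)) _ _ _ (is_derive_flat 1 (k * (t - a))) H.
by rewrite (@derive_val _ _ _ _ _ _ _ H2) mulrC.
Qed.

Lemma flat_scaled_bounded (a k : R) : exists C : R,
  (forall t : R, `|flat 1 (k * (t - a))| <= C) /\
  (forall t : R, `|'D_1 (fun t : R => flat 1 (k * (t - a))) t| <= C).
Proof.
have [C C0 hC] := flat_bounded (flat_derivative (1 : {poly R})).
exists (1 + `|k| * C); split => t.
  rewrite ger0_norm ?flat1_ge0// (le_trans (flat1_le1 _))// lerDl mulr_ge0//.
rewrite derive_flat_scaled normrM (le_trans (ler_wpM2l (normr_ge0 _) (hC _)))//.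
by rewrite lerDr.
Qed.

End powers.

(** * From the space-time equation to almost every time slice *)

Section evolution.
Context {R : realType} (G : stratified_group R).
Local Notation E := 'rV[R]_(topdim G).
Local Notation mu := (@lebesgue_rV R (topdim G)).
Local Notation leb := (@lebesgue_measure R).
Local Notation Z := (measurableTypeR R * E)%type.
Local Notation mu2 := (leb \x mu)%E.
Variables (Omega : set E) (T p : R).
Hypotheses (Omega_open : open Omega) (Omega_bounded : bounded_set Omega) (p_gt1 : 1 < p).

Let mO : measurable Omega. Proof. exact: open_measurable_rV. Qed.
Let mI : measurable (`]0, T[ : set (measurableTypeR R)). Proof. exact: measurable_itv. Qed.
Let mC : measurable (cylinder T Omega). Proof. exact: measurable_cylinder. Qed.
Let p_gt0 : 0 < p. Proof. exact: lt_trans ltr01 p_gt1. Qed.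

Lemma lebesgue_cylinder_lty : (mu2 (cylinder T Omega) < +oo)%E.
Proof.
rewrite /cylinder product_measure1E//; apply: lte_mul_pinfty => //.
  by rewrite ge0_fin_numE//; exact: lebesgue_interval_lty.
exact: lebesgue_domain_lty.
Qed.

(** The slice integral of [f] is measurable by Tonelli; its bound [N] will be a power of a Bochner
    norm, about which only the integral is known. *)
Lemma slice_dominated_integrable (f : Z -> R) (N : R -> \bar R) :
  measurable_fun (cylinder T Omega) f -> (forall z, 0 <= f z) -> (forall t, (0 <= N t)%E) ->
  {ae leb, forall t, 0 < t < T -> (\int[mu]_(x in Omega) (f (t, x))%:E <= N t)%E} ->
  (\int[leb]_(t in `]0%R, T[) N t < +oo)%E ->
  mu2.-integrable (cylinder T Omega) (EFin \o f).
Proof.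
move=> mf f0 N0 fN Noo; apply: integrable_lty => //.
rewrite /cylinder tonelli_rectangle//=; last 2 first.
- exact/measurable_EFinP.
- by move=> z _; rewrite lee_fin.
apply: le_lt_trans Noo.
apply: (@ae_le_integral_nonmeasurable _ _ _ leb).
- exact: mI.
- apply: (@tonelli_rectangle_measurable _ _ _ _ _ mu _ _ mI mO (EFin \o f)); first exact/measurable_EFinP.
  by move=> z _; rewrite lee_fin.
- by move=> t _; apply: integral_ge0 => x _; rewrite lee_fin.
- by [].
- by apply: ae_imp fN => t h; rewrite /= in_itv.
Qed.

(** The r-th power of [Jp] dominates the slice integral of |v|^r, and |v| <= 1 + |v|^r on a cylinder
    of finite measure. The hypothesis on [B] allows [Jp] to be read as an energy. *)
Lemma bochner_integrable (r : R) (B : set (E -> R)) (v : R -> E -> R) : 1 <= r ->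
  (forall f, B f -> exists g : E -> 'rV[R]_(hdim G), weak_hgrad Omega f g) ->
  bochner_L B (Jp r Omega) r T Omega v ->
  mu2.-integrable (cylinder T Omega) (EFin \o (fun z => v z.1 z.2)).
Proof.
move=> r1 Bg [mv Bv _ Joo]; have r0 : 0 < r by exact: lt_le_trans r1.
apply: (@le_integrable_real _ _ _ _ _ _ (fun z : Z => 1 + `|v z.1 z.2| `^ r)) => //.
  by move=> z _; exact: le_1DpowR.
apply: integrable_add => //; first exact: integrable_cst_real lebesgue_cylinder_lty.
apply: (@slice_dominated_integrable _ (fun t => Jp r Omega (v t) `^ r)%E) => //.
- by apply: measurable_powR_comp; exact: measurableT_comp.
- by move=> t; exact: poweR_ge0.
apply: ae_imp Bv => t Bt ht /=; have [g wg] := Bg _ (Bt ht).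
rewrite (energy_poweR Omega_open r0 wg).
apply: ge0_le_integral => //.
- apply/measurable_EFinP; apply: measurable_powR_comp; apply: measurableT_comp => //.
  exact: weak_hgrad_measurable_fun wg.
- by apply/measurable_EFinP; exact: measurable_energy wg.
- by move=> x _; rewrite lee_fin lerDr powR_ge0.
Qed.

(* The slice integral exists only for almost every t. *)
Lemma fubini_time_weight (theta : R -> R) (C : R) (f : Z -> R) :
  measurable_fun setT theta -> (forall t, `|theta t| <= C) ->
  mu2.-integrable (cylinder T Omega) (EFin \o f) ->
  \int[mu2]_(z in cylinder T Omega) (theta z.1 * f z) =
  \int[leb]_(t in `]0, T[) (theta t * \int[mu]_(x in Omega) f (t, x)).
Proof.
move=> mt hC intf.
have mt2 : measurable_fun (cylinder T Omega) (fun z : Z => theta z.1).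
  exact: measurable_cylinder_fst.
have itf := integrable_boundedM mC mt2 (fun z _ => hC z.1) intf.
rewrite (fubini_rectangle mI mO itf) /Rintegral; congr fine; apply: ae_eq_integral => //.
- exact: (measurable_int _ (fubini_rectangle_integrable mI mO itf)).
- apply/measurable_EFinP; apply: measurable_funM; first exact: measurable_funTS.
  exact: integrable_measurable (fubini_rectangle_integrable mI mO intf).
have := ae_integrable_slice mI mO intf.
by apply: ae_imp => t kt /kt{}kt; congr EFin; rewrite -RintegralZl.
Qed.

Variables (u : R -> E -> R) (Du : R -> E -> 'rV[R]_(hdim G)) (u' : R -> E -> R).
Hypothesis uV : in_V p T Omega u Du u'.

Lemma measurable_in_V_hgrad j : measurable_fun (cylinder T Omega) (fun z => Du z.1 z.2 ord0 j).
Proof. by have [_ []] := uV. Qed.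

Lemma in_V_hgrad_integrable :
  mu2.-integrable (cylinder T Omega) (EFin \o (fun z => euclid_norm (Du z.1 z.2) `^ p)).
Proof.
have [[_ _ _ Joo] [mDu wDu] _ _] := uV.
apply: (@slice_dominated_integrable _ (fun t => Jp p Omega (u t) `^ p)%E) => //.
- by apply: measurable_powR_comp; apply: measurable_euclid_norm.
- by move=> z; exact: powR_ge0.
- by move=> t; exact: poweR_ge0.
apply: ae_imp wDu => t wt ht /=; rewrite (energy_poweR Omega_open p_gt0 (wt ht)).
apply: ge0_le_integral => //.
- by move=> x _; rewrite lee_fin powR_ge0.
- apply/measurable_EFinP; apply: measurable_powR_comp; apply: measurable_euclid_norm => j.
  exact: weak_hgrad_measurable (wt ht).
- by apply/measurable_EFinP; exact: measurable_energy (wt ht).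
- by move=> x _; rewrite lee_fin lerDl powR_ge0.
Qed.

Lemma in_V_dt_integrable :
  mu2.-integrable (cylinder T Omega) (EFin \o (fun z => u' z.1 z.2)).
Proof.
have [_ _ hu' _] := uV.
apply: bochner_integrable hu'; last by move=> f [_ [g [wg _]]]; exists g.
by rewrite /conj_exponent ler_pdivlMr ?subr_gt0// mul1r gerBl.
Qed.

Lemma in_V_integrable :
  mu2.-integrable (cylinder T Omega) (EFin \o (fun z => u z.1 z.2)).
Proof.
have [hu _ _ _] := uV; apply: bochner_integrable hu; first exact: ltW.
by move=> f [[_ [g [wg _]]] _]; exists g.
Qed.

Lemma ae_slice_dt_integrable :
  {ae leb, forall t, 0 < t < T -> mu.-integrable Omega (EFin \o u' t)}.
Proof.
have := ae_integrable_slice mI mO in_V_dt_integrable.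
by apply: ae_imp => t h ht; apply: h; rewrite /= in_itv.
Qed.

Lemma ae_slice_hgrad_integrable :
  {ae leb, forall t, 0 < t < T ->
     mu.-integrable Omega (EFin \o (fun x => euclid_norm (Du t x) `^ p))}.
Proof.
have := ae_integrable_slice mI mO in_V_hgrad_integrable.
by apply: ae_imp => t h ht; apply: h; rewrite /= in_itv.
Qed.

Variables (beta q : R).
Hypothesis u_eq : forall phi Dphi phi', in_V p T Omega phi Dphi phi' -> C_L2 T Omega phi ->
  {ae mu2, forall z, cylinder T Omega z -> 0 <= phi z.1 z.2} ->
  mu2.-integrable (cylinder T Omega)
    (EFin \o (fun z => reaction beta q (u z.1 z.2) * phi z.1 z.2)) /\
  \int[mu2]_(z in cylinder T Omega)
    (u' z.1 z.2 * phi z.1 z.2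
     + euclid_norm (Du z.1 z.2) `^ (p - 2) * dotR (Du z.1 z.2) (Dphi z.1 z.2)) =
  - \int[mu2]_(z in cylinder T Omega) (reaction beta q (u z.1 z.2) * phi z.1 z.2).

Section test.
Variable psi : E -> R.
Hypotheses (Cpsi : Cc_infty Omega psi) (psi_ge0 : forall x, 0 <= psi x).

Let react (z : Z) := reaction beta q (u z.1 z.2) * psi z.2.
Let flux (z : Z) :=
  euclid_norm (Du z.1 z.2) `^ (p - 2) * dotR (Du z.1 z.2) (cgrad psi z.2).
Let k (z : Z) := u' z.1 z.2 * psi z.2 + flux z + react z.

Let psi2_measurable : measurable_fun (cylinder T Omega) (fun z : Z => psi z.2).
Proof.
apply: (measurable_cylinder_snd Omega_open); apply: (measurable_funS measurableT) => //.
exact: continuous_measurable_rV (smooth_continuous (Cc_infty_smooth Cpsi)).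
Qed.

Let cgrad2_measurable j :
  measurable_fun (cylinder T Omega) (fun z : Z => cgrad psi z.2 ord0 j).
Proof.
apply: (measurable_cylinder_snd Omega_open (f := fun x => cgrad psi x ord0 j)).
exact: weak_hgrad_measurable (cgrad_weak_hgrad Omega_open Cpsi).
Qed.

Let dt_psi_integrable :
  mu2.-integrable (cylinder T Omega) (EFin \o (fun z : Z => u' z.1 z.2 * psi z.2)).
Proof.
under eq_fun do rewrite /= mulrC.
have [C _ hC] := Cc_bounded Cpsi.
exact: (integrable_boundedM mC psi2_measurable (fun z _ => hC z.2) in_V_dt_integrable).
Qed.

Let flux_integrable : mu2.-integrable (cylinder T Omega) (EFin \o flux).
Proof.
have [C C0 hC] := Cc_cgrad_bounded Cpsi.
apply: (@le_integrable_real _ _ _ _ _ _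
  (fun z : Z => (hdim G)%:R * C * (1 + euclid_norm (Du z.1 z.2) `^ p))) => //.
- apply: measurable_funM.
    by apply/measurable_powR_comp/measurable_euclid_norm => j; exact: measurable_in_V_hgrad.
  by apply: measurable_dotR => j; [exact: measurable_in_V_hgrad|exact: cgrad2_measurable].
- move=> z _; apply: le_trans (flux_le _ _ p_gt1) _.
  rewrite -mulrA ler_wpM2l//  mulrC ler_pM ?powR_ge0 ?euclid_norm_ge0//.
  by apply: powRB1_le => //; exact: euclid_norm_ge0.
- apply: integrable_scale => //; apply: integrable_add => //.
    exact: integrable_cst_real lebesgue_cylinder_lty.
  exact: in_V_hgrad_integrable.
Qed.

Let test_weight (eta : R -> R) (C : R) : smooth eta -> (forall t, 0 <= eta t) ->
  (forall t, `|eta t| <= C) -> (forall t, `|'D_1 eta t| <= C) ->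
  mu2.-integrable (cylinder T Omega) (EFin \o (fun z : Z => eta z.1 * react z)) /\
  \int[mu2]_(z in cylinder T Omega) (eta z.1 * (u' z.1 z.2 * psi z.2 + flux z)) =
  - \int[mu2]_(z in cylinder T Omega) (eta z.1 * react z).
Proof.
move=> seta eta0 hC hdC.
have phiV := tensor_in_V T Omega_open Omega_bounded p_gt1 seta hC hdC Cpsi.
have [||h1 h2] := u_eq phiV; first exact: tensor_C_L2 seta Cpsi.
  by apply: aeW => z _; exact: mulr_ge0.
split.
  by move: h1; congr integrable; apply/funext => z /=; rewrite /react; congr EFin; ring.
transitivity (- \int[mu2]_(z in cylinder T Omega)
    (reaction beta q (u z.1 z.2) * (eta z.1 * psi z.2))).
  rewrite -h2; apply: eq_Rintegral => z _; rewrite dotRZr /flux; ring.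
by congr (- _); apply: eq_Rintegral => z _; rewrite /react; ring.
Qed.

Let cst1_smooth : smooth (fun _ : R => 1 : R). Proof. exact: smooth_cst. Qed.

(** The integrability clause of the weak formulation, read for the time weight 1; this is the source
    of all integrability of the reaction term. *)
Let react_integrable : mu2.-integrable (cylinder T Omega) (EFin \o react).
Proof.
have [] := @test_weight (fun=> 1) 1 cst1_smooth.
- by [].
- by move=> t; rewrite normr1.
- by move=> t; rewrite derive_cst normr0.
by move=> h _; move: h; congr integrable; apply/funext => z /=; rewrite mul1r.
Qed.

Let k_integrable : mu2.-integrable (cylinder T Omega) (EFin \o k).
Proof. exact: (integrable_add mC (integrable_add mC dt_psi_integrable flux_integrable) react_integrable). Qed.

(** The defect of the equation on the slice at time [t]; it has to vanish for almost every [t]. *)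
Let kappa (t : measurableTypeR R) : R := \int[mu]_(x in Omega) k (t, x).

Let kappa_integrable : leb.-integrable `]0, T[ (EFin \o kappa).
Proof. exact: (fubini_rectangle_integrable mI mO k_integrable). Qed.

Let kappa_weight (eta : R -> R) (C : R) : smooth eta -> (forall t, 0 <= eta t) ->
  (forall t, `|eta t| <= C) -> (forall t, `|'D_1 eta t| <= C) ->
  \int[leb]_(t in `]0, T[) (eta t * kappa t) = 0.
Proof.
move=> seta eta0 hC hdC; have [h1 h2] := test_weight seta eta0 hC hdC.
have meta : measurable_fun setT eta.
  by apply: continuous_measurable_fun; exact: smooth_continuous.
have meta2 : measurable_fun (cylinder T Omega) (fun z : Z => eta z.1).
  exact: measurable_cylinder_fst.
have i0 : mu2.-integrable (cylinder T Omega) (EFin \o (fun z : Z => eta z.1 * (u' z.1 z.2 * psi z.2 + flux z))).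
  exact: (integrable_boundedM mC meta2 (fun z _ => hC z.1) (integrable_add mC dt_psi_integrable flux_integrable)).
rewrite -(fubini_time_weight meta hC k_integrable).
transitivity (\int[mu2]_(z in cylinder T Omega)
    (eta z.1 * (u' z.1 z.2 * psi z.2 + flux z) + eta z.1 * react z)).
  by apply: eq_Rintegral => z _; rewrite -mulrDr.
by rewrite RintegralD// h2 addNr.
Qed.

(** The defect is orthogonal to every bounded smooth nonnegative time weight with bounded
    derivative. Such weights approximate indicators of rays, which are enough to force the defect to
    vanish almost everywhere. The exceptional null set depends on [psi]. *)
Lemma ae_weak_equation : {ae leb, forall t, 0 < t < T ->
  mu.-integrable Omega (EFin \o (fun x => reaction beta q (u t x) * psi x)) /\
  \int[mu]_(x in Omega) (u' t x * psi x
     + euclid_norm (Du t x) `^ (p - 2) * dotR (Du t x) (cgrad psi x)) =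
  - \int[mu]_(x in Omega) (reaction beta q (u t x) * psi x)}.
Proof.
have K0 : \int[leb]_(t in `]0, T[) kappa t = 0.
  have := @kappa_weight (fun=> 1) 1 cst1_smooth (fun=> ler01).
  under eq_Rintegral do rewrite mul1r.
  by apply=> t; rewrite ?derive_cst ?normr1 ?normr0.
have Ka a : \int[leb]_(t in `]a, +oo[ `&` `]0, T[) kappa t = 0.
  (* These weights tend to the indicator of ]a, +oo[ from below and stay in [0, 1], so that the
     defect itself provides the majorant. *)
  pose f_ n (t : measurableTypeR R) := flat (1 : {poly R}) (n%:R * (t - a)) * kappa t.
  have f0 n : \int[leb]_(t in `]0, T[) f_ n t = 0.
    have [C [hC hdC]] := flat_scaled_bounded a (n%:R).
    by apply: (kappa_weight (C := C)) => //; [exact: smooth_flat_scaled|move=> t; exact: flat1_ge0].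
  have mka : measurable_fun `]0, T[ kappa by exact: integrable_measurable kappa_integrable.
  have : \int[leb]_(t in `]0, T[) f_ n t @[n --> \oo] -->
         \int[leb]_(t in `]0, T[) (\1_(`]a, +oo[ : set R) t * kappa t).
    apply: (Rintegral_dominated (g := fun t : measurableTypeR R => `|kappa t|)) => //.
    + move=> n; apply: measurable_funM => //; apply: measurable_funTS.
      apply: continuous_measurable_fun; apply: smooth_continuous; exact: smooth_flat_scaled.
    + move=> t _; apply: cvgM; last exact: cvg_cst.
      rewrite indicE; have [ta|ta] := leP t a.
        rewrite memNset /=; last by rewrite in_itv /= andbT ltNge ta.
        by under eq_fun do rewrite flat_le0 ?mulr_ge0_le0 ?subr_le0//; exact: cvg_cst.
      by rewrite mem_set /= ?in_itv /= ?ta//; apply: cvg_flat1_scaled; rewrite subr_gt0.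
    + by move/integrable_norm : kappa_integrable; congr integrable.
    + by move=> n t _; rewrite /f_ normrM ger0_norm ?flat1_ge0// ler_piMl// flat1_le1.
  rewrite (_ : (fun n => _) = fun=> 0); last by apply/funext => n; exact: f0.
  move=> /(cvg_unique (@Rhausdorff R) (cvg_cst _)) h.
  rewrite [RHS]h; rewrite [RHS]Rintegral_mkcond [LHS]Rintegral_mkcond.
  apply: eq_Rintegral => t _; rewrite !patchE in_setI indicE.
  by case: (t \in _) => //=; rewrite ?mul1r// mul0r; case: ifP.
(* Open rays to the right are stable under intersection and generate the Borel sets, as the
   pi-lambda argument requires. *)
have kappa0 : {ae leb, forall t, `]0, T[%classic t -> kappa t = 0}.
  have mG : @measurable _ (measurableTypeR R) = <<s @RGenOInfty.G R >>.
    exact: RGenOInfty.measurableE.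
  apply: (ae_eq0_of_generator mG _ mI kappa_integrable K0).
    move=> _ _ [a ->] [b ->]; exists (Num.max a b).
    by apply/seteqP; split => t /=; rewrite !in_itv /= !andbT gt_max => /andP.
  by move=> _ [a ->]; exact: Ka.
(* On a slice the integral of the sum may be split only where the three terms are separately
   integrable, which costs three further null sets. *)
have S1 := ae_integrable_slice mI mO dt_psi_integrable.
have S2 := ae_integrable_slice mI mO flux_integrable.
have S3 := ae_integrable_slice mI mO react_integrable.
have := ae_and kappa0 (ae_and S1 (ae_and S2 S3)).
apply: ae_imp => t /= [k0 [s1 [s2 s3]]] ht.
have ht' : `]0, T[%classic t by rewrite /= in_itv.
have {}s1 := s1 ht'; have {}s2 := s2 ht'; have {}s3 := s3 ht'.
split; first exact: s3.
have := k0 ht'; rewrite /kappa /k RintegralD//; last exact: integrable_add.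
by move/eqP; rewrite addr_eq0 => /eqP.
Qed.

End test.
End evolution.

(** * Dominated convergence and summable errors *)

Section convergence.
Context d (T : measurableType d) {R : realType} (mu : {measure set T -> \bar R}).
Variable D : set T.
Hypothesis mD : measurable D.

Lemma Rintegral_ae_dominated (f_ : nat -> T -> R) (f g : T -> R) :
  (forall n, measurable_fun D (f_ n)) -> measurable_fun D f ->
  {ae mu, forall x, D x -> f_ n x @[n --> \oo] --> f x} ->
  mu.-integrable D (EFin \o g) ->
  {ae mu, forall x, forall n, D x -> `|f_ n x| <= g x} ->
  mu.-integrable D (EFin \o f) /\
  \int[mu]_(x in D) f_ n x @[n --> \oo] --> \int[mu]_(x in D) f x.
Proof.
move=> mf_ mf cf ig fg.
have [|||//|intf _ cvi] := @dominated_convergence _ _ _ mu D mD (fun n => EFin \o f_ n)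
  (EFin \o f) (EFin \o g) _ _ _ ig.
- by move=> n; exact/measurable_EFinP.
- exact/measurable_EFinP.
- by apply: ae_imp cf => x h /h; exact: cvg_EFin (nearW _ _).
split => //.
rewrite /Rintegral; apply: (fine_cvg (f := fun n => (\int[mu]_(x in D) (f_ n x)%:E)%E)).
by rewrite fineK//; exact: integrable_fin_num.
Qed.

(* Summing the e_ n yields an integrable majorant. *)
Lemma ae_cvg0_of_summable (e_ : nat -> T -> R) :
  (forall n, measurable_fun D (e_ n)) -> (forall n x, 0 <= e_ n x) ->
  (forall n, (\int[mu]_(x in D) (e_ n x)%:E <= (1 / (2 ^ n.+1)%:R)%:E)%E) ->
  exists2 S : T -> R, mu.-integrable D (EFin \o S) &
    {ae mu, forall x, D x -> (forall n, e_ n x <= S x) /\ e_ n x @[n --> \oo] --> (0 : R)}.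
Proof.
move=> me e0 he.
pose S (x : T) : \bar R := (\sum_(0 <= n <oo) (e_ n x)%:E)%E.
have mS : measurable_fun D S.
  apply: ge0_emeasurable_sum => [n x _ _|n _]; first by rewrite lee_fin.
  exact/measurable_EFinP.
have S0 x : (0 <= S x)%E by apply: nneseries_ge0 => n _ _; rewrite lee_fin.
have iS : mu.-integrable D S.
  apply/integrableP; split => //.
  under eq_integral do rewrite gee0_abs//.
  rewrite integral_nneseries//; last 2 first.
    by move=> n; exact/measurable_EFinP.
    by move=> n x _; rewrite lee_fin.
  apply: (@le_lt_trans _ _ (\sum_(0 <= n <oo) (1 / (2 ^ n.+1)%:R)%:E)%E).
    by apply: lee_nneseries => [n _ _|n _]; [apply: integral_ge0 => x _; rewrite lee_fin|exact: he].
  have H := @cvg_geometric_eseries_half R 1 0.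
  rewrite (_ : (\sum_(0 <= n <oo) _)%E = (1 / 2 ^+ 0)%:E) ?ltry//.
  rewrite -(cvg_lim (@ereal_hausdorff R) H); apply: congr_lim; apply/funext => n.
  by rewrite /eseries /=; apply: eq_bigr => k _; rewrite addn1.
have [iS' _] := integrable_fine mD iS.
exists (fine \o S) => //.
have := integrable_ae mD iS; apply: ae_imp => x finS Dx; have {}finS := finS Dx.
have partial n : series (e_ ^~ x) n <= fine (S x).
  rewrite -lee_fin fineK// /series /= -sumEFin.
  by apply: nneseries_lim_ge => k _ _; rewrite lee_fin.
split=> [n|].
  apply: le_trans (partial n.+1); rewrite /series /= big_nat_recr//= lerDr.
  by apply: sumr_ge0.
apply: cvg_series_cvg_0; apply: nondecreasing_is_cvgn.
  by apply: nondecreasing_series => n _ _.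
by exists (fine (S x)) => _ [n _ <-]; exact: partial.
Qed.

End convergence.

(** * Elementary limits and bounds for the flux *)

Section real_tools.
Context {R : realType}.

Lemma cvg_powR0 (a : nat -> R) (p : R) : 0 < p -> (forall n, 0 <= a n) ->
  a n `^ p @[n --> \oo] --> (0 : R) -> a n @[n --> \oo] --> (0 : R).
Proof.
move=> p0 a0 h; apply/cvgrPdist_lt => e e0.
have ep : 0 < e `^ p by exact: powR_gt0.
move/cvgrPdist_lt : h => /(_ _ ep); apply: filterS => n.
rewrite !sub0r !normrN ger0_norm ?powR_ge0// ger0_norm// => h.
rewrite ltNge; apply/negP => ea; move: h; rewrite ltNge => /negP; apply.
by apply: ge0_ler_powR; rewrite ?nnegrE ?(ltW p0) ?(ltW e0) ?a0.
Qed.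

(** A form of Young's inequality: the larger of the two numbers bounds the product by its own p-th
    power. *)
Lemma powR_mul_le (a b p : R) : 1 < p -> 0 <= a -> 0 <= b ->
  a `^ (p - 1) * b <= a `^ p + b `^ p.
Proof.
move=> p1 a0 b0; have p0 : 0 < p by exact: lt_trans p1.
have H (x : R) : 0 <= x -> x `^ (p - 1) * x = x `^ p.
  by move=> x0; rewrite mulrC mulr_powRB1.
have p10 : 0 <= p - 1 by rewrite subr_ge0 ltW.
have [ab|/ltW ba] := leP a b.
  rewrite (le_trans (y := b `^ p)) ?lerDr ?powR_ge0// -H// ler_wpM2r//.
  by apply: ge0_ler_powR.
by rewrite (le_trans (y := a `^ p)) ?lerDl ?powR_ge0// -H// ler_wpM2l ?powR_ge0.
Qed.

Lemma flux_le_sum n (p : R) (v w : 'rV[R]_n) : 1 < p ->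
  `|euclid_norm v `^ (p - 2) * dotR v w| <=
  n%:R * (euclid_norm v `^ p + euclid_norm w `^ p).
Proof.
move=> p1; apply: le_trans (flux_le _ _ p1) _.
by rewrite ler_wpM2l// powR_mul_le ?euclid_norm_ge0.
Qed.

Lemma flux_self n (p : R) (v : 'rV[R]_n) : 1 < p ->
  euclid_norm v `^ (p - 2) * dotR v v = euclid_norm v `^ p.
Proof.
move=> p1; have p0 : 0 < p by exact: lt_trans p1.
rewrite -euclid_norm_sqr expr2 mulrA (_ : p - 2 = p - 1 - 1); last by ring.
rewrite [X in X * _]mulrC mulr_powRB1 ?euclid_norm_ge0 ?subr_gt0//.
by rewrite mulrC mulr_powRB1 ?euclid_norm_ge0.
Qed.

Lemma cvg_dotR n (v : 'rV[R]_n) (w_ : nat -> 'rV[R]_n) (w : 'rV[R]_n) :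
  euclid_norm (w - w_ k) @[k --> \oo] --> (0 : R) -> dotR v (w_ k) @[k --> \oo] --> dotR v w.
Proof.
move=> h; pose c k := n%:R * (euclid_norm v * euclid_norm (w - w_ k)).
have c0 : c k @[k --> \oo] --> (0 : R).
  rewrite -[X in _ --> X](mulr0 n%:R).
  apply: cvgM; first exact: cvg_cst.
  by rewrite -[X in _ --> X](mulr0 (euclid_norm v)); apply: cvgM => //; exact: cvg_cst.
apply: (@squeeze_cvgr _ _ _ _ (fun k => dotR v w - c k) (fun k => dotR v w + c k)).
- apply: nearW => k; rewrite -ler_distlC (_ : dotR v w - dotR v (w_ k) = dotR v (w - w_ k)) ?dotR_le//.
  by rewrite /dotR -sumrB; apply: eq_bigr => i _; rewrite !mxE mulrBr.
- by rewrite -[X in _ --> X]subr0; apply: cvgB => //; exact: cvg_cst.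
- by rewrite -[X in _ --> X]addr0; apply: cvgD => //; exact: cvg_cst.
Qed.

End real_tools.

(** * The cutoff function *)

Section cutoff.
Context {R : realType}.

(* With y = 1/x, the derivative of x * (flat 1 x) ^ 2 is (1 + 2y) exp(-2y). *)
Definition cutoff_poly : {poly R} := 1 + 2%:P * 'X.

Definition cutoff (x : R) : R := flat 1 x * flat cutoff_poly x.

Lemma flat_cutoff_ge0 (x : R) : 0 <= flat cutoff_poly x.
Proof.
rewrite /flat; case: ifPn => // x0; rewrite mulr_ge0 ?expR_ge0// !hornerE.
by rewrite addr_ge0// mulr_ge0// invr_ge0 ltW.
Qed.

Lemma is_derive_cutoff (x : R) : is_derive x 1 cutoff
  (flat (flat_derivative 1) x * flat cutoff_poly x + flat 1 x * flat (flat_derivative cutoff_poly) x).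
Proof.
have H1 := is_derive_flat (1 : {poly R}) x; have H2 := is_derive_flat cutoff_poly x.
by apply: is_derive_eq; rewrite /GRing.scale /= addrC; congr (_ + _); exact: mulrC.
Qed.

(** With y = 1/x the sum collapses to 4 y^3 exp(-2y): the term - y^2 from the second factor cancels
    against y^2 from the first. *)
Lemma derive_cutoff_ge0 (x : R) :
  0 <= flat (flat_derivative 1) x * flat cutoff_poly x + flat 1 x * flat (flat_derivative cutoff_poly) x.
Proof.
rewrite /flat; case: ifPn => [x0|_]; last by rewrite !mul0r add0r.
have y0 : 0 < x^-1 by rewrite invr_gt0.
rewrite /flat_derivative /cutoff_poly -polyC1 derivD derivM !derivC derivX mul0r !add0r !hornerE /=.
set y := x^-1 in y0 *; set e := expR _.
rewrite (_ : _ + _ = 4 * y ^+ 3 * (e * e)); last by ring.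
by rewrite !mulr_ge0 ?expR_ge0// ?exprn_ge0// ltW.
Qed.

End cutoff.

(** * Passage to the limit in the flux *)

Section flux_limit.
Context {R : realType} (G : stratified_group R).
Local Notation E := 'rV[R]_(topdim G).
Local Notation H := 'rV[R]_(hdim G).
Local Notation mu := (@lebesgue_rV R (topdim G)).
Variables (Omega : set E) (p : R).
Hypotheses (Omega_open : open Omega) (p_gt1 : 1 < p).

Let mO : measurable Omega. Proof. exact: open_measurable_rV. Qed.

Variables (w : E -> R) (g : E -> H).
Hypotheses (intw : mu.-integrable Omega (EFin \o w))
  (mg : forall j, measurable_fun Omega (fun x => g x ord0 j))
  (intg : mu.-integrable Omega (EFin \o (fun x => euclid_norm (g x) `^ p))).

(** The gradient of a product of two compositions has two terms, one for each approximant; [X] and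
    [Y] are kept apart because their limits are taken one after the other. *)
Definition flux_integrand (c d e : E -> R) (X Y : E -> H) (x : E) : R :=
  w x * c x + euclid_norm (g x) `^ (p - 2) * dotR (g x) (d x *: X x + e x *: Y x).

Lemma measurable_flux_integrand (c d e : E -> R) (X Y : E -> H) :
  measurable_fun Omega c -> measurable_fun Omega d -> measurable_fun Omega e ->
  (forall j, measurable_fun Omega (fun x => X x ord0 j)) ->
  (forall j, measurable_fun Omega (fun x => Y x ord0 j)) ->
  measurable_fun Omega (flux_integrand c d e X Y).
Proof.
move=> mc md me mX mY; apply: measurable_funD.
  by apply: measurable_funM => //; exact: integrable_measurable intw.
apply: measurable_funM.
  by apply: measurable_powR_comp; exact: measurable_euclid_norm.
apply: measurable_dotR => // j; under eq_fun do rewrite !mxE.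
by apply: measurable_funD; exact: measurable_funM.
Qed.

(** Bounded coefficients and gradients whose p-th powers lie below [S] leave the majorant C |w| + 2
    C N (|g|^p + S), by the Young-type bound on the flux; the 2 counts the two gradient terms. *)
Lemma cvg_flux_integral (c_ d_ e_ : nat -> E -> R) (X_ Y_ : nat -> E -> H)
    (c d e : E -> R) (X Y : E -> H) (S : E -> R) (C : R) :
  (forall n, [/\ measurable_fun Omega (c_ n), measurable_fun Omega (d_ n) &
                 measurable_fun Omega (e_ n)]) ->
  (forall n j, measurable_fun Omega (fun x => X_ n x ord0 j)) ->
  (forall n j, measurable_fun Omega (fun x => Y_ n x ord0 j)) ->
  [/\ measurable_fun Omega c, measurable_fun Omega d & measurable_fun Omega e] ->
  (forall j, measurable_fun Omega (fun x => X x ord0 j)) ->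
  (forall j, measurable_fun Omega (fun x => Y x ord0 j)) ->
  (forall n x, [/\ `|c_ n x| <= C, `|d_ n x| <= C & `|e_ n x| <= C]) ->
  mu.-integrable Omega (EFin \o S) ->
  {ae mu, forall x, Omega x ->
     [/\ c_ n x @[n --> \oo] --> c x, d_ n x @[n --> \oo] --> d x &
         e_ n x @[n --> \oo] --> e x] /\
     [/\ euclid_norm (X x - X_ n x) @[n --> \oo] --> (0 : R),
         euclid_norm (Y x - Y_ n x) @[n --> \oo] --> (0 : R) &
         forall n, euclid_norm (X_ n x) `^ p <= S x /\ euclid_norm (Y_ n x) `^ p <= S x]} ->
  mu.-integrable Omega (EFin \o flux_integrand c d e X Y) /\
  \int[mu]_(x in Omega) flux_integrand (c_ n) (d_ n) (e_ n) (X_ n) (Y_ n) x @[n --> \oo]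
    --> \int[mu]_(x in Omega) flux_integrand c d e X Y x.
Proof.
move=> m_ mX_ mY_ [mc md me] mX mY bd iS ae.
pose N := (hdim G)%:R : R.
apply: (Rintegral_ae_dominated mO (g := fun x => C * `|w x| +
  2 * C * N * (euclid_norm (g x) `^ p + S x))).
- by move=> n; have [? ? ?] := m_ n; exact: measurable_flux_integrand.
- exact: measurable_flux_integrand.
- apply: ae_imp ae => x h /h [[cc cd ce] [cX cY _]].
  apply: cvgD; first by apply: cvgM => //; exact: cvg_cst.
  apply: cvgM; first exact: cvg_cst.
  rewrite (_ : (fun n => dotR _ _) =
    fun n => d_ n x * dotR (g x) (X_ n x) + e_ n x * dotR (g x) (Y_ n x)); last first.
    by apply/funext => n; rewrite dotRDr !dotRZr.
  rewrite dotRDr !dotRZr; apply: cvgD; apply: cvgM => //; exact: cvg_dotR.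
- apply: integrable_add => //.
    apply: integrable_scale => //; exact: integrable_norm intw.
  by apply: integrable_scale => //; exact: integrable_add.
- apply: ae_imp ae => x h n /h [_ [_ _ bS]]; have [bX bY] := bS n; have [bc bd' be] := bd n x.
  rewrite /flux_integrand (le_trans (ler_normD _ _))// lerD//.
    by rewrite normrM mulrC ler_wpM2r.
  rewrite dotRDr !dotRZr mulrDr (le_trans (ler_normD _ _))//.
  have K (a : R) (v : H) : `|a| <= C -> euclid_norm v `^ p <= S x ->
      `|euclid_norm (g x) `^ (p - 2) * (a * dotR (g x) v)| <=
      C * (N * (euclid_norm (g x) `^ p + S x)).
    move=> aC vS; rewrite mulrCA normrM ler_pM//.
    by apply: le_trans (flux_le_sum _ _ p_gt1) _; rewrite ler_wpM2l// lerD2l.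
  rewrite (_ : 2 * C * N * _ = C * (N * (euclid_norm (g x) `^ p + S x)) +
    C * (N * (euclid_norm (g x) `^ p + S x))); last by ring.
  by apply: lerD; exact: K.
Qed.

End flux_limit.

(** * The inequality on a single time slice *)

Section elliptic.
Context {R : realType} (G : stratified_group R).
Local Notation E := 'rV[R]_(topdim G).
Local Notation H := 'rV[R]_(hdim G).
Local Notation mu := (@lebesgue_rV R (topdim G)).
Variables (Omega : set E) (p : R).
Hypotheses (Omega_open : open Omega) (p_gt1 : 1 < p).

Let mO : measurable Omega. Proof. exact: open_measurable_rV. Qed.
Let p_gt0 : 0 < p. Proof. exact: lt_trans ltr01 p_gt1. Qed.

(** Approximants with energy error below 2^-(k+1) have summable errors. This gives convergence
    almost everywhere of the whole sequence, without passing to a subsequence, together with a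
    common integrable majorant. *)
Lemma ae_cvg_approximants (D : nat -> E -> R) (v : E -> R) (g : E -> H) :
  (forall k, Cc_infty Omega (D k)) -> weak_hgrad Omega v g -> approximable Omega p (range D) v g ->
  mu.-integrable Omega (EFin \o (fun x => euclid_norm (g x) `^ p)) ->
  exists (m : nat -> nat) (S : E -> R), mu.-integrable Omega (EFin \o S) /\
    {ae mu, forall x, Omega x ->
      [/\ D (m k) x @[k --> \oo] --> v x,
          euclid_norm (g x - cgrad (D (m k)) x) @[k --> \oo] --> (0 : R),
          euclid_norm (g x) `^ p <= S x &
          forall k, euclid_norm (cgrad (D (m k)) x) `^ p <= S x]}.
Proof.
move=> DC wg app intg.
have /choice[m hm] : forall k : nat, exists m, (energy Omega p (fun x => v x - D m x)%R
    (fun x => g x - cgrad (D m) x)%R < (1 / (2 ^ k.+1)%:R)%:E)%E.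
  move=> k; have [_ [m _ <-] h] := app (1 / (2 ^ k.+1)%:R) ltac:(by rewrite divr_gt0// ltr0n expn_gt0).
  by exists m.
pose e_ k x := euclid_norm (g x - cgrad (D (m k)) x) `^ p + `|v x - D (m k) x| `^ p.
have wD k : weak_hgrad Omega (D (m k)) (cgrad (D (m k))) by exact: cgrad_weak_hgrad.
have me k : measurable_fun Omega (e_ k).
  exact: measurable_energy (weak_hgradB Omega_open wg (wD k)).
have e0 k x : 0 <= e_ k x by rewrite addr_ge0 ?powR_ge0.
have [S iS ae] := ae_cvg0_of_summable mO me e0 (fun k => ltW (hm k)).
(* The majorant comes from the triangle inequality up to 2^p: the gradient of an approximant is g
   minus an error whose p-th power is at most S. *)
exists m, (fun x => 2 `^ p * (euclid_norm (g x) `^ p + S x)); split.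
  by apply: integrable_scale => //; exact: integrable_add.
apply: ae_imp ae => x h /h [hS c0].
have S0 : 0 <= S x by apply: le_trans (hS 0%N); rewrite addr_ge0 ?powR_ge0.
have p2 : 1 <= 2 `^ p :> R.
  have {1}-> : (1 : R) = 1 `^ p by rewrite powR1.
  by apply: ge0_ler_powR; rewrite ?nnegrE ?(ltW p_gt0)// ler1n.
have squeeze (a : nat -> R) : (forall k, 0 <= a k) -> (forall k, a k `^ p <= e_ k x) ->
    a k @[k --> \oo] --> (0 : R).
  move=> a0 ae; apply: (cvg_powR0 p_gt0 a0).
  apply: (@squeeze_cvgr _ _ _ _ (fun=> 0) (e_ ^~ x)) => //; last exact: cvg_cst.
  by apply: nearW => k; rewrite powR_ge0 ae.
have cv : `|v x - D (m k) x| @[k --> \oo] --> (0 : R).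
  by apply: squeeze => // k; rewrite lerDr powR_ge0.
split.
- apply/cvgrPdist_lt => d d0; move/cvgrPdist_lt : cv => /(_ _ d0).
  by apply: filterS => k; rewrite sub0r normrN normr_id.
- by apply: squeeze => k; [exact: euclid_norm_ge0|rewrite lerDl powR_ge0].
- rewrite (le_trans (y := 2 `^ p * euclid_norm (g x) `^ p)) ?ler_peMl ?powR_ge0//.
  by rewrite ler_wpM2l ?powR_ge0// lerDl.
- move=> k; have hk : euclid_norm (g x - cgrad (D (m k)) x) `^ p <= S x.
    by apply: le_trans (hS k); rewrite lerDl powR_ge0.
  apply: le_trans (powR_max_le (a := euclid_norm (g x))
    (b := euclid_norm (g x - cgrad (D (m k)) x)) (ltW p_gt0) _ _ _ _) _; rewrite ?euclid_norm_ge0//.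
    have := euclid_normD_max (g x) (- (g x - cgrad (D (m k)) x)).
    by rewrite -(scaleN1r (g x - _)) euclid_normZ normrN1 mul1r scaleN1r opprB addrC subrK.
  by rewrite ler_wpM2l ?powR_ge0// lerD2l.
Qed.

Lemma cgradM (f h : E -> R) x : smooth f -> smooth h ->
  cgrad (fun x => f x * h x) x = h x *: cgrad f x + f x *: cgrad h x :> H.
Proof.
move=> sf sh; apply/rowP => j; rewrite !mxE.
have -> : (fun x => f x * h x) = f \* h by [].
rewrite deriveM; [|exact: smooth_derivable..].
by rewrite /GRing.scale /= addrC.
Qed.

Lemma cgrad_flat_comp (P : {poly R}) (s M : R) (f : E -> R) x : smooth f ->
  cgrad (fun x => flat P (s * f x - M)) x = (s * flat (flat_derivative P) (s * f x - M)) *: cgrad f x :> H.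
Proof.
move=> sf; apply/rowP => j; rewrite !mxE.
have sl : smooth (fun y : R => flat P (s * y - M)).
  by apply: smooth_real_comp; [exact: smooth_flat|exact: smooth_affine].
rewrite (derive_real_comp (g := fun y : R => flat P (s * y - M)));
  [|exact: smooth_differentiable..].
congr (_ * _).
have H1 : is_derive (f x) 1 (fun y : R => s * y - M) s.
  have -> : (fun y : R => s * y - M) = s \*: id - cst M by [].
  by apply: is_derive_eq; rewrite subr0 /GRing.scale /= mulr1.
have H2 := @is_derive1_comp _ (flat P) (fun y : R => s * y - M) _ _ _ (is_derive_flat P (s * f x - M)) H1.
by rewrite (@derive_val _ _ _ _ _ _ _ H2) mulrC.
Qed.

Variables (D : nat -> E -> R) (v : E -> R) (g : E -> H) (w : E -> R) (beta q s M : R).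
Hypotheses (DC : forall k, Cc_infty Omega (D k)) (wg : weak_hgrad Omega v g)
  (app : approximable Omega p (range D) v g)
  (intw : mu.-integrable Omega (EFin \o w))
  (intg : mu.-integrable Omega (EFin \o (fun x => euclid_norm (g x) `^ p)))
  (s_sign : s = 1 \/ s = -1) (M_ge1 : 1 <= M) (q_lt : q < beta + 1).

(* The two factors carry different approximants of v: the reaction term gets a
   sign only once the first one has reached its limit v, and until then the
   second one keeps it integrable. *)
Definition cutoff_test (a b : nat) (x : E) : R :=
  flat 1 (s * D a x - M) * flat cutoff_poly (s * D b x - M).

Definition cutoff_test1 (b : nat) (x : E) : R := flat cutoff_poly (s * D b x - M).

Hypotheses
  (react_integrable : forall b,
     mu.-integrable Omega (EFin \o (fun x => reaction beta q (v x) * cutoff_test1 b x)))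
  (equation : forall a b,
     \int[mu]_(x in Omega) (w x * cutoff_test a b x
       + euclid_norm (g x) `^ (p - 2) * dotR (g x) (cgrad (cutoff_test a b) x)) =
     - \int[mu]_(x in Omega) (reaction beta q (v x) * cutoff_test a b x)).

Let A (f : E -> R) x : R := flat 1 (s * f x - M).
Let A' (f : E -> R) x : R := flat (flat_derivative 1) (s * f x - M).
Let B (f : E -> R) x : R := flat cutoff_poly (s * f x - M).
Let B' (f : E -> R) x : R := flat (flat_derivative cutoff_poly) (s * f x - M).

Let cgrad_test a b x : cgrad (cutoff_test a b) x =
  (B (D b) x * (s * A' (D a) x)) *: cgrad (D a) x +
  (A (D a) x * (s * B' (D b) x)) *: cgrad (D b) x.
Proof.
have sD k := Cc_infty_smooth (DC k).
have sl (P : {poly R}) k : smooth (fun x => flat P (s * D k x - M)).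
  have h : smooth (fun y : R => flat P (s * y - M)).
    by apply: smooth_real_comp; [exact: smooth_flat|exact: smooth_affine].
  by apply: (@smooth_real_comp _ _ (fun y : R => flat P (s * y - M))).
rewrite (cgradM x (sl 1 a) (sl cutoff_poly b)) (cgrad_flat_comp _ _ _ _ (sD a)) (cgrad_flat_comp _ _ _ _ (sD b)).
by rewrite !scalerA.
Qed.

Let flat_cvg (P : {poly R}) (y_ : nat -> R) y : y_ n @[n --> \oo] --> y ->
  flat P (s * y_ n - M) @[n --> \oo] --> flat P (s * y - M).
Proof.
move=> cy; apply: continuous_cvg; first exact: continuous_flat.
by apply: cvgB; [apply: cvgM => //; exact: cvg_cst|exact: cvg_cst].
Qed.

Let flat_meas (P : {poly R}) (f : E -> R) : measurable_fun Omega f ->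
  measurable_fun Omega (fun x => flat P (s * f x - M)).
Proof.
move=> mf; apply: (measurableT_comp (f := flat P)).
  by apply: continuous_measurable_fun => y; exact: continuous_flat.
by apply: measurable_funB => //; exact: measurable_funM.
Qed.

Let mD k : measurable_fun Omega (D k).
Proof. exact: weak_hgrad_measurable_fun (cgrad_weak_hgrad Omega_open (DC k)). Qed.

Let mDg k j : measurable_fun Omega (fun x => cgrad (D k) x ord0 j).
Proof. exact: weak_hgrad_measurable (cgrad_weak_hgrad Omega_open (DC k)). Qed.

Let mv : measurable_fun Omega v. Proof. exact: weak_hgrad_measurable_fun wg. Qed.

Let mg j : measurable_fun Omega (fun x => g x ord0 j).
Proof. exact: weak_hgrad_measurable wg. Qed.

(** Where the factor [A v] is nonzero, s v exceeds M >= 1 and the higher power prevails; oddness of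
    the reaction carries the case s = -1 over to s = 1. *)
Let sreact_ge0 x : 0 <= s * reaction beta q (v x) * A v x.
Proof.
rewrite /A; have [h|h] := leP (s * v x - M) 0; first by rewrite flat_le0// mulr0.
rewrite mulr_ge0 ?flat1_ge0//.
have {}h : 1 <= s * v x by rewrite subr_gt0 in h; exact: ltW (le_lt_trans M_ge1 h).
by have [e|e] := s_sign; move: h; rewrite e ?mul1r ?mulN1r -?reactionN; exact: reaction_ge0.
Qed.

Let F (f h : E -> R) (X Y : E -> H) := flux_integrand p w g (fun x => A f x * B h x)
  (fun x => B h x * (s * A' f x)) (fun x => A f x * (s * B' h x)) X Y.

Let s_norm : `|s| = 1. Proof. by case: s_sign => ->; rewrite ?normrN normr1. Qed.

Let flat_coeff_bounded : exists C, forall (f h : E -> R) x,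
  [/\ `|A f x * B h x| <= C, `|B h x * (s * A' f x)| <= C & `|A f x * (s * B' h x)| <= C].
Proof.
have [C1 C10 hC1] := flat_bounded (flat_derivative (1 : {poly R})).
have [C2 C20 hC2] := flat_bounded (cutoff_poly : {poly R}).
have [C3 C30 hC3] := flat_bounded (flat_derivative (cutoff_poly : {poly R})).
have bA f x : `|A f x| <= 1 by rewrite /A ger0_norm ?flat1_ge0 ?flat1_le1.
have C21 : 0 <= C2 * C1 by exact: mulr_ge0.
exists (C2 + C2 * C1 + C3) => f h x.
have h1 : `|A f x * B h x| <= C2 by rewrite normrM -[leRHS]mul1r ler_pM// hC2.
have h2 : `|B h x * (s * A' f x)| <= C2 * C1.
  by rewrite !normrM s_norm mul1r ler_pM// ?hC2 ?hC1.
have h3 : `|A f x * (s * B' h x)| <= C3.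
  by rewrite !normrM s_norm mul1r -[leRHS]mul1r ler_pM// ?hC3.
by split; [move: h1|move: h2|move: h3]; move/le_trans; apply; lra.
Qed.

Let measurable_coeff (f h : E -> R) : measurable_fun Omega f -> measurable_fun Omega h ->
  [/\ measurable_fun Omega (fun x => A f x * B h x),
     measurable_fun Omega (fun x => B h x * (s * A' f x)) &
     measurable_fun Omega (fun x => A f x * (s * B' h x))].
Proof.
move=> mf mh; split; apply: measurable_funM; try exact: flat_meas.
- by apply: measurable_funM => //; exact: flat_meas.
- by apply: measurable_funM => //; exact: flat_meas.
Qed.

Let cvg_integral_F (f_ h_ : nat -> E -> R) (X_ Y_ : nat -> E -> H) (f h : E -> R)
    (X Y : E -> H) (S : E -> R) :
  (forall n, measurable_fun Omega (f_ n)) -> (forall n, measurable_fun Omega (h_ n)) ->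
  (forall n j, measurable_fun Omega (fun x => X_ n x ord0 j)) ->
  (forall n j, measurable_fun Omega (fun x => Y_ n x ord0 j)) ->
  measurable_fun Omega f -> measurable_fun Omega h ->
  (forall j, measurable_fun Omega (fun x => X x ord0 j)) ->
  (forall j, measurable_fun Omega (fun x => Y x ord0 j)) ->
  mu.-integrable Omega (EFin \o S) ->
  {ae mu, forall x, Omega x ->
     (f_ n x @[n --> \oo] --> f x /\ h_ n x @[n --> \oo] --> h x) /\
     [/\ euclid_norm (X x - X_ n x) @[n --> \oo] --> (0 : R),
         euclid_norm (Y x - Y_ n x) @[n --> \oo] --> (0 : R) &
         forall n, euclid_norm (X_ n x) `^ p <= S x /\ euclid_norm (Y_ n x) `^ p <= S x]} ->
  mu.-integrable Omega (EFin \o F f h X Y) /\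
  \int[mu]_(x in Omega) F (f_ n) (h_ n) (X_ n) (Y_ n) x @[n --> \oo]
    --> \int[mu]_(x in Omega) F f h X Y x.
Proof.
move=> mf_ mh_ mX_ mY_ mf mh mX mY iS ae; have [C bC] := flat_coeff_bounded.
apply: (@cvg_flux_integral _ _ _ _ Omega_open p_gt1 _ _ intw mg intg
  (fun n x => A (f_ n) x * B (h_ n) x) (fun n x => B (h_ n) x * (s * A' (f_ n) x))
  (fun n x => A (f_ n) x * (s * B' (h_ n) x)) X_ Y_
  (fun x => A f x * B h x) (fun x => B h x * (s * A' f x))
  (fun x => A f x * (s * B' h x)) X Y S C _ mX_ mY_ _ mX mY _ iS).
- by move=> n; exact: measurable_coeff.
- exact: measurable_coeff.
- by move=> n x; exact: bC.
apply: ae_imp ae => x hx /hx [[cf ch] hXY]; split; last exact: hXY.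
have [cA cA' cB cB'] : [/\ A (f_ n) x @[n --> \oo] --> A f x, A' (f_ n) x @[n --> \oo] --> A' f x,
    B (h_ n) x @[n --> \oo] --> B h x & B' (h_ n) x @[n --> \oo] --> B' h x].
  by split; exact: flat_cvg.
by split; apply: cvgM => //; apply: cvgM => //; exact: cvg_cst.
Qed.

Lemma elliptic_inequality : s * \int[mu]_(x in Omega) (w x * cutoff (s * v x - M)) <= 0.
Proof.
have [m [S [iS ae]]] := ae_cvg_approximants DC wg app intg.
have [C bC] := flat_coeff_bounded.
have dist0 (z : H) : euclid_norm (z - z) @[n --> \oo] --> (0 : R).
  rewrite subrr (_ : euclid_norm 0 = 0 :> R); first exact: cvg_cst.
  by rewrite -(scale0r (0 : H)) euclid_normZ normr0 mul0r.
have ae_inner b : {ae mu, forall x, Omega x ->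
    (D (m n) x @[n --> \oo] --> v x /\ D (m b) x @[n --> \oo] --> D (m b) x) /\
    [/\ euclid_norm (g x - cgrad (D (m n)) x) @[n --> \oo] --> (0 : R),
        euclid_norm (cgrad (D (m b)) x - cgrad (D (m b)) x) @[n --> \oo] --> (0 : R) &
        forall n, euclid_norm (cgrad (D (m n)) x) `^ p <= S x /\
          euclid_norm (cgrad (D (m b)) x) `^ p <= S x]}.
  apply: ae_imp ae => x h /h [cD cg _ bS]; split; first by split; [exact: cD|exact: cvg_cst].
  by split; [exact: cg|exact: dist0|move=> n; split; exact: bS].
have ae_react b : {ae mu, forall x, Omega x ->
    A (D (m n)) x * (reaction beta q (v x) * B (D (m b)) x) @[n --> \oo] -->
    A v x * (reaction beta q (v x) * B (D (m b)) x)}.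
  apply: ae_imp ae => x h /h [cD _ _ _].
  by apply: cvgM; [exact: flat_cvg cD|exact: cvg_cst].
have ae_bound b : {ae mu, forall x, forall n, Omega x ->
    `|A (D (m n)) x * (reaction beta q (v x) * B (D (m b)) x)| <=
    `|reaction beta q (v x) * B (D (m b)) x|}.
  by apply: aeW => x n _; rewrite normrM ler_piMl// /A ger0_norm ?flat1_ge0 ?flat1_le1.
(* Inner limit: only the first factor moves. The second, a fixed test function, keeps the reaction
   term integrable and serves as its majorant; in the limit the sign of the reaction appears and the
   equation becomes an inequality. *)
have eqb b : s * \int[mu]_(x in Omega) F v (D (m b)) g (cgrad (D (m b))) x <= 0.
  have [_ cl] := @cvg_integral_F (fun n => D (m n)) (fun=> D (m b)) (fun n => cgrad (D (m n)))
    (fun=> cgrad (D (m b))) v (D (m b)) g (cgrad (D (m b))) S (fun n => mD (m n)) (fun=> mD (m b))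
    (fun n j => mDg (m n) j) (fun _ j => mDg (m b) j) mv (mD (m b)) mg (fun j => mDg (m b) j) iS
    (ae_inner b).
  have mr : measurable_fun Omega (fun x => reaction beta q (v x) * B (D (m b)) x).
    exact: integrable_measurable (react_integrable (m b)).
  have [ir cr] := @Rintegral_ae_dominated _ _ _ mu Omega mO
    (fun n x => A (D (m n)) x * (reaction beta q (v x) * B (D (m b)) x))
    (fun x => A v x * (reaction beta q (v x) * B (D (m b)) x))
    (fun x => `|reaction beta q (v x) * B (D (m b)) x|)
    (fun n => measurable_funM (flat_meas 1 (mD (m n))) mr) (measurable_funM (flat_meas 1 mv) mr)
    (ae_react b) (integrable_norm (react_integrable (m b))) (ae_bound b).
  have E0 n : \int[mu]_(x in Omega) F (D (m n)) (D (m b)) (cgrad (D (m n))) (cgrad (D (m b))) x =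
      - \int[mu]_(x in Omega) (A (D (m n)) x * (reaction beta q (v x) * B (D (m b)) x)).
    transitivity (- \int[mu]_(x in Omega) (reaction beta q (v x) * cutoff_test (m n) (m b) x)).
      rewrite -equation; apply: eq_Rintegral => x _.
      by rewrite /F /flux_integrand cgrad_test.
    by congr (- _); apply: eq_Rintegral => x _; rewrite /cutoff_test mulrCA.
  have -> : \int[mu]_(x in Omega) F v (D (m b)) g (cgrad (D (m b))) x =
      - \int[mu]_(x in Omega) (A v x * (reaction beta q (v x) * B (D (m b)) x)).
    apply: (cvg_unique (@Rhausdorff R) cl).
    by rewrite (_ : (fun n => _) = fun n => - \int[mu]_(x in Omega) (A (D (m n)) x *
      (reaction beta q (v x) * B (D (m b)) x))); [exact: cvgN|apply/funext].
  rewrite mulrN oppr_le0 -RintegralZl//; apply: Rintegral_ge0 => x _.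
  rewrite (_ : s * _ = s * reaction beta q (v x) * A v x * B (D (m b)) x); last by ring.
  by rewrite mulr_ge0// flat_cutoff_ge0.
(* Outer limit: the reaction term has disappeared from the inequality, so that the second factor may
   now tend to its limit without any control on the reaction. *)
have ae_outer : {ae mu, forall x, Omega x ->
    (v x @[n --> \oo] --> v x /\ D (m n) x @[n --> \oo] --> v x) /\
    [/\ euclid_norm (g x - g x) @[n --> \oo] --> (0 : R),
        euclid_norm (g x - cgrad (D (m n)) x) @[n --> \oo] --> (0 : R) &
        forall n, euclid_norm (g x) `^ p <= S x /\
          euclid_norm (cgrad (D (m n)) x) `^ p <= S x]}.
  apply: ae_imp ae => x h /h [cD cg bg bS]; split; first by split; [exact: cvg_cst|exact: cD].
  by split; [exact: dist0|exact: cg|move=> n; split; [exact: bg|exact: bS]].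
have [iF cF] := @cvg_integral_F (fun=> v) (fun n => D (m n)) (fun=> g) (fun n => cgrad (D (m n)))
  v v g g S (fun=> mv) (fun n => mD (m n)) (fun=> mg) (fun n j => mDg (m n) j) mv mv mg mg iS ae_outer.
have iwh : mu.-integrable Omega (EFin \o (fun x => w x * cutoff (s * v x - M))).
  under eq_fun do rewrite /= mulrC.
  apply: (integrable_boundedM mO _ _ intw (C := C)).
    by have [] := measurable_coeff mv mv.
  by move=> x _; have [] := bC v v x.
(* The middle quantity still contains the flux; it is at most 0 as the limit of the inequalities
   [eqb], and it dominates the left-hand side because the flux has the right sign. *)
apply: (@le_trans _ _ (s * \int[mu]_(x in Omega) F v v g g x)).
  rewrite -!RintegralZl//; apply: le_Rintegral => //.
  - exact: integrable_scale.
  - exact: integrable_scale.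
  move=> x _; rewrite /F /flux_integrand.
  rewrite -scalerDl dotRZr [X in _ <= _ * (_ + X)]mulrCA flux_self// mulrDr lerDl.
  have ss : s * s = 1 by case: s_sign => ->; rewrite ?mulrNN mulr1.
  have E0 (a a' b b' e : R) : s * ((b * (s * a') + a * (s * b')) * e) =
      (s * s) * ((a' * b + a * b') * e) by ring.
  by rewrite E0 ss mul1r mulr_ge0 ?powR_ge0// derive_cutoff_ge0.
have cs : s * \int[mu]_(x in Omega) F v (D (m n)) g (cgrad (D (m n))) x @[n --> \oo] -->
    s * \int[mu]_(x in Omega) F v v g g x.
  by apply: cvgM; [exact: cvg_cst|exact: cF].
by apply: (cvgr_to_le cs); apply: nearW.
Qed.

End elliptic.

(** * The inequality at almost every time *)

Section time_inequality.
Context {R : realType} (G : stratified_group R).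
Local Notation E := 'rV[R]_(topdim G).
Local Notation mu := (@lebesgue_rV R (topdim G)).
Local Notation leb := (@lebesgue_measure R).
Local Notation Z := (measurableTypeR R * E)%type.
Local Notation mu2 := (leb \x mu)%E.
Variables (Omega : set E) (T p beta q : R).
Hypotheses (Omega_open : open Omega) (Omega_bounded : bounded_set Omega) (p_gt1 : 1 < p)
  (q_lt : q < beta + 1).
Variables (u : R -> E -> R) (Du : R -> E -> 'rV[R]_(hdim G)) (u' : R -> E -> R).
Hypotheses (uV : in_V p T Omega u Du u')
  (u_eq : forall phi Dphi phi', in_V p T Omega phi Dphi phi' -> C_L2 T Omega phi ->
  {ae mu2, forall z, cylinder T Omega z -> 0 <= phi z.1 z.2} ->
  mu2.-integrable (cylinder T Omega)
    (EFin \o (fun z => reaction beta q (u z.1 z.2) * phi z.1 z.2)) /\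
  \int[mu2]_(z in cylinder T Omega)
    (u' z.1 z.2 * phi z.1 z.2
     + euclid_norm (Du z.1 z.2) `^ (p - 2) * dotR (Du z.1 z.2) (Dphi z.1 z.2)) =
  - \int[mu2]_(z in cylinder T Omega) (reaction beta q (u z.1 z.2) * phi z.1 z.2)).

Let p_gt0 : 0 < p. Proof. exact: lt_trans ltr01 p_gt1. Qed.

Lemma Cc_flat_comp (P : {poly R}) (s M : R) (f : E -> R) : 0 <= M -> Cc_infty Omega f ->
  Cc_infty Omega (fun x => flat P (s * f x - M)).
Proof.
move=> M0 Cf; apply: (@Cc_infty_comp _ _ _ (fun y : R => flat P (s * y - M))) => //.
  by apply: smooth_real_comp; [exact: smooth_flat|exact: smooth_affine].
by rewrite flat_le0// mulr0 sub0r oppr_le0.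
Qed.

Lemma ae_time_inequality (s M : R) : s = 1 \/ s = -1 -> 1 <= M ->
  {ae leb, forall t, 0 < t < T ->
     s * \int[mu]_(x in Omega) (u' t x * cutoff (s * u t x - M)) <= 0}.
Proof.
move=> s_sign M1; have M0 : 0 <= M by exact: le_trans M1.
have [[_ _ su _] [_ wDu] _ _] := uV.
have [D DC app] := exists_countable_approximants Omega_open p_gt0 su.
have C1 a b : Cc_infty Omega (cutoff_test D s M a b).
  apply: Cc_inftyMr; first exact: Cc_flat_comp.
  by apply: Cc_infty_smooth; exact: Cc_flat_comp.
have C2 b : Cc_infty Omega (cutoff_test1 D s M b) by exact: Cc_flat_comp.
have eq1 := @ae_weak_equation _ _ _ _ _ Omega_open Omega_bounded p_gt1 _ _ _ uV _ _ u_eq.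
(* The equation holds off a null set of times that depends on the test function. The functions used
   here are indexed by pairs of naturals and do not depend on the time, so that one null set serves
   them all. *)
have eqs : {ae leb, forall t, forall ab : nat * nat, 0 < t < T ->
   mu.-integrable Omega (EFin \o (fun x => reaction beta q (u t x) * cutoff_test1 D s M ab.2 x)) /\
   \int[mu]_(x in Omega) (u' t x * cutoff_test D s M ab.1 ab.2 x
     + euclid_norm (Du t x) `^ (p - 2) * dotR (Du t x) (cgrad (cutoff_test D s M ab.1 ab.2) x)) =
  - \int[mu]_(x in Omega) (reaction beta q (u t x) * cutoff_test D s M ab.1 ab.2 x)}.
  apply: ae_forall_countable => -[a b].
  have h1 := eq1 _ (C1 a b) (fun x => mulr_ge0 (flat1_ge0 _) (flat_cutoff_ge0 _)).
  (* The second factor is a test function in its own right; only the integrability clause is taken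
     from it, for use as the majorant in the inner limit. *)
  have h2 := eq1 _ (C2 b) (fun x => flat_cutoff_ge0 _).
  have := ae_and h1 h2; apply: ae_imp => t [k1 k2] ht.
  by split; [exact: (k2 ht).1|exact: (k1 ht).2].
have dt := ae_slice_dt_integrable Omega_open Omega_bounded p_gt1 uV.
have dg := ae_slice_hgrad_integrable Omega_open p_gt1 uV.
have := ae_and eqs (ae_and dt (ae_and dg (ae_and wDu app))).
apply: ae_imp => t [k1 [k2 [k3 [k4 k5]]]] ht.
apply: (@elliptic_inequality _ _ _ _ Omega_open p_gt1 D (u t) (Du t) (u' t) beta q) => //.
- exact: k4.
- by apply: k5 => //; exact: k4.
- exact: k2.
- exact: k3.
- by move=> b; have [] := k1 (0%N, b) ht.
- by move=> a b; have [] := k1 (a, b) ht.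
Qed.

End time_inequality.

(** * A smooth step function *)

Section smooth_step.
Context {R : realType}.

Let a : R := flat 1 1.
Let b : R := flat 1 a.
Let a_gt0 : 0 < a. Proof. exact: flat1_gt0. Qed.
Let b_gt0 : 0 < b. Proof. exact: flat1_gt0. Qed.

(** [flat 1] is composed with itself: as x runs from 0 to 1, the inner argument falls from [a] to 0,
    and [b] normalizes the value at [a]. The result is 0 on the negative half-line and 1 beyond
    1. *)
Definition step (x : R) : R := 1 - b^-1 * flat 1 (a - flat 1 x).

Definition step_derivative (x : R) : R :=
  b^-1 * (flat (flat_derivative 1) (a - flat 1 x) * flat (flat_derivative 1) x).

Lemma step_le0 x : x <= 0 -> step x = 0.
Proof. by move=> x0; rewrite /step (flat_le0 1 x0) subr0 -/b mulVf ?subrr// gt_eqF. Qed.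

Let flat_ge_a x : 1 <= x -> a - flat 1 x <= 0.
Proof. by move=> x1; rewrite subr_le0; exact: flat1_nondecreasing. Qed.

Lemma step_ge1 x : 1 <= x -> step x = 1.
Proof. by move=> x1; rewrite /step (flat_le0 1 (flat_ge_a x1)) mulr0 subr0. Qed.

Lemma step_ge0 x : 0 <= step x.
Proof.
rewrite subr_ge0 mulrC ler_pdivrMr// mul1r.
by apply: flat1_nondecreasing; rewrite gerBl flat1_ge0.
Qed.

Lemma step_le1 x : step x <= 1.
Proof. by rewrite gerBl mulr_ge0 ?flat1_ge0// invr_ge0 ltW. Qed.

Lemma norm_step_sub_le x y : `|step x - step y| <= 2.
Proof.
apply: (le_trans (ler_normB _ _)).
rewrite (ger0_norm (step_ge0 x)) (ger0_norm (step_ge0 y)).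
by rewrite [leRHS]mulr2n; exact: lerD (step_le1 x) (step_le1 y).
Qed.

Lemma smooth_step : smooth step.
Proof.
have sf : smooth (flat (1 : {poly R})) := smooth_flat _.
have affine (c1 c2 : R) (f : R -> R) : smooth f -> smooth (fun x => c1 + c2 * f x).
  move=> sf0; apply: smoothD; first exact: smooth_cst.
  by apply: smoothM => //; exact: smooth_cst.
have -> : step = fun x => 1 + (- b^-1) * flat 1 (a + (-1) * flat 1 x).
  by apply/funext => x; rewrite /step !mulNr mul1r.
have sa : smooth (fun x => a + (-1) * flat 1 x) := affine a (-1) _ sf.
by apply: affine; exact: (@smooth_real_comp _ _ (flat 1)).
Qed.

Lemma derive_step_scaled (k c t : R) :
  'D_1 (fun t : R => step (k * (t - c))) t = k * step_derivative (k * (t - c)).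
Proof.
have D1 (y : R) : is_derive y 1 (fun y : R => a - flat 1 y) (- flat (flat_derivative 1) y).
  have -> : (fun y : R => a - flat 1 y) = cst a - flat 1 by [].
  by apply: is_derive_eq; rewrite sub0r.
have D2 (y : R) := @is_derive1_comp _ (flat 1) (fun y : R => a - flat 1 y) y _ _
  (is_derive_flat 1 (a - flat 1 y)) (D1 y).
have D3 (y : R) : is_derive y 1 step (step_derivative y).
  have -> : step = cst 1 - b^-1 \*: (flat 1 \o (fun y : R => a - flat 1 y)) by [].
  apply: is_derive_eq; rewrite /step_derivative /GRing.scale /=; ring.
have D4 : is_derive t 1 (fun t : R => k * (t - c)) k.
  have -> : (fun t : R => k * (t - c)) = k \*: (id - cst c) by [].
  by apply: is_derive_eq; rewrite subr0 /GRing.scale /= mulr1.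
have D5 := @is_derive1_comp _ step (fun t : R => k * (t - c)) t _ _ (D3 _) D4.
by rewrite (@derive_val _ _ _ _ _ _ _ D5) mulrC.
Qed.

Lemma smooth_step_scaled (k c : R) : smooth (fun t : R => step (k * (t - c))).
Proof.
apply: smooth_real_comp; first exact: smooth_step.
by under eq_fun do rewrite mulrBr -mulrN; exact: smooth_affine.
Qed.

Let flat_derivative1_ge0 (x : R) : 0 <= flat (flat_derivative 1) x.
Proof.
apply: flat_ge0 => y y0.
by rewrite /flat_derivative -polyC1 derivC subr0 !hornerE mulr_ge0 // ltW.
Qed.

Lemma step_derivative_ge0 x : 0 <= step_derivative x.
Proof. by rewrite /step_derivative mulr_ge0 ?invr_ge0 ?(ltW b_gt0)// mulr_ge0. Qed.

Lemma step_derivative_le0 x : x <= 0 -> step_derivative x = 0.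
Proof. by move=> x0; rewrite /step_derivative (flat_le0 (flat_derivative 1) x0) !mulr0. Qed.

Lemma step_derivative_ge1 x : 1 <= x -> step_derivative x = 0.
Proof. by move=> x1; rewrite /step_derivative (flat_le0 _ (flat_ge_a x1)) mul0r mulr0. Qed.

Lemma step_derivative_bounded : exists C, forall x, step_derivative x <= C.
Proof.
have [C C0 hC] := flat_bounded (flat_derivative (1 : {poly R})).
exists (b^-1 * (C * C)) => x; rewrite /step_derivative ler_wpM2l ?invr_ge0 ?(ltW b_gt0)//.
by apply: ler_pM; rewrite ?flat_derivative1_ge0//; apply: le_trans (ler_norm _) (hC _).
Qed.

End smooth_step.

(** * One-sided mollification in time *)

Section mollification.
Context {R : realType}.
Local Notation leb := (@lebesgue_measure R).

(** The time derivative of [step (k (t - c))]: a nonnegative kernel of mass 1 carried by ]c, c +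
    1/k[, to the right of [c]. *)
Definition mollifier (k c t : R) : R := k * step_derivative (k * (t - c)).

Lemma mollifier_ge0 k c t : 0 <= k -> 0 <= mollifier k c t.
Proof. by move=> k0; rewrite mulr_ge0// step_derivative_ge0. Qed.

Lemma mollifier_out (k c t : R) : 0 < k -> ~ (c < t < c + k^-1) -> mollifier k c t = 0.
Proof.
move=> k0 h; rewrite /mollifier; have [tc|ct] := leP t c.
  by rewrite step_derivative_le0 ?mulr0// mulr_ge0_le0 ?subr_le0// ltW.
rewrite step_derivative_ge1 ?mulr0//.
have : c + k^-1 <= t by rewrite leNgt; apply/negP => h'; apply: h; rewrite ct h'.
by rewrite -lerBrDl -(ler_pM2l k0) mulfV ?gt_eqF.
Qed.

Lemma measurable_mollifier (k c : R) : measurable_fun setT (mollifier k c).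
Proof.
apply: continuous_measurable_fun; apply: smooth_continuous.
have -> : mollifier k c = 'D_1 (fun t : R => step (k * (t - c))).
  by apply/funext => t; rewrite derive_step_scaled.
exact/smooth_derive/smooth_step_scaled.
Qed.

Lemma mollifier_bounded (k c : R) : 0 <= k -> exists C, forall t, `|mollifier k c t| <= C.
Proof.
move=> k0; have [C hC] := @step_derivative_bounded R.
exists (k * C) => t; rewrite ger0_norm ?mollifier_ge0//.
by rewrite ler_wpM2l.
Qed.

Lemma integral_mollifier (k c T : R) : 0 < k -> 0 < c -> c + k^-1 < T ->
  \int[leb]_(t in `]0, T[) mollifier k c t = 1.
Proof.
move=> k0 c0 cT; have kV : 0 < k^-1 by rewrite invr_gt0.
have T0 : 0 < T by rewrite (lt_trans _ cT)// addr_gt0.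
pose F (t : R) := step (k * (t - c)).
have sF : smooth F by exact: smooth_step_scaled.
have dF (t : R) : mollifier k c t = 'D_1 F t by rewrite derive_step_scaled.
transitivity (\int[leb]_(t in `[0, T]) mollifier k c t).
  apply: Rintegral_support => //; first by move=> t /=; rewrite !in_itv /= => /andP[/ltW -> /ltW ->].
  move=> t _; rewrite /= in_itv /= => /negP h; apply: mollifier_out => // /andP[h1 h2].
  by move/negP : h; rewrite (lt_trans c0 h1) (lt_trans h2 cT).
rewrite /Rintegral (@continuous_FTC2 _ (mollifier k c) F _ _ T0).
- rewrite /F (step_ge1 (x := k * (T - c))); last first.
    by rewrite -(ler_pM2l kV) mulKf ?gt_eqF// mulr1 lerBrDl ltW.
  by rewrite (step_le0 (x := k * (0 - c))) ?sube0// sub0r mulrN oppr_le0 mulr_ge0// ltW.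
- apply: continuous_subspaceT.
  rewrite (_ : mollifier k c = 'D_1 F); last exact/funext.
  exact/smooth_continuous/smooth_derive.
- split; first by move=> t _; exact: smooth_derivable.
  + by apply: cvg_at_right_filter; exact: smooth_continuous.
  + by apply: cvg_at_left_filter; exact: smooth_continuous.
- by move=> t _; rewrite derive1E dF.
Qed.

Lemma cvg_mollification (U : R -> R) (c T : R) (k_ : nat -> R) :
  0 < c -> (forall n, 0 < k_ n) -> (forall n, c + (k_ n)^-1 < T) ->
  (k_ n)^-1 @[n --> \oo] --> (0 : R) ->
  leb.-integrable `]0, T[ (EFin \o U) ->
  (forall e, 0 < e -> exists2 d, 0 < d & forall t, 0 < t < T -> `|t - c| < d -> `|U t - U c| < e) ->
  \int[leb]_(t in `]0, T[) (mollifier (k_ n) c t * U t) @[n --> \oo] --> U c.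
Proof.
move=> c0 k0 kT kcv intU cU; apply/cvgrPdist_le => e e0.
have [d d0 hd] := cU _ e0.
move/cvgrPdist_lt : kcv => /(_ _ d0); apply: filterS => n.
rewrite sub0r normrN gtr0_norm ?invr_gt0// => nd.
have mI : measurable (`]0, T[%classic : set (measurableTypeR R)) by exact: measurable_itv.
have [C hC] := mollifier_bounded c (ltW (k0 n)).
have mm : measurable_fun `]0, T[ (mollifier (k_ n) c).
  by apply: measurable_funTS; exact: measurable_mollifier.
have im : leb.-integrable `]0, T[ (EFin \o mollifier (k_ n) c).
  apply: (bounded_measurable_integrable (C := C)) => //.
  exact: lebesgue_interval_lty.
have imU : leb.-integrable `]0, T[ (EFin \o (fun t => mollifier (k_ n) c t * U t)).
  exact: (integrable_boundedM mI mm (fun t _ => hC t) intU).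
have imc : leb.-integrable `]0, T[ (EFin \o (fun t => U c * mollifier (k_ n) c t)).
  exact: integrable_scale.
have -> : U c = \int[leb]_(t in `]0, T[) (U c * mollifier (k_ n) c t).
  by rewrite RintegralZl// integral_mollifier ?mulr1.
rewrite distrC -RintegralB//.
have idiff : leb.-integrable `]0, T[
    (EFin \o (fun t => mollifier (k_ n) c t * U t - U c * mollifier (k_ n) c t)).
  by have := integrableB mI imU imc; congr integrable.
apply: (le_trans (le_normr_Rintegral mI idiff)).
apply: (@le_trans _ _ (\int[leb]_(t in `]0, T[) (e * mollifier (k_ n) c t))).
  apply: le_Rintegral => //; [exact: integrable_norm idiff|exact: integrable_scale|].
  move=> t /=; rewrite in_itv /= => ht.
  rewrite (mulrC (U c)) -mulrBr normrM mulrC (ger0_norm (mollifier_ge0 _ _ (ltW (k0 n)))).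
  have [h|h] := pselect (c < t < c + (k_ n)^-1); last by rewrite mollifier_out ?mulr0.
  rewrite ler_wpM2r ?mollifier_ge0 ?ltW//; apply: hd => //.
  have /andP[h1 h2] := h; rewrite gtr0_norm ?subr_gt0// ltrBlDl.
  by rewrite (lt_trans h2)// ltrD2l.
by rewrite RintegralZl// integral_mollifier ?mulr1.
Qed.

End mollification.

(** * Continuity in time with values in L^1 *)

Section continuity_L1.
Context {R : realType} (G : stratified_group R).
Local Notation E := 'rV[R]_(topdim G).
Local Notation mu := (@lebesgue_rV R (topdim G)).
Variables (Omega : set E) (T : R).
Hypotheses (Omega_open : open Omega) (Omega_bounded : bounded_set Omega).

Let mO : measurable Omega. Proof. exact: open_measurable_rV. Qed.

Variable (u : R -> E -> R).
Hypothesis uC : C_L2 T Omega u.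

Lemma Lp2_integrable (f : E -> R) : Lp 2%:E Omega f -> mu.-integrable Omega (EFin \o f).
Proof.
have two0 : (0 : R) < 2 by [].
move=> /(LpP Omega_open _ two0)[mf foo].
apply: (@le_integrable_real _ _ _ _ _ _ (fun x => 1 + `|f x| `^ 2)) => //.
  by move=> x _; apply: le_1DpowR => //; rewrite ler1n.
apply: integrable_add => //; first by apply: integrable_cst_real => //; exact: lebesgue_domain_lty.
apply: integrable_lty => //.
by apply: measurable_powR_comp; exact: measurableT_comp.
Qed.

Lemma C_L2_integrable t : 0 <= t <= T -> mu.-integrable Omega (EFin \o u t).
Proof. by move=> ht; apply: Lp2_integrable; have [h _] := uC; exact: h. Qed.

(** Hoelder's inequality is replaced by the pointwise bound |f| <= eta + |f|^2 / eta, integrated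
    over a domain of finite measure. *)
Lemma C_L2_cvg_L1 (t e : R) : 0 <= t <= T -> 0 < e -> exists2 d, 0 < d &
  forall s, 0 <= s <= T -> `|s - t| < d -> \int[mu]_(x in Omega) `|u s x - u t x| < e.
Proof.
move=> ht e0; have [_ /(_ t ht) cvN] := uC.
pose m := fine (mu Omega).
have mE : mu Omega = m%:E by rewrite fineK// ge0_fin_numE// lebesgue_domain_lty.
have m0 : 0 <= m by exact: fine_ge0.
(* The pointwise bound integrates to at most eta (m + 1), with m the measure of [Omega]; dividing by
   m + 2 leaves the inequality strict. *)
pose eta := e / (m + 2).
have eta0 : 0 < eta by rewrite divr_gt0// ltr_wpDl.
have : \forall s \near within `[0, T]%classic (nbhs t),
    ('N[mu]_2%:E [EFin \o ((fun x => u s x - u t x)%R \_ Omega)] < eta%:E)%E.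
  have : nbhs 0%E [set y : \bar R | (y < eta%:E)%E].
    by apply: open_nbhs_nbhs; split; [exact: open_ereal_lt_ereal|rewrite /= lte_fin].
  exact: cvN.
rewrite near_withinE => /nbhs_ballP[d /= d0 hd].
exists d => // s hs st.
have hN : ('N[mu]_2%:E [EFin \o ((fun x => u s x - u t x)%R \_ Omega)] < eta%:E)%E.
  apply: hd; first by rewrite /ball /= distrC.
  by rewrite /= in_itv.
have iu := C_L2_integrable ht; have is' := C_L2_integrable hs.
have mf : measurable_fun Omega (fun x => u s x - u t x).
  exact: measurable_funB (integrable_measurable is') (integrable_measurable iu).
pose f x := u s x - u t x.
have hI : (\int[mu]_(x in Omega) (`|f x| `^ 2)%:E < (eta `^ 2)%:E)%E.
  rewrite ltNge; apply/negP => h.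
  have : (eta%:E <= 'N[mu]_2%:E [EFin \o (f \_ Omega)])%E.
    rewrite LnormE//.
    have -> : eta%:E = ((eta `^ 2)%:E `^ 2^-1)%E.
      by rewrite poweR_EFin -powRrM mulfV// powRr1// ltW.
    apply: gt0_ler_poweR => //.
    - by rewrite in_itv /= lee_fin powR_ge0 leey.
    - by rewrite in_itv /= leey andbT; apply: integral_ge0 => x _; rewrite lee_fin powR_ge0.
  by rewrite leNgt hN.
have i2 : mu.-integrable Omega (EFin \o (fun x => `|f x| `^ 2)).
  apply: integrable_lty => //.
  - by apply: measurable_powR_comp; exact: measurableT_comp.
  - by apply: lt_trans hI _; rewrite ltry.
have i1 : mu.-integrable Omega (EFin \o f).
  by have := integrableB mO is' iu; congr integrable.
apply: (@le_lt_trans _ _ (\int[mu]_(x in Omega) (eta + eta^-1 * `|f x| `^ 2))).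
  apply: le_Rintegral => //.
  - exact: integrable_norm i1.
  - apply: integrable_add => //; last exact: integrable_scale.
    by apply: integrable_cst_real => //; exact: lebesgue_domain_lty.
  move=> x _; rewrite -/(f x) (powR_mulrn 2 (normr_ge0 (f x))).
  have [h|h] := leP `|f x| eta; first by rewrite (le_trans h)// lerDl mulr_ge0// invr_ge0 ltW.
  rewrite -[leLHS]add0r lerD ?(ltW eta0)// expr2 mulrA ler_peMl//.
  by rewrite mulrC ler_pdivlMr// mul1r ltW.
rewrite RintegralD//; last 2 first.
- by apply: integrable_cst_real => //; exact: lebesgue_domain_lty.
- exact: integrable_scale.
have -> : \int[mu]_(x in Omega) eta = eta * m by rewrite Rintegral_cst.
rewrite RintegralZl//.
have : eta^-1 * \int[mu]_(x in Omega) (`|f x| `^ 2) <= eta.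
  rewrite ler_pdivrMl// -expr2 -(powR_mulrn 2 (ltW eta0)) -lee_fin fineK; first exact: ltW hI.
  exact: integrable_fin_num i2.
move=> hh; apply: (@le_lt_trans _ _ (eta * m + eta)); first by rewrite lerD2l.
have -> : eta * m + eta = e * (m + 1) / (m + 2) by rewrite /eta; ring.
by rewrite ltr_pdivrMr ?ltr_wpDl// ltr_pM2l// ltrD2l ltr1n.
Qed.

End continuity_L1.

(** * Increments of u as time integrals of its weak derivative *)

Section time_increment.
Context {R : realType} (G : stratified_group R).
Local Notation E := 'rV[R]_(topdim G).
Local Notation mu := (@lebesgue_rV R (topdim G)).
Local Notation leb := (@lebesgue_measure R).
Local Notation Z := (measurableTypeR R * E)%type.
Local Notation mu2 := (leb \x mu)%E.
Variables (Omega : set E) (T p : R).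
Hypotheses (Omega_open : open Omega) (Omega_bounded : bounded_set Omega) (p_gt1 : 1 < p).

Let mO : measurable Omega. Proof. exact: open_measurable_rV. Qed.
Let mI : measurable (`]0, T[ : set (measurableTypeR R)). Proof. exact: measurable_itv. Qed.
Let mC : measurable (cylinder T Omega). Proof. exact: measurable_cylinder. Qed.

Variables (u : R -> E -> R) (Du : R -> E -> 'rV[R]_(hdim G)) (u' : R -> E -> R).
Hypotheses (uV : in_V p T Omega u Du u') (uC : C_L2 T Omega u).

Variables (s t : R).
Hypotheses (s_gt0 : 0 < s) (st : s < t) (tT : t < T).

Let mst : measurable (`]s, t] : set (measurableTypeR R)). Proof. exact: measurable_itv. Qed.

Let sub_cylinder : `]s, t]%classic `*` Omega `<=` cylinder T Omega.
Proof.
move=> [a x] /= [ha Ox]; split => //; move: ha; rewrite /= !in_itv /= => /andP[h1 h2].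
by rewrite (lt_trans s_gt0 h1) (le_lt_trans h2 tT).
Qed.

Lemma slab_dt_integrable : mu2.-integrable (`]s, t] `*` Omega) (EFin \o (fun z => u' z.1 z.2)).
Proof.
have h := in_V_dt_integrable Omega_open Omega_bounded p_gt1 uV.
exact: (integrableS mC (measurableX mst mO) sub_cylinder h).
Qed.

Section test.
Variable psi : E -> R.
Hypotheses (Cpsi : Cc_infty Omega psi).

Let mpsi : measurable_fun Omega psi.
Proof. exact: weak_hgrad_measurable_fun (cgrad_weak_hgrad Omega_open Cpsi). Qed.

Let mpsi2 : measurable_fun (cylinder T Omega) (fun z : Z => psi z.2).
Proof. exact: measurable_cylinder_snd. Qed.

Let U (a : measurableTypeR R) : R := \int[mu]_(x in Omega) (u a x * psi x).
Let W (a : measurableTypeR R) : R := \int[mu]_(x in Omega) (u' a x * psi x).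

Let upsi : mu2.-integrable (cylinder T Omega) (EFin \o (fun z : Z => u z.1 z.2 * psi z.2)).
Proof.
have [C _ hC] := Cc_bounded Cpsi.
under eq_fun do rewrite /= mulrC.
exact: (integrable_boundedM mC mpsi2 (fun z _ => hC z.2) (in_V_integrable Omega_open Omega_bounded p_gt1 uV)).
Qed.

Let u'psi : mu2.-integrable (cylinder T Omega) (EFin \o (fun z : Z => u' z.1 z.2 * psi z.2)).
Proof.
have [C _ hC] := Cc_bounded Cpsi.
under eq_fun do rewrite /= mulrC.
exact: (integrable_boundedM mC mpsi2 (fun z _ => hC z.2) (in_V_dt_integrable Omega_open Omega_bounded p_gt1 uV)).
Qed.

Let slice_psi (f : E -> R) : mu.-integrable Omega (EFin \o f) ->
  mu.-integrable Omega (EFin \o (fun x => f x * psi x)).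
Proof.
have [C _ hC] := Cc_bounded Cpsi => hf.
under eq_fun do rewrite /= mulrC.
exact: (integrable_boundedM mO mpsi (fun x _ => hC x) hf).
Qed.

Let U_continuous (c e : R) : 0 < c < T -> 0 < e ->
  exists2 d, 0 < d & forall a, 0 < a < T -> `|a - c| < d -> `|U a - U c| < e.
Proof.
move=> /andP[c0 cT] e0; have [C C0 hC] := Cc_bounded Cpsi.
have hc : 0 <= c <= T by rewrite !ltW.
have C1 : 0 < C + 1 by rewrite ltr_wpDl.
have [d d0 hd] := C_L2_cvg_L1 Omega_open Omega_bounded uC hc (divr_gt0 e0 C1).
exists d => // a /andP[a0 aT] ac; have ha : 0 <= a <= T by rewrite !ltW.
have ia := C_L2_integrable Omega_open Omega_bounded uC ha.
have ic := C_L2_integrable Omega_open Omega_bounded uC hc.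
have iac : mu.-integrable Omega (EFin \o (fun x => u a x - u c x)).
  by have := integrableB mO ia ic; congr integrable.
have -> : U a - U c = \int[mu]_(x in Omega) ((u a x - u c x) * psi x).
  rewrite /U -(RintegralB mO (slice_psi ia) (slice_psi ic)).
  by apply: eq_Rintegral => x _; rewrite mulrBl.
apply: (le_lt_trans (le_normr_Rintegral mO (slice_psi iac))).
apply: (@le_lt_trans _ _ (C * \int[mu]_(x in Omega) `|u a x - u c x|)).
  rewrite -RintegralZl//; last exact: integrable_norm iac.
  apply: le_Rintegral => //.
  - exact: integrable_norm (slice_psi iac).
  - by apply: integrable_scale => //; exact: integrable_norm iac.
  by move=> x _; rewrite normrM mulrC ler_wpM2r.
have I0 : 0 <= \int[mu]_(x in Omega) `|u a x - u c x| by exact: Rintegral_ge0.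
apply: (@le_lt_trans _ _ ((C + 1) * \int[mu]_(x in Omega) `|u a x - u c x|)).
  by rewrite ler_wpM2r// lerDl.
by rewrite mulrC -ltr_pdivlMr//; exact: hd.
Qed.

(** The weak derivative is tested with a smooth plateau in time that rises just after [s] and falls
    just after [t], times [psi]. The condition on [k] keeps its support inside the open cylinder. *)
Let weight (k : R) : 0 < k -> t + k^-1 < T ->
  \int[leb]_(a in `]0, T[) ((mollifier k s a - mollifier k t a) * U a) =
  - \int[leb]_(a in `]0, T[) ((step (k * (a - s)) - step (k * (a - t))) * W a).
Proof.
move=> k0 kT; have [_ _ _ dtu] := uV.
pose eta (a : R) := step (k * (a - s)) - step (k * (a - t)).
have seta : smooth eta.
  have -> : eta = fun a => step (k * (a - s)) + (-1) * step (k * (a - t)).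
    by apply/funext => a; rewrite mulN1r.
  apply: smoothD; first exact: smooth_step_scaled.
  by apply: smoothM; [exact: smooth_cst|exact: smooth_step_scaled].
have deta (a : R) : 'D_1 eta a = mollifier k s a - mollifier k t a.
  have -> : eta = (fun a => step (k * (a - s))) - (fun a => step (k * (a - t))) by [].
  rewrite deriveB; [|exact/smooth_derivable/smooth_step_scaled..].
  by rewrite !derive_step_scaled.
have eta_out (a : R) : ~ (s <= a <= t + k^-1) -> eta a = 0.
  move=> h; rewrite /eta; have [as_|sa] := ltP a s.
    by rewrite !step_le0 ?subrr// mulr_ge0_le0 ?ltW// ?subr_lt0// (lt_trans as_).
  have ta : t + k^-1 < a by rewrite ltNge; apply/negP => h'; apply: h; rewrite sa h'.
  have big (c : R) : c <= t -> 1 <= k * (a - c).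
    move=> ct; rewrite -ler_pdivrMl// mulr1 lerBrDl (le_trans _ (ltW ta))// lerD2r//.
  by rewrite !step_ge1 ?subrr//; apply: big => //; exact: ltW.
pose phi (z : R * E) := eta z.1 * psi z.2.
have Cphi : Cc_infty (cylinder T Omega : set (R * E)) phi.
  pose K : set (R * E) := `[s, t + k^-1]%classic `*` support_closure psi.
  have [spsi cpsi subpsi] := Cpsi.
  have cK : compact K by apply: compact_setX => //; exact: segment_compact.
  apply: (Cc_infty_of_compact (K := K)).
  - by apply: smoothM; [exact: smooth_fst|exact: smooth_snd].
  - exact: cK.
  - by apply: compact_closed cK; exact: norm_hausdorff.
  - move=> [a x] [/= ha hx]; split; last exact: subpsi.
    move: ha; rewrite /= !in_itv /= => /andP[h1 h2].
    by rewrite (lt_le_trans s_gt0 h1) (le_lt_trans h2 kT).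
  - move=> [a x] nK; rewrite /phi /=; have [h|h] := pselect (s <= a <= t + k^-1).
      rewrite (@Cc_infty_eq0 _ _ psi) ?mulr0// => hx; apply: nK; split => //=.
    by rewrite eta_out ?mul0r.
have dphi (z : R * E) : 'D_(1, 0) phi z = (mollifier k s z.1 - mollifier k t z.1) * psi z.2.
  pose e (z : R * E) := eta z.1; pose f (z : R * E) := psi z.2.
  have se : smooth e by exact: smooth_fst.
  have sf : smooth f by apply: smooth_snd; exact: Cc_infty_smooth Cpsi.
  have -> : phi = e \* f by [].
  rewrite deriveM; [|exact: smooth_derivable..].
  rewrite (@derive_affine _ _ _ _ (fst : R * E -> R) eta z (1, 0) 1)//.
  rewrite (@derive_affine _ _ _ _ (snd : R * E -> E) psi z (1, 0) 0) ?derive0//.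
  by rewrite scaler0 add0r deta mulrC.
have Ceta : exists C, forall a, `|mollifier k s a - mollifier k t a| <= C.
  have [C1 h1] := mollifier_bounded s (ltW k0); have [C2 h2] := mollifier_bounded t (ltW k0).
  exists (C1 + C2) => a; rewrite (le_trans (ler_normB _ _))// lerD//.
have [C hC] := Ceta.
have mmol : measurable_fun setT (fun a => mollifier k s a - mollifier k t a).
  by apply: measurable_funB; exact: measurable_mollifier.
have meta : measurable_fun setT eta.
  by apply: continuous_measurable_fun; exact: smooth_continuous.
have eta1 a : `|eta a| <= 2 by exact: norm_step_sub_le.
rewrite -(fubini_time_weight Omega_open mmol hC upsi) -(fubini_time_weight Omega_open meta eta1 u'psi).
transitivity (\int[mu2]_(z in cylinder T Omega) (u z.1 z.2 * 'D_(1, 0) phi z)).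
  by apply: eq_Rintegral => z _; rewrite dphi mulrCA.
rewrite dtu//; congr (- _); apply: eq_Rintegral => z _.
by rewrite /phi mulrCA.
Qed.

(** As the plateau sharpens, the left-hand side of [weight] tends to the difference of the values of
    U at [s] and [t], by continuity in time, and the plateau tends to the indicator of ]s, t]. *)
Lemma increment_test : U t - U s = \int[leb]_(a in `]s, t]) W a.
Proof.
have Tt : 0 < T - t by rewrite subr_gt0.
(* The sharpness k is shifted by N, so that every plateau, and not only those far in the sequence,
   ends before T. *)
have [N hN] : exists N : nat, N.+1%:R^-1 < T - t.
  near \oo => N; exists N; near: N.
  exact: (near_infty_natSinv_lt (PosNum Tt)).
pose k_ (n : nat) : R := (n + N).+1%:R.
have k0 n : 0 < k_ n by exact: ltr0Sn.
have kN n : (k_ n)^-1 <= N.+1%:R^-1.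
  by rewrite lef_pV2 ?posrE ?ltr0Sn// ler_nat ltnS leq_addl.
have kT n : t + (k_ n)^-1 < T by rewrite -ltrBrDl (le_lt_trans (kN n)).
have ksT n : s + (k_ n)^-1 < T by rewrite (lt_trans _ (kT n))// ltrD2r.
have kcv : (k_ n)^-1 @[n --> \oo] --> (0 : R).
  have := @cvg_harmonic R; rewrite -(cvg_shiftn N); exact.
have t0 : 0 < t by exact: lt_trans st.
have sT : s < T by exact: lt_trans tT.
have hs : 0 < s < T by rewrite s_gt0 sT.
have ht : 0 < t < T by rewrite t0 tT.
have iU : leb.-integrable `]0, T[ (EFin \o U) := fubini_rectangle_integrable mI mO upsi.
have iW : leb.-integrable `]0, T[ (EFin \o W) := fubini_rectangle_integrable mI mO u'psi.
have molU (c : R) (k : R) : 0 < k -> leb.-integrable `]0, T[ (EFin \o (fun a => mollifier k c a * U a)).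
  move=> kp; have [C hC] := mollifier_bounded c (ltW kp).
  apply: (integrable_boundedM mI _ (fun a _ => hC a) iU).
  by apply: measurable_funTS; exact: measurable_mollifier.
have Uc (c : R) : 0 < c < T -> forall e, 0 < e -> exists2 d, 0 < d &
    forall a, 0 < a < T -> `|a - c| < d -> `|U a - U c| < e.
  by move=> hc e e0; exact: U_continuous.
have L : \int[leb]_(a in `]0, T[) ((mollifier (k_ n) s a - mollifier (k_ n) t a) * U a)
    @[n --> \oo] --> U s - U t.
  rewrite (_ : (fun n => _) = fun n => \int[leb]_(a in `]0, T[) (mollifier (k_ n) s a * U a) -
      \int[leb]_(a in `]0, T[) (mollifier (k_ n) t a * U a)); last first.
    apply/funext => n; rewrite -RintegralB//; [|exact: molU..].
    by apply: eq_Rintegral => a _; rewrite mulrBl.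
  apply: cvgB; first exact: (cvg_mollification s_gt0 k0 ksT kcv iU (Uc s hs)).
  exact: (cvg_mollification t0 k0 kT kcv iU (Uc t ht)).
have Rl : (- \int[leb]_(a in `]0, T[) ((step (k_ n * (a - s)) - step (k_ n * (a - t))) * W a))
    @[n --> \oo] --> - \int[leb]_(a in `]0, T[) (\1_(`]s, t] : set R) a * W a).
  apply: cvgN; apply: (Rintegral_dominated (g := fun a : measurableTypeR R => 2 * `|W a|)) => //.
  - move=> n; apply: measurable_funM; last exact: integrable_measurable iW.
    apply: measurable_funTS; apply: measurable_funB;
      by apply: continuous_measurable_fun; apply: smooth_continuous; exact: smooth_step_scaled.
  - move=> a _; apply: cvgM; last exact: cvg_cst.
    (* For fixed [a] the sequence is eventually constant; since [step] is 0 at the origin, the limit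
       is the indicator of a < c reversed, open at [c], which makes the limiting interval open at
       [s] and closed at [t]. *)
    have step_cvg (c : R) : step (k_ n * (a - c)) @[n --> \oo] --> ((c < a)%R%:R : R).
      have [ca|ac] := ltP c a; last first.
        under eq_fun do rewrite step_le0 ?mulr_ge0_le0 ?subr_le0 ?(ltW (k0 _))//.
        exact: cvg_cst.
      apply: (cvg_near_cst (1 : R)).
      have ac0 : 0 < a - c by rewrite subr_gt0.
      move/cvgrPdist_lt : kcv => /(_ _ ac0); apply: filterS => n.
      rewrite sub0r normrN gtr0_norm ?invr_gt0// => /ltW h; rewrite step_ge1//.
      by rewrite -ler_pdivrMl// mulr1.
    have -> : \1_(`]s, t] : set R) a = (s < a)%R%:R - (t < a)%R%:R :> R.
      rewrite indicE; have [sa|as_] := ltP s a.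
        have [ta|at_] := ltP t a; first by rewrite memNset ?subrr//= in_itv /= sa /= leNgt ta.
        by rewrite mem_set ?subr0//= in_itv /= sa.
      rewrite memNset /=; last by rewrite in_itv /= ltNge as_.
      by rewrite ltNge (le_trans as_ (ltW st)) /= subrr.
    by apply: cvgB; exact: step_cvg.
  - by apply: integrable_scale => //; exact: integrable_norm iW.
  - by move=> n a _; rewrite normrM; apply: ler_wpM2r (norm_step_sub_le _ _).
have E0 : U s - U t = - \int[leb]_(a in `]0, T[) (\1_(`]s, t] : set R) a * W a).
  apply: (cvg_unique (@Rhausdorff R) L).
  by rewrite (_ : (fun n => _) = fun n => - \int[leb]_(a in `]0, T[)
    ((step (k_ n * (a - s)) - step (k_ n * (a - t))) * W a)) //; apply/funext => n; exact: weight.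
rewrite -opprB E0 opprK.
have <- : \int[leb]_(a in `]s, t]) (\1_(`]s, t] : set R) a * W a) =
    \int[leb]_(a in `]0, T[) (\1_(`]s, t] : set R) a * W a).
  apply: Rintegral_support => //.
  - by move=> a /=; rewrite !in_itv /= => /andP[h1 h2]; rewrite (lt_trans s_gt0 h1) (le_lt_trans h2 tT).
  - by move=> a _ na; rewrite indicE memNset// mul0r.
by apply: eq_Rintegral => a ha; rewrite indicE ha mul1r.
Unshelve. all: by end_near.
Qed.

End test.

(** By Fubini the two sides have the same integral against each [psi], and the fundamental lemma
    applies. The null set of points depends on [s] and [t], which is harmless because only finitely
    many times are compared at once. *)
Lemma time_increment : {ae mu, forall x, Omega x ->
  u t x - u s x = \int[leb]_(a in `]s, t]) u' a x}.
Proof.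
have t0 : 0 < t by exact: lt_trans st.
have sT : s < T by exact: lt_trans tT.
have it : mu.-integrable Omega (EFin \o u t).
  by apply: (C_L2_integrable Omega_open Omega_bounded uC); rewrite !ltW.
have is' : mu.-integrable Omega (EFin \o u s).
  by apply: (C_L2_integrable Omega_open Omega_bounded uC); rewrite !ltW.
pose V (x : E) : R := \int[leb]_(a in `]s, t]) u' a x.
have iV : mu.-integrable Omega (EFin \o V) := fubini_rectangle_integrable2 mst mO slab_dt_integrable.
have idiff : mu.-integrable Omega (EFin \o (fun x => u t x - u s x)).
  by have := integrableB mO it is'; congr integrable.
have iF : mu.-integrable Omega (EFin \o (fun x => u t x - u s x - V x)).
  by have := integrableB mO idiff iV; congr integrable.
suff : {ae mu, forall x, Omega x -> u t x - u s x - V x = 0}.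
  by apply: ae_imp => x h /h /eqP; rewrite subr_eq0 => /eqP.
apply: (ae_eq0_of_test Omega_open) => [K cK KO|psi Cpsi psi0].
  have mK : measurable K.
    by apply: closed_measurable_rV; apply: compact_closed cK; exact: norm_hausdorff.
  exact: (integrableS mO mK KO iF).
have mpsi : measurable_fun Omega psi.
  exact: weak_hgrad_measurable_fun (cgrad_weak_hgrad Omega_open Cpsi).
have [C _ hC] := Cc_bounded Cpsi.
have slice (f : E -> R) : mu.-integrable Omega (EFin \o f) ->
    mu.-integrable Omega (EFin \o (fun x => f x * psi x)).
  move=> hf; under eq_fun do rewrite /= mulrC.
  exact: (integrable_boundedM mO mpsi (fun x _ => hC x) hf).
have islab : mu2.-integrable (`]s, t] `*` Omega) (EFin \o (fun z : Z => u' z.1 z.2 * psi z.2)).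
  have mp : measurable_fun (`]s, t] `*` Omega) (fun z : Z => psi z.2).
    by apply: measurable_funS sub_cylinder (measurable_cylinder_snd Omega_open mpsi).
  have := integrable_boundedM (measurableX mst mO) mp (fun z _ => hC z.2) slab_dt_integrable.
  by congr integrable; apply/funext => z /=; rewrite mulrC.
have H := increment_test Cpsi.
(* Exchange of the time and space integrals; for almost every x the factor [psi x] leaves the time
   integral. *)
have HV : \int[mu]_(x in Omega) (V x * psi x) =
    \int[leb]_(a in `]s, t]) \int[mu]_(x in Omega) (u' a x * psi x).
  rewrite -(fubini_rectangle mst mO islab) (fubini_rectangle2 mst mO islab).
  rewrite /Rintegral; congr fine; apply: ae_eq_integral => //.
  - by apply/measurable_EFinP; apply: measurable_funM => //; exact: integrable_measurable iV.
  - exact: (measurable_int _ (fubini_rectangle_integrable2 mst mO islab)).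
  have := ae_integrable_slice2 mst mO slab_dt_integrable.
  by apply: ae_imp => x kx /kx{}kx; congr EFin; rewrite /V -RintegralZr.
transitivity (\int[mu]_(x in Omega) (u t x * psi x) - \int[mu]_(x in Omega) (u s x * psi x)
  - \int[mu]_(x in Omega) (V x * psi x)); last by rewrite HV -H subrr.
rewrite -RintegralB//; [|exact: slice it|exact: slice is'].
rewrite -RintegralB//; [|by have := slice _ idiff; congr integrable; apply/funext => x /=; rewrite mulrBl
                        |exact: slice iV].
by apply: eq_Rintegral => x _; rewrite !mulrBl.
Qed.

End time_increment.

(** * Convexity of the potential and monotonicity from local information *)

Section potential.
Context {R : realType}.

Definition potential (x : R) : R := x * flat 1 x ^+ 2.

Lemma potential_le0 x : x <= 0 -> potential x = 0.
Proof. by move=> x0; rewrite /potential (flat_le0 1 x0) expr0n mulr0. Qed.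

Lemma potential_gt0 x : 0 < x -> 0 < potential x.
Proof. by move=> x0; rewrite /potential mulr_gt0// exprn_gt0// flat1_gt0. Qed.

Lemma potential_ge0 x : 0 <= potential x.
Proof.
by have [/potential_le0->|/potential_gt0/ltW] := leP x 0.
Qed.

Global Instance is_derive_potential (x : R) : is_derive x 1 potential (cutoff x).
Proof.
have -> : potential = id \* (flat 1 \* flat (1 : {poly R})) by [].
have H1 := is_derive_flat (1 : {poly R}) x.
apply: is_derive_eq; rewrite /GRing.scale /= /cutoff /flat; case: ifPn => x0; last by rewrite !(mul0r, mulr0, addr0).
rewrite /flat_derivative /cutoff_poly -polyC1 !derivC !hornerE /=.
set e := expR _; by field; rewrite gt_eqF.
Qed.

Lemma cutoff_nondecreasing : {homo (@cutoff R) : x y / x <= y}.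
Proof.
move=> x y xy; have cf : {within `[x, y], continuous (@cutoff R)}.
  apply/continuous_subspaceT => z; apply: differentiable_continuous; apply/derivable1_diffP.
  exact: (@ex_derive _ _ _ _ _ _ _ (is_derive_cutoff z)).
have [z _ E] := @MVT_segment R _ _ x y xy (fun z _ => is_derive_cutoff z) cf.
by rewrite -subr_ge0 E mulr_ge0 ?derive_cutoff_ge0// subr_ge0.
Qed.

(** The mean value theorem together with the monotonicity of [cutoff]. The tangent is taken at [y],
    to be the later of two times, so that the increment is bounded above. *)
Lemma potential_convex (x y : R) : potential y - potential x <= cutoff y * (y - x).
Proof.
have mvt (a b : R) : a <= b -> exists2 c, a <= c <= b & potential b - potential a = cutoff c * (b - a).
  move=> ab; have cf : {within `[a, b], continuous potential}.
    apply/continuous_subspaceT => z; apply: differentiable_continuous; apply/derivable1_diffP.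
    exact: ex_derive.
  have [c hc E] := @MVT_segment R _ _ a b ab (fun z _ => is_derive_potential z) cf.
  by exists c => //; move: hc; rewrite in_itv.
have [xy|/ltW yx] := leP x y.
  have [c /andP[_ cy] ->] := mvt _ _ xy.
  by rewrite ler_wpM2r ?subr_ge0// cutoff_nondecreasing.
have [c /andP[yc _] E] := mvt _ _ yx.
rewrite -(opprB (potential x)) E -mulrN opprB ler_wnM2r ?subr_le0//.
exact: cutoff_nondecreasing.
Qed.

Lemma cutoff_bounded : exists2 C : R, 0 <= C & forall x : R, `|cutoff x| <= C.
Proof.
have [C C0 hC] := flat_bounded (cutoff_poly : {poly R}).
exists C => // x; rewrite /cutoff normrM -[leRHS]mul1r ler_pM//.
by rewrite ger0_norm ?flat1_ge0 ?flat1_le1.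
Qed.

Lemma cutoff_lipschitz : exists2 L : R, 0 <= L & forall x y : R, `|cutoff x - cutoff y| <= L * `|x - y|.
Proof.
have [C1 C10 h1] := flat_bounded (flat_derivative (1 : {poly R})).
have [C2 C20 h2] := flat_bounded (cutoff_poly : {poly R}).
have [C3 C30 h3] := flat_bounded (flat_derivative (cutoff_poly : {poly R})).
exists (C1 * C2 + C3); first by rewrite addr_ge0 ?mulr_ge0.
apply: (lipschitz_of_derive is_derive_cutoff) => x.
rewrite (le_trans (ler_normD _ _))// !normrM lerD ?ler_pM//.
by rewrite -[leRHS]mul1r ler_pM// ger0_norm ?flat1_ge0 ?flat1_le1.
Qed.

(** The supremum of the times t with A t <= A a belongs to that set and cannot lie before [b]. The
    local hypothesis compares pairs of points near t, t itself included, so that no continuity of A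
    is involved. *)
Lemma locally_nonincreasing (A : R -> R) (a b : R) : a <= b ->
  (forall t, a <= t <= b -> exists2 d, 0 < d &
     forall x y, a <= x -> x < y -> y <= b -> `|x - t| < d -> `|y - t| < d -> A y <= A x) ->
  A b <= A a.
Proof.
move=> ab H; pose S := [set t : R | a <= t <= b /\ A t <= A a].
have Sa : S a by split; rewrite ?lexx.
have ubS : ubound S b by move=> t [/andP[_ tb] _].
have hs : has_sup S by split; [exists a|exists b].
pose c := sup S.
have ac : a <= c by apply: ub_le_sup => //; exists b.
have cb : c <= b by apply: ge_sup => //; exists a.
have [d d0 hd] := H c (introT andP (conj ac cb)).
have Sc : A c <= A a.
  have [t St ct] := sup_adherent d0 hs.
  have [/andP[at_ tb] At] := St.
  have tc : t <= c by apply: ub_le_sup => //; exists b.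
  move: tc; rewrite le_eqVlt => /orP[/eqP <-//|tc].
  apply: le_trans At; apply: hd => //; last by rewrite subrr normr0.
  by rewrite distrC gtr0_norm ?subr_gt0// ltrBlDl -ltrBlDr.
have [//|cb'] : c = b \/ c < b by move: cb; rewrite le_eqVlt => /orP[/eqP|]; [left|right].
  by move=> <-.
exfalso; pose t := Num.min b (c + d / 2).
have ct : c < t by rewrite lt_min cb' ltrDl divr_gt0.
have tb : t <= b by rewrite ge_min lexx.
have St : S t.
  split; first by rewrite tb (le_trans ac (ltW ct)).
  apply: le_trans Sc; apply: hd => //; first by rewrite subrr normr0.
  rewrite gtr0_norm ?subr_gt0// ltrBlDl gt_min; apply/orP; right.
  by rewrite ltrD2l ltr_pdivrMr// mulr_natr mulr2n ltrDl.
have : t <= c by apply: ub_le_sup => //; exists b.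
by rewrite leNgt ct.
Qed.

End potential.

Lemma le_of_sub_le (R : realDomainType) (g1 g2 e1 e2 c d : R) :
  g1 - e1 - c <= g2 - e2 -> c <= d -> e1 <= d -> 0 <= e2 -> g1 <= g2 + (d + d).
Proof. lra. Qed.

Lemma le_sub_of_increment (R : realDomainType) (g1 g2 e1 e2 c1 c2 : R) :
  g1 - g2 <= e1 - e2 + c2 -> g1 - e1 - (c1 + c2) <= g2 - e2 - c1.
Proof. lra. Qed.

(** Replacing f by the minimum of f and g changes it on a null set only and makes the inequality
    hold everywhere. *)
Lemma ae_le_Rintegral d (T : measurableType d) {R : realType} (mu : {measure set T -> \bar R})
    (D : set T) (f g : T -> R) : measurable D ->
  mu.-integrable D (EFin \o f) -> mu.-integrable D (EFin \o g) ->
  {ae mu, forall x, D x -> f x <= g x} ->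
  \int[mu]_(x in D) f x <= \int[mu]_(x in D) g x.
Proof.
move=> mD intf intg fg.
have mh : measurable_fun D (fun x => Num.min (f x) (g x)).
  exact: (measurable_minr (integrable_measurable intf) (integrable_measurable intg)).
have ih : mu.-integrable D (EFin \o (fun x => Num.min (f x) (g x))).
  apply: (@le_integrable_real _ _ _ _ _ _ (fun x => `|f x| + `|g x|)) => //.
    by move=> x _; case: (leP (f x) (g x)) => _; rewrite ?lerDl ?lerDr.
  by apply: integrable_add => //; [exact: integrable_norm intf|exact: integrable_norm intg].
have -> : \int[mu]_(x in D) f x = \int[mu]_(x in D) Num.min (f x) (g x).
  rewrite /Rintegral; congr fine; apply: ae_eq_integral => //.
  - exact: (measurable_int _ intf).
  - exact: (measurable_int _ ih).
  by apply: ae_imp fg => x h /h fx; rewrite min_l.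
by apply: le_Rintegral => // x _; rewrite ge_min lexx orbT.
Qed.

(** * The comparison argument in time *)

Section comparison.
Context {R : realType} (G : stratified_group R).
Local Notation E := 'rV[R]_(topdim G).
Local Notation mu := (@lebesgue_rV R (topdim G)).
Local Notation leb := (@lebesgue_measure R).
Local Notation Z := (measurableTypeR R * E)%type.
Local Notation mu2 := (leb \x mu)%E.
Variables (Omega : set E) (T p : R).
Hypotheses (Omega_open : open Omega) (Omega_bounded : bounded_set Omega) (p_gt1 : 1 < p).

Let mO : measurable Omega. Proof. exact: open_measurable_rV. Qed.
Let mI : measurable (`]0, T[ : set (measurableTypeR R)). Proof. exact: measurable_itv. Qed.
Let mC : measurable (cylinder T Omega). Proof. exact: measurable_cylinder. Qed.

Variables (u : R -> E -> R) (Du : R -> E -> 'rV[R]_(hdim G)) (u' : R -> E -> R).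
Hypotheses (uV : in_V p T Omega u Du u') (uC : C_L2 T Omega u).
Variables (s M : R).
Hypotheses (s_norm : `|s| = 1)
  (u_ineq : {ae leb, forall t, 0 < t < T ->
     s * \int[mu]_(x in Omega) (u' t x * cutoff (s * u t x - M)) <= 0}).

Let idt : mu2.-integrable (cylinder T Omega) (EFin \o (fun z : Z => u' z.1 z.2)).
Proof. exact: (in_V_dt_integrable Omega_open Omega_bounded p_gt1 uV). Qed.

Let iu t : 0 <= t <= T -> mu.-integrable Omega (EFin \o u t).
Proof. exact: (C_L2_integrable Omega_open Omega_bounded uC). Qed.

Let excess t (x : E) : R := potential (s * u t x - M).
Let Gamma t : R := \int[mu]_(x in Omega) excess t x.

(* |u'| <= K + tail K, and the integral of tail K tends to 0 as K grows. *)
Let tail (K : R) (z : Z) : R := Num.max (`|u' z.1 z.2| - K) 0.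
Let rho (K : R) (t : measurableTypeR R) : R := \int[mu]_(x in Omega) tail K (t, x).

Let measurable_real_comp (h : R -> R) (f : E -> R) : continuous h -> measurable_fun Omega f ->
  measurable_fun Omega (fun x => h (f x)).
Proof.
by move=> ch mf; apply: (measurableT_comp (f := h)) => //; exact: continuous_measurable_fun.
Qed.

Let continuous_potential : continuous (@potential R).
Proof.
move=> z; apply: differentiable_continuous; apply/derivable1_diffP; exact: ex_derive.
Qed.

Let continuous_cutoff : continuous (@cutoff R).
Proof.
move=> z; apply: differentiable_continuous; apply/derivable1_diffP.
exact: (@ex_derive _ _ _ _ _ _ _ (is_derive_cutoff z)).
Qed.

Let measurable_excess_arg t : 0 <= t <= T -> measurable_fun Omega (fun x => s * u t x - M).
Proof.
move=> ht; apply: measurable_funB => //; apply: measurable_funM => //.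
exact: integrable_measurable (iu ht).
Qed.

Let cutoff_arg_lipschitz (L : R) (t t' : R) x :
  (forall a b : R, `|cutoff a - cutoff b| <= L * `|a - b|) ->
  `|cutoff (s * u t x - M) - cutoff (s * u t' x - M)| <= L * `|u t x - u t' x|.
Proof.
move=> h; apply: le_trans (h _ _) _.
by rewrite (_ : _ - _ - _ = s * (u t x - u t' x)) ?normrM ?s_norm ?mul1r//; ring.
Qed.

Let potential_lipschitz (C : R) : (forall x : R, `|cutoff x| <= C) ->
  forall a b : R, `|potential a - potential b| <= C * `|a - b|.
Proof. by move=> hC; apply: (lipschitz_of_derive (@is_derive_potential R)). Qed.

Let iexcess t : 0 <= t <= T -> mu.-integrable Omega (EFin \o excess t).
Proof.
move=> ht; have [C C0 hC] := @cutoff_bounded R.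
apply: (@le_integrable_real _ _ _ _ _ _ (fun x => C * (`|u t x| + `|M|))) => //.
- exact: measurable_real_comp continuous_potential (measurable_excess_arg ht).
- move=> x _; have := potential_lipschitz hC (s * u t x - M) 0.
  rewrite (potential_le0 (lexx 0)) !subr0 => /le_trans; apply; rewrite ler_wpM2l//.
  by rewrite (le_trans (ler_normB _ _))// normrM s_norm mul1r.
- apply: integrable_scale => //; apply: integrable_add => //; first exact: integrable_norm (iu ht).
  by apply: integrable_cst_real => //; exact: lebesgue_domain_lty.
Qed.

Let Gamma_lipschitz (C t t' : R) : (forall x : R, `|cutoff x| <= C) ->
  0 <= t <= T -> 0 <= t' <= T ->
  Gamma t <= Gamma t' + C * \int[mu]_(x in Omega) `|u t x - u t' x|.
Proof.
move=> hC ht ht'; have idiff : mu.-integrable Omega (EFin \o (fun x => `|u t x - u t' x|)).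
  by have := integrable_norm (integrableB mO (iu ht) (iu ht')); congr integrable.
rewrite -RintegralZl// -RintegralD//; [|exact: iexcess|exact: integrable_scale].
apply: le_Rintegral => //; first exact: iexcess.
  by apply: integrable_add => //; [exact: iexcess|exact: integrable_scale].
move=> x _; rewrite -lerBlDl (le_trans (ler_norm _))//.
apply: le_trans (potential_lipschitz hC _ _) _; rewrite ler_wpM2l//.
  exact: le_trans (normr_ge0 _) (hC 0).
by rewrite (_ : _ - _ - _ = s * (u t x - u t' x)) ?normrM ?s_norm ?mul1r//; ring.
Qed.

Let measurable_tail K : measurable_fun (cylinder T Omega) (tail K).
Proof.
apply: measurable_maxr; last exact: measurable_cst.
apply: measurable_funB; last exact: measurable_cst.
by apply: measurableT_comp => //; exact: integrable_measurable idt.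
Qed.

Let tail_ge0 K z : 0 <= tail K z. Proof. by rewrite le_max lexx orbT. Qed.

Let tail_le K z : 0 <= K -> tail K z <= `|u' z.1 z.2|.
Proof. by move=> K0; rewrite ge_max normr_ge0 gerBl K0. Qed.

Let itail K : 0 <= K -> mu2.-integrable (cylinder T Omega) (EFin \o tail K).
Proof.
move=> K0; apply: (@le_integrable_real _ _ _ _ _ _ (fun z : Z => `|u' z.1 z.2|)) => //.
  by move=> z _; rewrite ger0_norm ?tail_le.
exact: integrable_norm idt.
Qed.

Let tail_cvg0 : \int[mu2]_(z in cylinder T Omega) tail n%:R z @[n --> \oo] --> (0 : R).
Proof.
have -> : (0 : R) = \int[mu2]_(z in cylinder T Omega) cst 0 z by rewrite Rintegral_cst// mul0r.
apply: (Rintegral_dominated (g := fun z : Z => `|u' z.1 z.2|)) => //.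
- move=> z _; apply: cvg_near_cst; near=> n; rewrite /tail; apply/max_idPr.
  by rewrite subr_le0; near: n; exact: nbhs_infty_ger.
- exact: integrable_norm idt.
- by move=> n z _; rewrite ger0_norm ?tail_le.
Unshelve. all: by end_near.
Qed.

(** The slice inequality involves [cutoff] at time t, convexity involves it at time b. Their
    difference is multiplied by |u_t| <= K + tail: against K it is bounded by the Lipschitz constant
    times |u(b) - u(t)|, against the tail merely by 2 C. *)
Let increment_le (C L K a b : R) : 0 <= K -> 0 <= C -> 0 <= L ->
  (forall x : R, `|cutoff x| <= C) ->
  (forall x y : R, `|cutoff x - cutoff y| <= L * `|x - y|) ->
  0 < a -> a < b -> b < T -> forall e : R,
  (forall t, a < t <= b -> \int[mu]_(x in Omega) `|u b x - u t x| <= e) ->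
  Gamma b - Gamma a <= K * L * e * (b - a) + 2 * C * \int[leb]_(t in `]a, b]) rho K t.
Proof.
move=> K0 C0 L0 hC hL a0 ab bT e he.
have b0 : 0 < b by exact: lt_trans ab.
have aT : a < T by exact: lt_trans bT.
have ha : 0 <= a <= T by rewrite !ltW.
have hb : 0 <= b <= T by rewrite !ltW.
have mab : measurable (`]a, b] : set (measurableTypeR R)) by exact: measurable_itv.
have sub : `]a, b]%classic `<=` (`]0, T[%classic : set R).
  by move=> t /=; rewrite !in_itv /= => /andP[h1 h2]; rewrite (lt_trans a0 h1) (le_lt_trans h2 bT).
pose k (x : E) : R := cutoff (s * u b x - M).
have mk : measurable_fun Omega k.
  exact: measurable_real_comp continuous_cutoff (measurable_excess_arg hb).
have islab := slab_dt_integrable Omega_open Omega_bounded p_gt1 uV a0 bT.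
have mk2 : measurable_fun (`]a, b] `*` Omega) (fun z : Z => s * k z.2).
  apply: measurable_funM => //.
  have sub2 : `]a, b]%classic `*` Omega `<=` cylinder T Omega by move=> z [h1 h2]; split => //; exact: sub.
  exact: (measurable_funS mC sub2 (measurable_cylinder_snd Omega_open mk)).
have bk (x : E) : `|s * k x| <= C by rewrite normrM s_norm mul1r; exact: hC.
have iku : mu2.-integrable (`]a, b] `*` Omega) (EFin \o (fun z : Z => s * k z.2 * u' z.1 z.2)).
  exact: (integrable_boundedM (measurableX mab mO) mk2 (fun z _ => bk z.2) islab).
have msk : measurable_fun Omega (fun x => s * k x) by exact: measurable_funM.
have ik (f : E -> R) : mu.-integrable Omega (EFin \o f) ->
    mu.-integrable Omega (EFin \o (fun x => s * k x * f x)).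
  by move=> hf; exact: (integrable_boundedM mO msk (fun x _ => bk x) hf).
have idiff : mu.-integrable Omega (EFin \o (fun x => u b x - u a x)).
  by have := integrableB mO (iu hb) (iu ha); congr integrable.
have step1 : Gamma b - Gamma a <= \int[mu]_(x in Omega) (s * k x * (u b x - u a x)).
  rewrite -RintegralB//; [|exact: iexcess|exact: iexcess].
  apply: le_Rintegral => //; last 2 first.
  - exact: ik.
  - move=> x _; apply: le_trans (potential_convex _ _) _.
    by rewrite le_eqVlt; apply/orP; left; apply/eqP; rewrite /k; ring.
  by have := integrableB mO (iexcess hb) (iexcess ha); congr integrable.
apply: (le_trans step1).
have inc := time_increment Omega_open Omega_bounded p_gt1 uV uC a0 ab bT.
(* The increment u(b) - u(a) becomes the time integral of u_t; the factor [k] does not depend on t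
   and enters that integral. *)
have -> : \int[mu]_(x in Omega) (s * k x * (u b x - u a x)) =
    \int[leb]_(t in `]a, b]) \int[mu]_(x in Omega) (s * k x * u' t x).
  rewrite -(fubini_rectangle mab mO iku) (fubini_rectangle2 mab mO iku).
  rewrite /Rintegral; congr fine; apply: ae_eq_integral => //.
  - exact: (measurable_int _ (ik _ idiff)).
  - exact: (measurable_int _ (fubini_rectangle_integrable2 mab mO iku)).
  have := ae_and inc (ae_integrable_slice2 mab mO islab).
  by apply: ae_imp => x [ix kx] Ox; congr EFin; rewrite ix// -RintegralZl//; exact: kx.
have irho : leb.-integrable `]a, b] (EFin \o rho K).
  apply: (integrableS mI mab sub).
  exact: (fubini_rectangle_integrable mI mO (itail K0)).
have ic : leb.-integrable `]a, b] (EFin \o (fun=> K * L * e)).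
  apply: integrable_cst_real => //.
  by rewrite (le_lt_trans _ (lebesgue_interval_lty T))// le_measure ?inE.
apply: (@le_trans _ _ (\int[leb]_(t in `]a, b]) (K * L * e + 2 * C * rho K t))); last first.
  rewrite RintegralD//; last exact: integrable_scale.
  have -> : \int[leb]_(t in `]a, b]) (K * L * e) = K * L * e * (b - a).
    by rewrite Rintegral_cst//= lebesgue_measure_itv /= lte_fin ab -EFinD.
  by rewrite RintegralZl.
apply: ae_le_Rintegral => //.
- exact: (fubini_rectangle_integrable mab mO iku).
- by apply: integrable_add => //; exact: integrable_scale.
have A1 := ae_integrable_slice mI mO idt.
have A2 := ae_integrable_slice mI mO (itail K0).
have := ae_and u_ineq (ae_and A1 A2); apply: ae_imp => t /= [q1 [q2 q3]] ht.
have ht' := sub _ ht; have {}q2 := q2 ht'; have {}q3 := q3 ht'.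
have htT : 0 < t < T by move: ht'; rewrite /= in_itv.
have htT' : 0 <= t <= T by case/andP: htT => h1 h2; rewrite !ltW.
have {}q1 := q1 htT.
pose kt (x : E) : R := cutoff (s * u t x - M).
have mkt : measurable_fun Omega kt.
  exact: measurable_real_comp continuous_cutoff (measurable_excess_arg htT').
have ikt : mu.-integrable Omega (EFin \o (fun x => u' t x * kt x)).
  under eq_fun do rewrite /= mulrC.
  exact: (integrable_boundedM mO mkt (fun x _ => hC _) q2).
have iskt : mu.-integrable Omega (EFin \o (fun x => s * (u' t x * kt x))) by exact: integrable_scale.
have iub : mu.-integrable Omega (EFin \o (fun x => `|u b x - u t x|)).
  by have := integrable_norm (integrableB mO (iu hb) (iu htT')); congr integrable.
have ir : mu.-integrable Omega (EFin \o (fun x => K * L * `|u b x - u t x| + 2 * C * tail K (t, x))).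
  by apply: integrable_add => //; exact: integrable_scale.
(* The first term of the bound is the quantity that the slice inequality makes nonpositive; the rest
   is the cost of exchanging [k] for [kt]. *)
apply: (@le_trans _ _ (\int[mu]_(x in Omega) (s * (u' t x * kt x) +
    (K * L * `|u b x - u t x| + 2 * C * tail K (t, x))))).
  apply: le_Rintegral => //; first exact: ik.
    exact: integrable_add.
  move=> x _; rewrite -lerBlDl.
  rewrite (_ : _ - _ = s * u' t x * (k x - kt x)); last by rewrite /k /kt; ring.
  rewrite (le_trans (ler_norm _))// !normrM s_norm mul1r.
  have d1 : `|k x - kt x| <= L * `|u b x - u t x| by exact: cutoff_arg_lipschitz.
  have d2 : `|k x - kt x| <= 2 * C.
    by rewrite (le_trans (ler_normB _ _))// mulr_natl mulr2n; apply: lerD; exact: hC.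
  have d3 : `|u' t x| <= K + tail K (t, x) by rewrite -lerBlDl le_max lexx.
  apply: (le_trans (ler_wpM2r (normr_ge0 _) d3)); rewrite mulrDl lerD//.
    by rewrite -mulrA ler_wpM2l.
  by rewrite mulrC ler_wpM2r.
rewrite RintegralD// RintegralZl// -[leRHS]add0r lerD//.
rewrite RintegralD//; [|exact: integrable_scale..].
rewrite !RintegralZl// lerD2r ler_wpM2l ?mulr_ge0//.
by apply: he; move: ht; rewrite /= in_itv.
Qed.

(** The level n is fixed first, to make the tail small over the whole cylinder; only then is the
    L^1-continuity of u used, near each time, against the factor K L determined by n. The allowed
    loss [d] is shared equally between the two errors. *)
Let Gamma_le (a b d : R) : 0 < a -> a <= b -> b < T -> 0 < d -> Gamma b <= Gamma a + d.
Proof.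
move=> a0 ab bT d0.
have [C C0 hC] := @cutoff_bounded R; have [L L0 hL] := @cutoff_lipschitz R.
have T0 : 0 < T by rewrite (lt_trans a0)// (le_lt_trans ab).
have C2 : 0 < 2 * C + 1 by rewrite ltr_wpDl// mulr_ge0.
have [n hn] : exists n : nat,
    \int[mu2]_(z in cylinder T Omega) tail n%:R z < d / 2 / (2 * C + 1).
  have e0 : 0 < d / 2 / (2 * C + 1) by rewrite !divr_gt0.
  move/cvgrPdist_lt : tail_cvg0 => /(_ _ e0) [n _ /(_ n (leqnn n))].
  by rewrite sub0r normrN => h; exists n; exact: le_lt_trans (ler_norm _) h.
pose K : R := n%:R.
have KL0 : 0 <= K * L by rewrite mulr_ge0// ler0n.
have KL1 : 0 < K * L + 1 by rewrite ltr_wpDl.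
(* A rate of loss per unit time: over ]0, T[ it amounts to at most d / 2. *)
pose eps := d / 2 / T.
have eps0 : 0 < eps by rewrite !divr_gt0.
have irho : leb.-integrable `]0, T[ (EFin \o rho K).
  exact: (fubini_rectangle_integrable mI mO (itail (ler0n _ n))).
have sub (x y : R) : 0 < x -> y < T -> `]x, y]%classic `<=` (`]0, T[%classic : set R).
  by move=> x0 yT t /=; rewrite !in_itv /= => /andP[h1 h2]; rewrite (lt_trans x0 h1) (le_lt_trans h2 yT).
have irho2 (x y : R) : 0 < x -> y < T -> leb.-integrable `]x, y] (EFin \o rho K).
  by move=> x0 yT; apply: (integrableS mI _ (sub _ _ x0 yT) irho); exact: measurable_itv.
have rho0 t : 0 <= rho K t by apply: Rintegral_ge0 => x _; exact: tail_ge0.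
(* Both errors are additive over intervals, so that after subtracting their accumulated amounts
   [increment_le] says that A does not increase over short intervals. *)
pose A t := Gamma t - eps * t - 2 * C * \int[leb]_(y in `]a, t]) rho K y.
have A_le : A b <= A a.
  apply: locally_nonincreasing => // t0 /andP[at0 t0b].
  have ht0 : 0 <= t0 <= T by rewrite (le_trans (ltW a0) at0) (le_trans t0b (ltW bT)).
  (* Both u(y) and u(t) are compared with u(t0), hence the half; the added 1 avoids a division by
     zero when K L = 0. *)
  have e'0 : 0 < eps / 2 / (K * L + 1) by rewrite !divr_gt0.
  have [r r0 hr] := C_L2_cvg_L1 Omega_open Omega_bounded uC ht0 e'0.
  exists r => // x y ax xy yb xr yr.
  have x0 : 0 < x by exact: lt_le_trans ax.
  have yT : y < T by exact: le_lt_trans bT.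
  have hy : 0 <= y <= T by rewrite (ltW (lt_trans x0 xy)) ltW.
  have := @increment_le C L K x y (ler0n _ n) C0 L0 hC hL x0 xy yT (eps / (K * L + 1)).
  have close t : x < t <= y ->
      \int[mu]_(z in Omega) `|u y z - u t z| <= eps / (K * L + 1).
    move=> /andP[xt ty].
    have ht : 0 <= t <= T by rewrite (ltW (lt_trans x0 xt)) (le_trans ty (ltW yT)).
    have tr : `|t - t0| < r.
      move: xr yr; rewrite !ltr_norml => /andP[h1 h2] /andP[h3 h4].
      rewrite (lt_le_trans h1) ?lerD2r ?(ltW xt)//=.
      by rewrite (le_lt_trans _ h4)// lerD2r.
    have i1 (c : R) : 0 <= c <= T -> mu.-integrable Omega (EFin \o (fun z => `|u c z - u t0 z|)).
      by move=> hc; have := integrable_norm (integrableB mO (iu hc) (iu ht0)); congr integrable.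
    have i2 : mu.-integrable Omega (EFin \o (fun z => `|u y z - u t z|)).
      by have := integrable_norm (integrableB mO (iu hy) (iu ht)); congr integrable.
    apply: (@le_trans _ _ (\int[mu]_(z in Omega) (`|u y z - u t0 z| + `|u t z - u t0 z|))).
      apply: le_Rintegral => //; first by apply: integrable_add => //; exact: i1.
      move=> z _; rewrite (_ : u y z - u t z = (u y z - u t0 z) - (u t z - u t0 z)); last by ring.
      exact: ler_normB.
    rewrite RintegralD//; [|exact: i1|exact: i1].
    have -> : eps / (K * L + 1) = eps / 2 / (K * L + 1) + eps / 2 / (K * L + 1).
      by rewrite -mulrDl; congr (_ / _); rewrite -splitr.
    by rewrite lerD// ltW// hr.
  move=> /(_ close) h.
  have hcoef : K * L * (eps / (K * L + 1)) * (y - x) <= eps * (y - x).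
    rewrite ler_wpM2r ?subr_ge0 ?(ltW xy)// mulrCA ler_piMr ?(ltW eps0)//.
    by rewrite ler_pdivrMr// mul1r lerDl.
  have hsplit : \int[leb]_(t in `]a, y]) rho K t =
      \int[leb]_(t in `]a, x]) rho K t + \int[leb]_(t in `]x, y]) rho K t.
    rewrite -(@Rintegral_itvB _ _ (BRight a) (BRight y) x) ?bnd_simp ?(ltW xy)//.
      by rewrite addrC subrK.
    exact: irho2.
  rewrite /A hsplit mulrDr.
  have {}h := le_trans h (lerD hcoef (lexx _)).
  by rewrite mulrBr in h; exact: le_sub_of_increment h.
have Iab : 2 * C * \int[leb]_(y in `]a, b]) rho K y <= d / 2.
  have hI : \int[leb]_(y in `]a, b]) rho K y <= \int[mu2]_(z in cylinder T Omega) tail n%:R z.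
    rewrite (fubini_rectangle mI mO (itail (ler0n _ n))).
    rewrite -lee_fin !fineK; [|exact: integrable_fin_num irho|].
    - have r0 y : `]0, T[%classic y -> (0 <= (EFin \o rho K) y)%E by rewrite lee_fin rho0.
      exact: (ge0_subset_integral leb (measurable_itv _) mI (measurable_int _ irho) r0 (sub _ _ a0 bT)).
    - by apply: integrable_fin_num (irho2 _ _ a0 bT); exact: measurable_itv.
  have I0 : 0 <= \int[mu2]_(z in cylinder T Omega) tail n%:R z.
    by apply: Rintegral_ge0 => z _; exact: tail_ge0.
  apply: (@le_trans _ _ ((2 * C + 1) * \int[mu2]_(z in cylinder T Omega) tail n%:R z)).
    by apply: ler_pM; rewrite ?mulr_ge0 ?lerDl// Rintegral_ge0.
  by rewrite mulrC -ler_pdivlMr// ltW.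
have Raa : \int[leb]_(y in `]a, a]) rho K y = 0 by rewrite set_itvoc0 Rintegral_set0.
have epsb : eps * b <= d / 2.
  by rewrite /eps -mulrA ler_piMr ?divr_ge0 ?(ltW d0)// mulrC ler_pdivrMr// mul1r ltW.
have epsa : 0 <= eps * a by rewrite mulr_ge0 ?ltW.
move: A_le; rewrite /A Raa mulr0 subr0 => h.
by rewrite (splitr d); exact: le_of_sub_le h Iab epsb epsa.
Qed.

(** [Gamma] is the integral of a function that is positive exactly where s u exceeds M; it vanishes
    at time 0 and has lost nothing of its nullity by time t. *)
Lemma comparison_principle (t : R) : 0 < t < T ->
  {ae mu, forall x, Omega x -> s * u 0 x <= M} ->
  {ae mu, forall x, Omega x -> s * u t x <= M}.
Proof.
move=> /andP[t0 tT] u0M.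
have T0 : 0 < T by exact: lt_trans tT.
have h0 : 0 <= (0 : R) <= T by rewrite lexx ltW.
have ht : 0 <= t <= T by rewrite !ltW.
have [C C0 hC] := @cutoff_bounded R.
have C1 : 0 < C + 1 by rewrite ltr_wpDl.
have G0 : Gamma 0 = 0.
  transitivity (\int[mu]_(x in Omega) (fun=> 0 : R) x); last by rewrite Rintegral_cst// mul0r.
  rewrite /Gamma /Rintegral; congr fine; apply: ae_eq_integral => //.
    exact: (measurable_int _ (iexcess h0)).
  apply: ae_imp u0M => x h /h hx; congr EFin.
  by rewrite /excess potential_le0// subr_le0.
have Gt : Gamma t <= 0.
  (* [Gamma_le] starts at positive times only. The gap between 0 and a small time [a] is bridged by
     the L^1-continuity at 0, with half of [d] for each of the two passages. *)
  apply/ler_addgt0Pr => d d0; rewrite add0r.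
  have d2 : 0 < d / 2 by rewrite divr_gt0.
  have [r r0 hr] := C_L2_cvg_L1 Omega_open Omega_bounded uC h0 (divr_gt0 d2 C1).
  pose a := Num.min t (r / 2).
  have a0 : 0 < a by rewrite lt_min t0 divr_gt0.
  have at_ : a <= t by rewrite ge_min lexx.
  have ha : 0 <= a <= T by rewrite (ltW a0) (le_trans at_ (ltW tT)).
  have ar : `|a - 0| < r.
    rewrite subr0 gtr0_norm// gt_min; apply/orP; right.
    by rewrite ltr_pdivrMr// mulr_natr mulr2n ltrDl.
  have h1 := Gamma_le a0 at_ tT d2.
  have h2 := Gamma_lipschitz hC ha h0; rewrite G0 add0r in h2.
  have h3 : C * \int[mu]_(x in Omega) `|u a x - u 0 x| <= d / 2.
    apply: (@le_trans _ _ ((C + 1) * \int[mu]_(x in Omega) `|u a x - u 0 x|)).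
      by rewrite ler_wpM2r ?lerDl// Rintegral_ge0.
    by rewrite mulrC -ler_pdivlMr// ltW// hr.
  by rewrite (splitr d); exact: le_trans h1 (lerD (le_trans h2 h3) (lexx _)).
have ige := iexcess ht.
have Iz : (\int[mu]_(x in Omega) (excess t x)%:E = 0)%E.
  have fn := integrable_fin_num mO ige.
  have := fineK fn; rewrite /= => <-; congr EFin; apply/eqP.
  by rewrite eq_le Gt /= Rintegral_ge0// => x _; exact: potential_ge0.
have Habs : (\int[mu]_(x in Omega) `|(EFin \o excess t) x| = 0)%E.
  rewrite -[RHS]Iz; apply: eq_integral => x _ /=.
  by rewrite ger0_norm// potential_ge0.
have [/(_ Habs) H _] := ae_eq_integral_abs mu mO (measurable_int _ ige).
apply: ae_imp H => x h Ox; have [hx] : (excess t x)%:E = (0 : R)%:E := h Ox.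
rewrite leNgt; apply/negP => sM.
have : 0 < potential (s * u t x - M) by rewrite potential_gt0// subr_gt0.
by rewrite -/(excess t x) hx ltxx.
Qed.

End comparison.

(** * The essential bound and the conclusion *)

Lemma Lp_infty_bound (R : realType) (G : stratified_group R)
    (Omega : set 'rV[R]_(topdim G)) (f : 'rV[R]_(topdim G) -> R) :
  Lp +oo%E Omega f -> exists M : R,
    {ae @lebesgue_rV R (topdim G), forall x, Omega x -> `|f x| <= M}.
Proof.
rewrite /Lp /= => /andP[_]; rewrite inE /finite_norm Lnorm.unlock /=.
case: ifPn => [_ foo|mu0 _]; last first.
  (* Degenerate branch of the norm: the whole space is null, and any bound holds almost
     everywhere. *)
  exists 0, setT; split => //; apply/eqP; rewrite eq_le measure_ge0 andbT.
  by rewrite leNgt.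
have [M hM] : exists M : R, (ess_sup_inf.ess_sup (@lebesgue_rV R (topdim G))
    (abse \o (EFin \o (f \_ Omega))) <= M%:E)%E.
  by move: foo; case: (ess_sup_inf.ess_sup _ _) => [r| |]// _; [exists r|exists 0; exact: leNye].
exists M; have := ess_sup_inf.ess_sup_ge (@lebesgue_rV R (topdim G)) (abse \o (EFin \o (f \_ Omega))).
apply: ae_imp => x hx Ox.
by have := le_trans hx hM; rewrite /= patchE mem_set.
Qed.

Theorem corollary3p1 (R : realType) (G : stratified_group R)
    (Omega : set 'rV[R]_(topdim G)) (p beta q : R)
    (u0 : 'rV[R]_(topdim G) -> R) (u : R -> 'rV[R]_(topdim G) -> R)
    (Omega_open : open Omega) (Omega_bounded : bounded_set Omega)
    (p_gt1 : 1 < p) (beta_gt0 : 0 < beta) (q_ge1 : 1 <= q)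
    (p_le_q : p <= q) (q_lt_beta1 : q < beta + 1)
    (u0_sobolev : S01p p Omega u0)
    (u0_bounded : Lp +oo%E Omega u0)
    (u0_ge0 : {ae @lebesgue_rV R (topdim G),
                forall x, Omega x -> 0 <= u0 x})
    (u0_neq0 : ~ {ae @lebesgue_rV R (topdim G),
                   forall x, Omega x -> u0 x = 0})
    (u_sol : weak_solution p beta q Omega u0 u) :
  exists M : R, forall t : R, 0 < t ->
    {ae @lebesgue_rV R (topdim G), forall x, Omega x -> `|u t x| <= M}.

Proof.
have [M0 u0M] := Lp_infty_bound u0_bounded.
(* The maximum with 1 puts the level in the range where the reaction has a sign; M is fixed before
   the time is. *)
pose M := Num.max 1 M0.
have M1 : 1 <= M by rewrite le_max lexx.
exists M => t t0.
(* Any horizon beyond t would do: t must be an interior time, and M does not depend on the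
   horizon. *)
have T0 : 0 < t + 1 by rewrite addr_gt0.
have [Du [u' [uV uC u0E u_eq]]] := u_sol _ T0.
have ht : 0 < t < t + 1 by rewrite t0 ltrDl ltr01.
have bound s : s = 1 \/ s = -1 ->
    {ae @lebesgue_rV R (topdim G), forall x, Omega x -> s * u t x <= M}.
  move=> hs; have s1 : `|s| = 1 by case: hs => ->; rewrite ?normrN normr1.
  apply: (comparison_principle Omega_open Omega_bounded p_gt1 uV uC s1 _ ht).
    exact: (ae_time_inequality Omega_open Omega_bounded p_gt1 q_lt_beta1 uV u_eq hs M1).
  apply: ae_imp (ae_and u0M u0E) => x [h1 h2] Ox; rewrite h2//.
  by rewrite (le_trans (ler_norm _))// normrM s1 mul1r (le_trans (h1 Ox))// le_max lexx orbT.
have b1 := bound 1 (or_introl erefl); have b2 := bound (-1) (or_intror erefl).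
apply: ae_imp (ae_and b1 b2) => x [h1 h2] Ox.
by have := h1 Ox; have := h2 Ox; rewrite mul1r mulN1r ler_norml lerNl => -> ->.
Qed.
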